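(* Let $\mathcal{F}=\{F_t\}_{t\ge0}$ be a semigroup of holomorphic self-mappings of a domain $\mathcal{D}$ in a complex Banach space $X$ satisfying condition ( * ) with limit point $x_0$ and generator $f$, where $f'(x_0)=-\omega\,\mathrm{Id}_X$ for some $\omega\in\mathbb{C}$. Let $\{\Gamma_t\}_{t\ge0}$ be a semicocycle over $\mathcal{F}$, with values in a complex unital Banach algebra $\mathcal{A}$, generated by a holomorphic $B:\mathcal{D}\to\mathcal{A}$, and let $B_0=B(x_0)$. If $$k\omega\notin\sigma(B_0)-\sigma(B_0)=\{\lambda-\lambda':\ \lambda,\lambda'\in\sigma(B_0)\}\quad\text{for all } k\in\mathbb{N},$$ then there is a holomorphic $M:\mathcal{D}\to\mathcal{A}_*$ with $\Gamma_t(x)=M(F_t(x))^{-1}e^{tB_0}M(x)$ for all $t\ge0$, $x\in\mathcal{D}$, and such $M$ normalized by $M(x_0)=1_{\mathcal A}$ is unique.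
   Context: Condition ( * ): $F_t(x)\to x_0\in\mathcal{D}$ as $t\to\infty$ uniformly on subsets strictly inside $\mathcal{D}$ (bounded subsets at positive distance from $\partial\mathcal{D}$), and $\mathcal{F}$ is generated by a holomorphic $f:\mathcal{D}\to X$ (i.e. $f(x)=\lim_{t\to0^+}\frac1t(F_t(x)-x)$ uniformly on subsets strictly inside $\mathcal{D}$) with $\kappa_+(f'(x_0))<0$, where $\kappa_+(a)=\limsup_{t\to\infty}\frac1t\log\|e^{ta}\|$. Semigroup: holomorphic self-maps $F_t$ with $F_{t+s}=F_t\circ F_s$, $F_t(x)\to x$ as $t\to0^+$. $\mathcal{A}$ has unit $1_{\mathcal A}$, $\|1_{\mathcal A}\|=1$; $\mathcal{A}_*$ = invertible elements; $\sigma(B_0)$ is the spectrum of $B_0$ in $\mathcal{A}$. Semicocycle: holomorphic $\Gamma_t:\mathcal{D}\to\mathcal{A}$ with $\Gamma_t(F_s(x))\Gamma_s(x)=\Gamma_{t+s}(x)$, $\Gamma_t(x)\to1_{\mathcal A}$ as $t\to0^+$; generated by $B$: $t\mapsto\Gamma_t(x)$ solves $\frac{dv}{dt}=B(F_t(x))v$, $v(0)=1_{\mathcal A}$. *)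

(* Defs.v *)
From HB Require Import structures.
From mathcomp Require Import all_boot all_order all_algebra.
From mathcomp Require Import complex.
From mathcomp Require Import all_classical all_reals all_analysis.
Import Order.TTheory GRing.Theory Num.Theory.
Import numFieldNormedType.Exports.

Set Implicit Arguments.
Unset Strict Implicit.
Unset Printing Implicit Defensive.

Local Open Scope classical_set_scope.
Local Open Scope ring_scope.
Local Open Scope complex_scope.

Definition holo (R : realType) (V W : normedModType R[i]) (D : set V)
  (g : V -> W) : Prop := forall x, D x -> differentiable g x.

Definition is_domain (R : realType) (V : normedModType R[i]) (D : set V) : Prop :=
  [/\ open D, connected D & D !=set0].

Definition strictly_inside (R : realType) (V : normedModType R[i])
  (D S : set V) : Prop :=
  [/\ S `<=` D,
      exists M : R, forall x, S x -> `|x| <= M%:C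
    & exists r : R, 0 < r /\
        forall x y, S x -> `|y - x| < r%:C -> D y].

Record banach_algebra (R : realType) (A : completeNormedModType R[i])
  (mul : A -> A -> A) (one : A) : Prop := BanachAlgebra {
  ba_mulA : forall a b c, mul a (mul b c) = mul (mul a b) c;
  ba_mul1l : forall a, mul one a = a;
  ba_mul1r : forall a, mul a one = a;
  ba_mulDl : forall a b c, mul (a + b) c = mul a c + mul b c;
  ba_mulDr : forall a b c, mul a (b + c) = mul a b + mul a c;
  ba_mulZl : forall (k : R[i]) a b, mul (k *: a) b = k *: mul a b;
  ba_mulZr : forall (k : R[i]) a b, mul a (k *: b) = k *: mul a b;
  ba_norm_mul : forall a b, `|mul a b| <= `|a| * `|b|;
  ba_norm1 : `|one| = 1 }.

Definition invertible (R : realType) (A : completeNormedModType R[i])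
  (mul : A -> A -> A) (one : A) (a : A) : Prop :=
  exists b, mul a b = one /\ mul b a = one.

(* the inverse a^{-1} (meaningful when a is invertible) *)
Definition ainv (R : realType) (A : completeNormedModType R[i])
  (mul : A -> A -> A) (one : A) (a : A) : A :=
  xget 0 [set b | mul a b = one /\ mul b a = one].

Definition spectrum (R : realType) (A : completeNormedModType R[i])
  (mul : A -> A -> A) (one : A) (a : A) : set R[i] :=
  [set l | ~ invertible mul one (a - l *: one)].

Definition apow (R : realType) (A : completeNormedModType R[i])
  (mul : A -> A -> A) (one : A) (a : A) (k : nat) : A :=
  iter k (mul a) one.

Definition aexp (R : realType) (A : completeNormedModType R[i])
  (mul : A -> A -> A) (one : A) (a : A) : A :=
  limn (series (fun k : nat => (k`!%:R)^-1 *: apow mul one a k)).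

Definition opexp (R : realType) (X : completeNormedModType R[i])
  (T : X -> X) (x : X) : X :=
  limn (series (fun k : nat => (k`!%:R)^-1 *: iter k T x)).

(* kappa_+(T) < 0, where kappa_+(T) = limsup_{t->oo} (1/t) log ||e^{tT}||:
   unfolded as: for some c < 0, eventually ||e^{tT}|| <= e^{ct}, the
   operator-norm inequality being written pointwise. *)
Definition kappa_plus_neg (R : realType) (X : completeNormedModType R[i])
  (T : X -> X) : Prop :=
  exists c : R, c < 0 /\ exists t0 : R, forall t : R, t0 <= t ->
    forall x : X, `|opexp (fun y => t%:C *: T y) x| <= (expR (c * t))%:C * `|x|.

Definition hol_semigroup (R : realType) (X : completeNormedModType R[i])
  (D : set X) (F : R -> X -> X) : Prop :=
  [/\ forall t, 0 <= t -> forall x, D x -> D (F t x),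
      forall t, 0 <= t -> holo D (F t),
      forall x, D x -> F 0 x = x,
      forall t s, 0 <= t -> 0 <= s -> forall x, D x -> F (t + s) x = F t (F s x)
    & forall x, D x -> F t x @[t --> 0^'+] --> x].

Definition condition_star (R : realType) (X : completeNormedModType R[i])
  (D : set X) (F : R -> X -> X) (x0 : X) (f : X -> X) : Prop :=
  [/\ D x0,
      forall S, strictly_inside D S -> forall e : R, 0 < e ->
        exists T : R, forall t, T <= t -> forall x, S x -> `|F t x - x0| < e%:C,
      holo D f,
      forall S, strictly_inside D S -> forall e : R, 0 < e ->
        exists d : R, 0 < d /\ forall t, 0 < t -> t < d -> forall x, S x ->
          `|(t%:C)^-1 *: (F t x - x) - f x| < e%:C
    & kappa_plus_neg ('d f x0 : X -> X)].

Definition semicocycle (R : realType) (X A : completeNormedModType R[i])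
  (mul : A -> A -> A) (one : A) (D : set X) (F : R -> X -> X)
  (Gamma : R -> X -> A) (B : X -> A) : Prop :=
  [/\ forall t, 0 <= t -> holo D (Gamma t),
      forall t s, 0 <= t -> 0 <= s -> forall x, D x ->
        mul (Gamma t (F s x)) (Gamma s x) = Gamma (t + s) x,
      forall x, D x -> Gamma t x @[t --> 0^'+] --> one,
      forall x, D x -> Gamma 0 x = one
    & holo D B /\ (* t |-> Gamma_t(x) solves dv/dt = B(F_t(x)) v on [0,oo)
         (one-sided derivative at t = 0) *)
      forall x, D x -> forall t, 0 <= t ->
        ((fun h : R => (h%:C)^-1 *: (Gamma (t + h) x - Gamma t x))
           @ within [set h : R | h != 0 /\ 0 <= t + h] (nbhs (0 : R)))
        --> mul (B (F t x)) (Gamma t x)].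

(* Main.v *)
(** In the coordinate [y = x - x0] the conjugation equation at a fixed time [t] reads
    [M y = e^{-tB0} M(Phi y) G y] with [Phi = F_t], [Phi'(0) = e^{-tw}] and
    [G = Gamma_t], [G 0 = e^{tB0}].  On the homogeneous part of degree [k] of [M] the
    right-hand side minus [M] acts as [e^{-tkw} e^{-tB0} P e^{tB0} - P], which for small
    [t] is [-t] times a perturbation of the Sylvester operator
    [P |-> (B0 + kw) P - P B0].  By Rosenblum's theorem the latter is invertible exactly
    because [kw] is not a difference of spectral values of [B0].  Hence the equation can
    be solved degree by degree, and its solution is unique modulo high order.  Since
    [|Phi'(0)| < 1], the right-hand side is a contraction on maps of high order, which
    gives local existence and uniqueness for a single small [t].  Uniform convergence
    [F_t -> x0] spreads the local solution over [D]; applying uniqueness to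
    [e^{-sB0} M(F_s x) Gamma_s x], another solution, yields the equation for all times [s]. *)

Require Import Defs.
From HB Require Import structures.
From mathcomp Require Import all_boot all_order all_algebra.
From mathcomp Require Import complex.
From mathcomp Require Import all_classical all_reals all_analysis.
From mathcomp Require Import ring lra.
Import Order.TTheory GRing.Theory Num.Theory.
Import numFieldNormedType.Exports.
Local Open Scope classical_set_scope.
Local Open Scope ring_scope.
Local Open Scope complex_scope.
Set Implicit Arguments.
Unset Strict Implicit.
Unset Printing Implicit Defensive.

(** * Real-valued norms and differentials *)

(** Holomorphy is only complex differentiability at every point, so each analytic fact is derived
    from Goursat's lemma, with finite dyadic Riemann sums in place of integrals and estimates with
    crude constants in place of formulas. The one-variable Cauchy estimate is stated for a
    relational seminorm because it serves twice: for the norm of a Banach space, and for the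
    distance of an operator on [A] from those that factor through the Sylvester operator. The second
    use gives Rosenblum's theorem by Liouville's argument. A homogeneous part is replaced by an
    order of vanishing at the fixed point: what matters of degree [k] is that replacing [y] by
    [d *: y] multiplies a map of order [k] by [d ^+ k], up to order [k.+1]. The order [N] at which
    contraction starts is fixed before the time [t], from the real part of [w] and the norm of [B0]
    alone, because [t] has to be small for the finitely many degrees below [N]. *)

Inductive lexp (K : Type) := LVar of nat | LZero | LAdd of lexp K & lexp K
  | LOpp of lexp K | LScale of K & lexp K.
Arguments LVar {K}. Arguments LZero {K}.

Section Lexp.
Variables (K : pzRingType) (E : lmodType K).

Fixpoint leval (env : seq E) (e : lexp K) : E :=
  match e with
  | LVar i => nth 0 env i
  | LZero => 0
  | LAdd e1 e2 => leval env e1 + leval env e2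
  | LOpp e1 => - leval env e1
  | LScale k e1 => k *: leval env e1
  end.

Fixpoint lcoef (i : nat) (e : lexp K) : K :=
  match e with
  | LVar j => if Nat.eqb j i then 1 else 0
  | LZero => 0
  | LAdd e1 e2 => lcoef i e1 + lcoef i e2
  | LOpp e1 => - lcoef i e1
  | LScale k e1 => k * lcoef i e1
  end.

Fixpoint lsame (n : nat) (e1 e2 : lexp K) : Prop :=
  if n is n'.+1 then lcoef n' e1 = lcoef n' e2 /\ lsame n' e1 e2 else True.

Lemma levalE env e : leval env e = \sum_(i < size env) lcoef i e *: nth 0 env i.
Proof.
elim: e => [j||e1 h1 e2 h2|e1 h1|k e1 h1] /=.
- have hE i : (if Nat.eqb j i then 1 else 0 : K) = (i == j)%:R.
    by rewrite -[Nat.eqb j i]/(j == i) eq_sym; case: (i == j).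
  under eq_bigr do rewrite hE.
  case: (ltnP j (size env)) => hj; last first.
    rewrite nth_default // big1 // => i _; case: eqP => [h|_]; last by rewrite scale0r.
    by move: hj; rewrite -h leqNgt ltn_ord.
  rewrite (bigD1 (Ordinal hj)) //= eqxx scale1r big1 ?addr0 // => i hi.
  case: eqP => [h|_]; last by rewrite scale0r.
  by move: hi; rewrite -val_eqE /= h eqxx.
- by rewrite big1 // => i _; rewrite scale0r.
- by rewrite h1 h2 -big_split; apply: eq_bigr => i _; rewrite scalerDl.
- by rewrite h1 -sumrN; apply: eq_bigr => i _; rewrite scaleNr.
- by rewrite h1 scaler_sumr; apply: eq_bigr => i _; rewrite scalerA.
Qed.

(** Reflection principle behind [lmod]: two linear combinations of the same vectors agree once their
    coefficients agree, which leaves one [ring] or [field] goal per vector. *)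
Lemma leval_eq env e1 e2 : lsame (size env) e1 e2 -> leval env e1 = leval env e2.
Proof.
move=> h; rewrite !levalE; apply: eq_bigr => i _; congr (_ *: _).
case: i => i /=; move: h; elim: (size env) => [|n ih] //= [h1 h2].
by rewrite ltnS leq_eqVlt => /predU1P[-> //|]; apply: ih.
Qed.
End Lexp.

Ltac lmem x l :=
  lazymatch l with
  | nil => constr:(false)
  | cons x _ => constr:(true)
  | cons _ ?l' => lmem x l'
  end.
Ltac lpos x l :=
  lazymatch l with
  | cons x _ => constr:(0%N)
  | cons _ ?l' => let n := lpos x l' in constr:(S n)
  end.
Ltac latoms t l :=
  lazymatch t with
  | (?x + ?y)%R => let l' := latoms x l in latoms y l'
  | (- ?x)%R => latoms x l
  | (_ *: ?x)%R => latoms x l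
  | 0%R => l
  | ?x => let b := lmem x l in
          lazymatch b with true => l | false => constr:(cons x l) end
  end.
Ltac lreify K t l :=
  lazymatch t with
  | (?x + ?y)%R => let a := lreify K x l in let b := lreify K y l in constr:(@LAdd K a b)
  | (- ?x)%R => let a := lreify K x l in constr:(@LOpp K a)
  | (?k *: ?x)%R => let a := lreify K x l in constr:(@LScale K k a)
  | 0%R => constr:(@LZero K)
  | ?x => let n := lpos x l in constr:(@LVar K n)
  end.
Ltac lsolve :=
  lazymatch goal with
  | |- True => exact I
  | |- _ /\ _ => split; [try first [by ring | by field] | lsolve]
  end.
Ltac lmod K E :=
  lazymatch goal with
  | |- ?t1 = ?t2 =>
    let l := latoms t1 (@nil E) in
    let l := latoms t2 l in
    let e1 := lreify K t1 l in
    let e2 := lreify K t2 l in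
    change (@leval _ _ l e1 = @leval _ _ l e2);
    apply: leval_eq;
    cbn [size lsame lcoef Nat.eqb];
    lsolve
  end.

(** The norm takes values in [R[i]]. It is always a nonnegative real ([normE]), so its real part
    carries all of it and makes real arithmetic such as [lra] available. *)
Definition nr (R : realType) (V : normedZmodType R[i]) (x : V) : R := complex.Re `|x|.

Section Nr.
Variable R : realType.
Implicit Type V : normedZmodType R[i].

Lemma normE V (x : V) : `|x| = (nr x)%:C.
Proof.
have := normr_ge0 x; rewrite /nr; case: (`|x|) => a b.
by rewrite lecE /= => /andP[/eqP -> _].
Qed.

Lemma nr_ge0 V (x : V) : 0 <= nr x.
Proof. by rewrite -lecR -normE normr_ge0. Qed.

Lemma nr0 V : nr (0 : V) = 0.
Proof. by rewrite /nr normr0. Qed.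

Lemma nr0_eq0 V (x : V) : nr x = 0 -> x = 0.
Proof. by move=> h; apply/eqP; rewrite -normr_eq0 normE h. Qed.

Lemma nr_gt0 V (x : V) : x != 0 -> 0 < nr x.
Proof.
move=> x0; rewrite lt_neqAle nr_ge0 andbT eq_sym; apply/eqP => /nr0_eq0 /eqP.
exact/negP.
Qed.

Lemma nrD V (x y : V) : nr (x + y) <= nr x + nr y.
Proof. by rewrite -lecR rmorphD /= -!normE ler_normD. Qed.

Lemma nrN V (x : V) : nr (- x) = nr x.
Proof. by rewrite /nr normrN. Qed.

Lemma nrB V (x y : V) : nr (x - y) <= nr x + nr y.
Proof. by rewrite -(nrN y) nrD. Qed.

Lemma nrC V (x y : V) : nr (x - y) = nr (y - x).
Proof. by rewrite -nrN opprB. Qed.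

Lemma nr_tri V (x y z : V) : nr (x - z) <= nr (x - y) + nr (y - z).
Proof. rewrite -(subrKA y). exact: nrD. Qed.

Lemma nrZ (V : normedModType R[i]) (k : R[i]) (x : V) : nr (k *: x) = nr k * nr x.
Proof.
apply/eqP; have : (nr (k *: x))%:C = (nr k * nr x)%:C.
  by rewrite rmorphM /= -!normE normrZ.
by move/(congr1 (@complex.Re R)) => /= ->.
Qed.

Lemma nrM (k l : R[i]) : nr (k * l) = nr k * nr l.
Proof.
have : (nr (k * l))%:C = (nr k * nr l)%:C by rewrite rmorphM /= -!normE normrM.
by move/(congr1 (@complex.Re R)).
Qed.

Lemma nrR (a : R) : nr (a%:C) = `|a|.
Proof. by rewrite /nr normc_def /= expr0n /= addr0 sqrtr_sqr. Qed.

Lemma nrV (k : R[i]) : nr k^-1 = (nr k)^-1.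
Proof.
have [->|k0] := eqVneq k 0; first by rewrite invr0 nr0 invr0.
have h : nr k * nr k^-1 = 1 by rewrite -nrM divff // -[1 : R[i]]/(1%:C) nrR normr1.
have h0 : nr k != 0 by apply/eqP => h0; move: h; rewrite h0 mul0r => /esym/eqP; rewrite oner_eq0.
by apply: (mulfI h0); rewrite h divff.
Qed.

Lemma nr1 : nr (1 : R[i]) = 1.
Proof. by rewrite -[1 : R[i]]/(1%:C) nrR normr1. Qed.

Lemma nri : nr ('i : R[i]) = 1.
Proof. by rewrite /nr normc_def /= expr0n /= add0r expr1n sqrtr1. Qed.

Lemma nr_Re (k : R[i]) : `|complex.Re k| <= nr k.
Proof.
rewrite /nr normc_def /= -sqrtr_sqr; apply: ler_wsqrtr.
by rewrite lerDl sqr_ge0.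
Qed.

Lemma nr_Im (k : R[i]) : `|complex.Im k| <= nr k.
Proof.
rewrite /nr normc_def /= -sqrtr_sqr; apply: ler_wsqrtr.
by rewrite lerDr sqr_ge0.
Qed.

Lemma nr_ReIm (k : R[i]) : nr k <= `|complex.Re k| + `|complex.Im k|.
Proof.
rewrite {1}(complexE k); apply: le_trans (nrD _ _) _.
by rewrite nrM nri mul1r !nrR.
Qed.

Lemma nbhs_nrP (V : normedModType R[i]) (x : V) (P : set V) :
  nbhs x P <-> exists2 d : R, 0 < d & forall y, nr (y - x) < d -> P y.
Proof.
split.
  case/nbhs_ballP => e e0 he.
  have [eR1 eR2] : e = (complex.Re e)%:C /\ 0 < complex.Re e.
    move: e0; case: (e) => a b; rewrite /= ltcE /= => /andP[/eqP -> ->]; by split.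
  exists (complex.Re e) => // y yx; apply: he.
  by rewrite -ball_normE /= distrC normE eR1 ltcR.
case=> d d0 hd; apply/nbhs_ballP; exists (d%:C); first by rewrite /= ltcR.
by move=> y; rewrite -ball_normE /= distrC normE ltcR => /hd.
Qed.

(* ['d g x] is a choice operator whose unfolding makes failed unifications
   diverge; [dif g x] is the same map behind an opaque proof. *)
Fact dif_sig (V W : normedModType R[i]) (g : V -> W) (x : V) :
  {D : V -> W | D = 'd g x :> (V -> W)}.
Proof. by exists ('d g x). Qed.

Definition dif (V W : normedModType R[i]) (g : V -> W) (x : V) : V -> W :=
  sval (dif_sig g x).

Lemma difE (V W : normedModType R[i]) (g : V -> W) (x : V) :
  dif g x = 'd g x :> (V -> W).
Proof. exact: (svalP (dif_sig g x)). Qed.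

Lemma difD (V W : normedModType R[i]) (g : V -> W) x u v :
  dif g x (u + v) = dif g x u + dif g x v.
Proof. by rewrite difE linearD. Qed.

Lemma difZ (V W : normedModType R[i]) (g : V -> W) x k v :
  dif g x (k *: v) = k *: dif g x v.
Proof. by rewrite difE linearZ. Qed.

Lemma dif0 (V W : normedModType R[i]) (g : V -> W) x : dif g x 0 = 0.
Proof. by rewrite difE linear0. Qed.

Lemma differentiableEP (V W : normedModType R[i]) (f : V -> W) (x : V) :
  differentiable f x ->
  (exists2 c : R, 0 < c & forall v, nr (dif f x v) <= c * nr v) /\
  forall e : R, 0 < e -> exists2 d : R, 0 < d & forall h, nr h < d ->
    nr (f (x + h) - f x - dif f x h) <= e * nr h.
Proof.
move=> df; rewrite difE; split.
  have := linear_lipschitz (diff_continuous df).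
  case=> k [k0 hk]; have [kR1 kR2] : k = (complex.Re k)%:C /\ 0 < complex.Re k.
    by move: k0; case: (k) => a b; rewrite /= ltcE /= => /andP[/eqP -> ->].
  exists (complex.Re k) => // v; rewrite -lecR rmorphM /= -!normE -kR1; exact: hk.
move=> e e0.
have := @diff_locally _ _ _ x f df; move/eqaddoP => /(_ e%:C).
rewrite ltcR => /(_ e0) /nbhs_nrP[d d0 hd]; exists d => // h hh.
have := hd h; rewrite subr0 => /(_ hh) /=.
have -> : (f \o shift x - (cst (f x) + 'd f x)) h = f (x + h) - f x - 'd f x h.
  by rewrite [x + h]addrC -addrA -opprD.
by rewrite !normE -rmorphM lecR.
Qed.

(** Converse of [differentiableEP]. The bound on [L] makes it continuous, which is what uniqueness
    of the differential requires. *)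
Lemma differentiableI (V W : normedModType R[i]) (f : V -> W) (x : V) (L : V -> W)
    (c : R) :
  (forall k u v, L (k *: u + v) = k *: L u + L v) ->
  (forall v, nr (L v) <= c * nr v) ->
  (forall e : R, 0 < e -> exists2 d : R, 0 < d & forall h, nr h < d ->
    nr (f (x + h) - f x - L h) <= e * nr h) ->
  differentiable f x /\ dif f x = L :> (V -> W).
Proof.
move=> Llin Lb hL.
pose LL : {linear V -> W} := HB.pack L (GRing.isLinear.Build _ _ _ _ L Llin).
have Lc : continuous LL.
  move=> y P; rewrite /= => /nbhs_nrP[d d0 hd]; apply/nbhs_nrP.
  (* The sign of [c] is unknown; [|c| + 1] is a positive Lipschitz constant in any case. *)
  exists (d / (`|c| + 1)); first by rewrite divr_gt0 // ltr_wpDl.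
  move=> z zy; apply: hd; have -> : LL z - LL y = LL (z - y) by rewrite linearB.
  apply: le_lt_trans (Lb _) _.
  apply: (@le_lt_trans _ _ ((`|c| + 1) * nr (z - y))).
    by rewrite ler_wpM2r ?nr_ge0 //; apply: le_trans (ler_norm c) _; rewrite lerDl.
  by rewrite mulrC -ltr_pdivlMr // ltr_wpDl.
have ho : f \o shift x = cst (f x) + LL +o_ 0 id.
  apply/eqaddoP => e e0.
  have [eR1 eR2] : e = (complex.Re e)%:C /\ 0 < complex.Re e.
    by move: e0; case: (e) => a b; rewrite /= ltcE /= => /andP[/eqP -> ->].
  have [d d0 hd] := hL _ eR2; apply/nbhs_nrP; exists d => // h; rewrite subr0 => hh.
  have -> : (f \o shift x - (cst (f x) + LL)) h = f (x + h) - f x - L h.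
    by rewrite [x + h]addrC -addrA -opprD.
  by have := hd h hh; rewrite -lecR rmorphM /= -!normE -eR1.
have E := diff_unique Lc ho; rewrite difE; split => //.
by apply/diff_locallyP; rewrite E.
Qed.

End Nr.

(** * Goursat's lemma on squares, by bisection *)

Section Cousin.
Variable R : realType.

Lemma half_pow_small (l0 d : R) : 0 < l0 -> 0 < d -> exists n : nat, l0 / 2 ^+ n < d.
Proof.
move=> l00 d0; have [n hn] : exists n : nat, l0 / d < n%:R.
  exists (Num.truncn (l0 / d)).+1; exact: truncnS_gt.
exists n; rewrite ltr_pdivrMr ?exprn_gt0 // mulrC -ltr_pdivrMr //.
apply: lt_trans hn _; rewrite -natrX ltr_nat; exact: ltn_expl.
Qed.

Lemma nested_point (u v : nat -> R) :
  (forall n, u n <= u n.+1) -> (forall n, v n.+1 <= v n) -> (forall n, u n <= v n) ->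
  exists a, forall n, u n <= a <= v n.
Proof.
move=> hu hv huv.
have hu' m n : (m <= n)%N -> u m <= u n.
  by move=> /subnK <-; elim: (n - m)%N => [|k ih] //; rewrite addSn; apply: le_trans ih (hu _).
have hv' m n : (m <= n)%N -> v n <= v m.
  by move=> /subnK <-; elim: (n - m)%N => [|k ih] //; rewrite addSn; apply: le_trans (hv _) ih.
have huv' m n : u m <= v n.
  apply: (@le_trans _ _ (u (maxn m n))); first by rewrite hu' ?leq_maxl.
  by apply: le_trans (huv _) _; rewrite hv' ?leq_maxr.
exists (sup (range u)) => n; apply/andP; split.
  apply: sup_upper_bound; last by exists n.
  split; first by exists (u 0), 0.
  by exists (v 0) => _ [m _ <-].
apply: ge_sup; first by exists (u 0), 0.
by move=> _ [m _ <-].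
Qed.

(** Compactness as an induction principle. If the property failed, one of the four quarters would
    fail again and again; the nested bad squares shrink to a point, near which all small squares are
    good. Goursat's lemma uses it on squares, and its segment version covers segments and time
    intervals. *)
Lemma cousin_square (G : R -> R -> R -> Prop) (x0 y0 l0 : R) : 0 < l0 ->
  (forall x y l, 0 < l -> G x y (l / 2) -> G (x + l / 2) y (l / 2) ->
    G x (y + l / 2) (l / 2) -> G (x + l / 2) (y + l / 2) (l / 2) -> G x y l) ->
  (forall a b, x0 <= a <= x0 + l0 -> y0 <= b <= y0 + l0 ->
    exists2 d, 0 < d & forall x y l, 0 < l < d -> x <= a <= x + l -> y <= b <= y + l ->
      x0 <= x -> x + l <= x0 + l0 -> y0 <= y -> y + l <= y0 + l0 -> G x y l) ->
  G x0 y0 l0.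
Proof.
move=> l00 Gsub Gloc; apply: contrapT => nG.
pose child (p q : R * R * R) :=
  [/\ q.2 = p.2 / 2, p.1.1 <= q.1.1, q.1.1 + q.2 <= p.1.1 + p.2, p.1.2 <= q.1.2
    & q.1.2 + q.2 <= p.1.2 + p.2].
pose bad (p : R * R * R) := ~ G p.1.1 p.1.2 p.2.
(* A bad quarter if there is one, and [p] itself otherwise; [nextP] shows that the default never
   occurs on a bad square. *)
pose next (p : R * R * R) := xget p [set q | child p q /\ bad q].
have nextP p : 0 < p.2 -> bad p -> child p (next p) /\ bad (next p).
  case: p => [[x y] l] /= l1 bp; apply: contrapT => hc; apply: bp => /=.
  have hG q : child (x, y, l) q -> G q.1.1 q.1.2 q.2.
    move=> cq; apply: contrapT => bq; apply: hc.
    by rewrite /next; case: xgetP => [r _ //|/(_ q)]; case.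
  apply: Gsub => //.
  - by apply: (hG (x, y, l / 2)); split => //=; lra.
  - by apply: (hG (x + l / 2, y, l / 2)); split => //=; lra.
  - by apply: (hG (x, y + l / 2, l / 2)); split => //=; lra.
  - by apply: (hG (x + l / 2, y + l / 2, l / 2)); split => //=; lra.
pose s n := iter n next (x0, y0, l0).
have sP n : [/\ bad (s n), 0 < (s n).2 & (s n).2 = l0 / 2 ^+ n].
  elim: n => [|n [bn pn en]]; first by split=> //=; rewrite expr0 divr1.
  have [[c _ _ _ _] b] := nextP _ pn bn; split => //=; first by rewrite c; lra.
  by rewrite c en exprSr invfM mulrA.
have sC n : child (s n) (s n.+1) by have [bn pn _] := sP n; have [] := nextP _ pn bn.
have [a ha] : exists a, forall n, (s n).1.1 <= a <= (s n).1.1 + (s n).2.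
  apply: nested_point => n; have [] := sC n => // *.
  by rewrite lerDl ltW //; have [] := sP n.
have [b hb] : exists b, forall n, (s n).1.2 <= b <= (s n).1.2 + (s n).2.
  apply: nested_point => n; have [] := sC n => // *.
  by rewrite lerDl ltW //; have [] := sP n.
have [d d0 hd] := Gloc a b (ha 0) (hb 0).
have [n hn] := half_pow_small l00 d0.
have [bn pn en] := sP n; apply: bn.
have hin m : [/\ x0 <= (s m).1.1, (s m).1.1 + (s m).2 <= x0 + l0, y0 <= (s m).1.2
    & (s m).1.2 + (s m).2 <= y0 + l0].
  elim: m => [|m [h1 h2 h3 h4]]; first by split.
  by have [_ c1 c2 c3 c4] := sC m; split; lra.
have [h1 h2 h3 h4] := hin n.
by apply: hd => //; rewrite pn en.
Qed.

Lemma cousin_segment (G : R -> R -> Prop) (x0 l0 : R) : 0 < l0 ->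
  (forall x l, 0 < l -> G x (l / 2) -> G (x + l / 2) (l / 2) -> G x l) ->
  (forall a, x0 <= a <= x0 + l0 ->
    exists2 d, 0 < d & forall x l, 0 < l < d -> x <= a <= x + l ->
      x0 <= x -> x + l <= x0 + l0 -> G x l) ->
  G x0 l0.
Proof.
move=> l00 Gsub Gloc; apply: (@cousin_square (fun x _ l => G x l) x0 0 l0) => //.
  by move=> x y l l1 h1 h2 _ _; apply: Gsub.
move=> a b ha _; have [d d0 hd] := Gloc a ha; exists d => // x y l h1 h2 _ h3 h4 _ _.
exact: hd.
Qed.

End Cousin.

(* [N x c]: the seminorm of [x] is at most [c]; a relation, so that it covers the
   distance to a set of operators without choosing an infimum *)
Record seminorm_bound (R : realType) (E : lmodType R[i]) (N : E -> R -> Prop) : Prop :=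
  SeminormBound {
  sb_le : forall x c c', c <= c' -> N x c -> N x c';
  sb_ge0 : forall x c, N x c -> 0 <= c;
  sb_0 : N 0 0;
  sb_D : forall x y c c', N x c -> N y c' -> N (x + y) (c + c');
  sb_Z : forall k x c, N x c -> N (k *: x) (nr k * c) }.

(** * Dyadic Riemann sums along segments and squares *)

Section Seg.
Variables (R : realType) (E : lmodType R[i]).
Implicit Types (f g : R[i] -> E) (z u w : R[i]) (m : nat).

(* the mean of [f] over the [2^m] left endpoints of the dyadic subdivision of [z, z + u] *)
Fixpoint seg f m z u : E :=
  if m is m'.+1 then (2^-1 : R[i]) *: (seg f m' z (u / 2) + seg f m' (z + u / 2) (u / 2))
  else f z.

Lemma seg_convex f m z u (P : E -> Prop) :
  (forall x y, P x -> P y -> P ((2^-1 : R[i]) *: (x + y))) ->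
  (forall s : R, 0 <= s <= 1 -> P (f (z + s%:C * u))) -> P (seg f m z u).
Proof.
move=> Pc; elim: m z u => [|m ih] z u hP /=.
  by have := hP 0; rewrite mul0r addr0; apply; rewrite lexx ler01.
have hc : (2^-1 : R[i]) = (2^-1 : R)%:C by rewrite fmorphV rmorph_nat.
apply: Pc; apply: ih => s /andP[s0 s1].
  have -> : z + s%:C * (u / 2) = z + (s / 2)%:C * u by rewrite rmorphM /= -hc; ring.
  by apply: hP; apply/andP; split; lra.
have -> : z + u / 2 + s%:C * (u / 2) = z + ((s + 1) / 2)%:C * u.
  by rewrite rmorphM rmorphD /= -hc; ring.
by apply: hP; apply/andP; split; lra.
Qed.

Lemma seg_linear f g (k : R[i]) m z u :
  seg (fun y => k *: f y + g y) m z u = k *: seg f m z u + seg g m z u.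
Proof. by elim: m z u => [|m ih] z u //=; rewrite !ih; lmod (R[i]) E. Qed.

Lemma seg_translate (a b : E) m z u w :
  seg (fun y => y *: a + b) m (z + w) u = seg (fun y => y *: a + b) m z u + w *: a.
Proof.
elim: m z u => [|m ih] z u /=; first by lmod (R[i]) E.
have -> : z + w + u / 2 = z + u / 2 + w by ring.
rewrite !ih; lmod (R[i]) E.
Qed.

(* dyadic Riemann sum of [f] along the boundary of the square with corner [z] and side [l] *)
Definition contour f m z (l : R) : E :=
  l%:C *: (seg f m z l%:C - seg f m (z + 'i * l%:C) l%:C +
    'i *: (seg f m (z + l%:C) ('i * l%:C) - seg f m z ('i * l%:C))).

Lemma contour_linear f g (k : R[i]) m z l :
  contour (fun y => k *: f y + g y) m z l = k *: contour f m z l + contour g m z l.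
Proof. by rewrite /contour !seg_linear; lmod (R[i]) E. Qed.

(** Exact for every [m]: an edge sum at depth [m.+1] is the mean of its two halves at depth [m], and
    each inner edge is met twice with opposite signs. *)
Lemma contour_split f m z l : contour f m.+1 z l =
  contour f m z (l / 2) + contour f m (z + (l / 2)%:C) (l / 2) +
  (contour f m (z + 'i * (l / 2)%:C) (l / 2) +
   contour f m (z + 'i * (l / 2)%:C + (l / 2)%:C) (l / 2)).
Proof.
rewrite /contour /=.
have hl : l%:C = (l / 2)%:C + (l / 2)%:C by rewrite -rmorphD /=; congr (_%:C); lra.
set h := (l / 2)%:C in hl *; rewrite hl.
have -> : (h + h) / 2 = h by field.
have -> : 'i * (h + h) / 2 = 'i * h by field.
have -> : 'i * (h + h) = 'i * h + 'i * h by ring.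
have -> : z + ('i * h + 'i * h) + h = z + 'i * h + h + 'i * h by ring.
have -> : z + ('i * h + 'i * h) = z + 'i * h + 'i * h by ring.
have -> : z + (h + h) = z + h + h by ring.
have -> : z + h + h + 'i * h = z + 'i * h + h + h by ring.
have -> : z + h + 'i * h = z + 'i * h + h by ring.
lmod (R[i]) E.
Qed.

(** Opposite edges differ by a translation, which shifts the mean by a multiple of [a]; the two
    pairs of edges contribute opposite amounts. *)
Lemma contour_affine (a b : E) m z l :
  contour (fun y => y *: a + b) m z l = 0.
Proof. by rewrite /contour !seg_translate; lmod (R[i]) E. Qed.

End Seg.

Section Goursat.
Variable R : realType.

Lemma ReD (a b : R[i]) : complex.Re (a + b) = complex.Re a + complex.Re b.
Proof. by case: a => ? ?; case: b => ? ?. Qed.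
Lemma ImD (a b : R[i]) : complex.Im (a + b) = complex.Im a + complex.Im b.
Proof. by case: a => ? ?; case: b => ? ?. Qed.
Lemma ReN (a : R[i]) : complex.Re (- a) = - complex.Re a.
Proof. by case: a => ? ?. Qed.
Lemma ImN (a : R[i]) : complex.Im (- a) = - complex.Im a.
Proof. by case: a => ? ?. Qed.
Lemma ReMr (r : R) (a : R[i]) : complex.Re (r%:C * a) = r * complex.Re a.
Proof. by case: a => ? ? /=; rewrite mul0r subr0. Qed.
Lemma ImMr (r : R) (a : R[i]) : complex.Im (r%:C * a) = r * complex.Im a.
Proof. by case: a => ? ? /=; rewrite mul0r addr0. Qed.
Lemma ReMi (a : R[i]) : complex.Re ('i * a) = - complex.Im a.
Proof. by case: a => ? ? /=; rewrite mul0r mul1r add0r. Qed.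
Lemma ImMi (a : R[i]) : complex.Im ('i * a) = complex.Re a.
Proof. by case: a => ? ? /=; rewrite mul0r mul1r add0r. Qed.
Definition reimE := (ReD, ImD, ReN, ImN, ReMr, ImMr, ReMi, ImMi).

Definition in_square (x y l : R) (p : R[i]) : Prop :=
  x <= complex.Re p <= x + l /\ y <= complex.Im p <= y + l.

Definition on_edge (x y l : R) (p : R[i]) : Prop :=
  in_square x y l p /\ (complex.Re p = x \/ complex.Re p = x + l \/
                        complex.Im p = y \/ complex.Im p = y + l).

Variables (E : lmodType R[i]) (N : E -> R -> Prop).
Hypothesis SN : seminorm_bound N.

(** Complex derivative relative to the seminorm [N], hence determined only modulo elements of
    seminorm zero. The finiteness clauses are there because [N x c] may fail for every [c]. *)
Definition bder (f : R[i] -> E) (z : R[i]) (a : E) : Prop :=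
  [/\ exists c, N (f z) c, exists c, N a c
    & forall e : R, 0 < e -> exists2 d : R, 0 < d & forall h : R[i], nr h < d ->
        N (f (z + h) - f z - h *: a) (e * nr h)].

Lemma sb_N x c : N x c -> N (- x) c.
Proof. by move=> h; rewrite -scaleN1r; have := sb_Z SN (-1) h; rewrite nrN nr1 mul1r. Qed.

Lemma sb_B x y c c' : N x c -> N y c' -> N (x - y) (c + c').
Proof. by move=> h /sb_N; apply: (sb_D SN). Qed.

Lemma seg_bound f m z u c : (forall s : R, 0 <= s <= 1 -> N (f (z + s%:C * u)) c) ->
  N (seg f m z u) c.
Proof.
apply: (@seg_convex _ _ _ _ _ _ (fun x => N x c)) => x y hx hy.
have := sb_Z SN (2^-1 : R[i]) (sb_D SN hx hy); apply: (sb_le SN).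
have -> : (2^-1 : R[i]) = (2^-1 : R)%:C by rewrite fmorphV rmorph_nat.
rewrite nrR ger0_norm ?invr_ge0 //; lra.
Qed.

Lemma contour_bound f m x y l c : 0 <= l ->
  (forall p, on_edge x y l p -> N (f p) c) -> N (contour f m (x +i* y) l) (4 * l * c).
Proof.
move=> l0 hf.
have hs z u : (forall s : R, 0 <= s <= 1 -> on_edge x y l (z + s%:C * u)) ->
    N (seg f m z u) c by move=> h; apply: seg_bound => s /h; apply: hf.
have hb (s : R) : 0 <= s <= 1 -> 0 <= s * l <= l.
  by move=> /andP[s0 s1]; rewrite mulr_ge0 //= ler_piMl.
have h1 : N (seg f m (x +i* y) l%:C) c.
  apply: hs => s /hb hsl; split; first by rewrite /in_square !reimE /=; split; lra.
  by right; right; left; rewrite !reimE /=; lra.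
have h2 : N (seg f m (x +i* y + 'i * l%:C) l%:C) c.
  apply: hs => s /hb hsl; split; first by rewrite /in_square !reimE /=; split; lra.
  by right; right; right; rewrite !reimE /=; lra.
have h3 : N (seg f m (x +i* y) ('i * l%:C)) c.
  apply: hs => s /hb hsl; split; first by rewrite /in_square !reimE /=; split; lra.
  by left; rewrite !reimE /=; lra.
have h4 : N (seg f m (x +i* y + l%:C) ('i * l%:C)) c.
  apply: hs => s /hb hsl; split; first by rewrite /in_square !reimE /=; split; lra.
  by right; left; rewrite !reimE /=; lra.
have := sb_Z SN l%:C (sb_D SN (sb_B h1 h2) (sb_Z SN 'i (sb_B h4 h3))).
by apply: (sb_le SN); rewrite nrR ger0_norm // nri; lra.
Qed.

Lemma in_square_dist x y l p q : in_square x y l p -> in_square x y l q ->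
  nr (p - q) <= 2 * l.
Proof.
move=> [/andP[? ?] /andP[? ?]] [/andP[? ?] /andP[? ?]].
apply: le_trans (nr_ReIm _) _; rewrite !reimE.
have : `|complex.Re p - complex.Re q| <= l by rewrite ler_norml; apply/andP; split; lra.
have : `|complex.Im p - complex.Im q| <= l by rewrite ler_norml; apply/andP; split; lra.
lra.
Qed.

(** Affine parts contribute nothing, so on a small square only the first-order remainder is left.
    The bound holds from some depth [M] on, since each bisection consumes one level of the
    subdivision. *)
Lemma goursat f x y l : 0 < l ->
  (forall p, in_square x y l p -> exists a, bder f p a) ->
  forall e : R, 0 < e -> exists M : nat, forall m, (M <= m)%N ->
    N (contour f m (x +i* y) l) (e * l ^+ 2).
Proof.
move=> l0 df e e0.
apply: (@cousin_square R (fun x y l => exists M : nat, forall m, (M <= m)%N ->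
    N (contour f m (x +i* y) l) (e * l ^+ 2))) => // [x' y' l' l'0 |a b ha hb].
  case=> [M1 h1] [M2 h2] [M3 h3] [M4 h4].
  exists (maxn (maxn M1 M2) (maxn M3 M4)).+1 => -[//|m].
  rewrite ltnS !geq_max => /andP[/andP[m1 m2] /andP[m3 m4]].
  rewrite contour_split.
  have -> : x' +i* y' + (l' / 2)%:C = (x' + l' / 2) +i* y'.
    by apply/eqP; rewrite eq_complex /= addr0 !eqxx.
  have -> : x' +i* y' + 'i * (l' / 2)%:C = x' +i* (y' + l' / 2).
    by apply/eqP; rewrite eq_complex /=; apply/andP; split; apply/eqP; lra.
  have -> : x' +i* (y' + l' / 2) + (l' / 2)%:C = (x' + l' / 2) +i* (y' + l' / 2).
    by apply/eqP; rewrite eq_complex /= addr0 !eqxx.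
  have := sb_D SN (sb_D SN (h1 m m1) (h2 m m2)) (sb_D SN (h3 m m3) (h4 m m4)).
  by apply: (sb_le SN); rewrite expr_div_n; lra.
have [al [_ _ hal]] := df (a +i* b) (conj ha hb).
(* Points of a square of side [l'] are at most [2 * l'] apart and its boundary has length [4 * l'],
   so a remainder of slope [e / 8] adds up to [e * l' ^+ 2]. *)
have [d d0 hd] := hal (e / 8) (divr_gt0 e0 (ltr0n _ 8)).
exists (d / 2) => [|x' y' l' /andP[l'0 l'd] ha' hb' hx1 hx2 hy1 hy2]; first by lra.
exists 0 => m _.
set p := a +i* b in hd.
have ip : in_square x' y' l' p by split.
pose g q := (1 : R[i]) *: (f q - f p - (q - p) *: al) + (q *: al + (f p - p *: al)).
have -> : f = g.
  by apply: funext => q; rewrite /g; lmod (R[i]) E.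
rewrite /g contour_linear contour_affine addr0 scale1r.
have : N (contour (fun q => f q - f p - (q - p) *: al) m (x' +i* y') l')
    (4 * l' * (e / 8 * (2 * l'))).
  apply: contour_bound => [|q [iq _]]; first exact: ltW.
  have hq := in_square_dist iq ip.
  have := hd (q - p); rewrite [p + _]addrC subrK => hh.
  apply: (sb_le SN) (hh _); last by apply: le_lt_trans hq _; lra.
  by apply: ler_wpM2l => //; lra.
by apply: (sb_le SN); rewrite expr2; lra.
Qed.

End Goursat.

(** * Cauchy estimates *)

Section Cauchy.
Variable R : realType.
Variables (E : lmodType R[i]) (N : E -> R -> Prop).
Hypothesis SN : seminorm_bound N.
Implicit Types (f g : R[i] -> E).

(** A puncture where [f] is smaller than every multiple of [1 / nr (p - w)] is removable. The point
    sits at one third or two thirds of the diagonal, and halving the square exchanges these two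
    positions, so [w] never meets an edge: only the quarter containing it is bisected again, and the
    other three fall under Goursat's lemma. *)
Lemma contour_singular f w : forall x y l t : R,
  0 < l -> t = 1 / 3 \/ t = 2 / 3 -> w = (x + t * l) +i* (y + t * l) ->
  (forall p, in_square x y l p -> p != w -> exists a, bder N f p a) ->
  (forall e : R, 0 < e -> exists2 d : R, 0 < d & forall p : R[i], p != w -> nr (p - w) < d ->
     N (f p) (e / nr (p - w))) ->
  forall e : R, 0 < e -> exists M : nat, forall m, (M <= m)%N ->
    N (contour f m (x +i* y) l) e.
Proof.
move=> x y l t l0 ht hw df hs e e0.
(* The boundary of the last square stays at distance at least [l / 3] from [w], and
   [4 * l * (e / 24 / (l / 3)) = e / 2]. *)
have [d d0 hd] := hs (e / 24) (divr_gt0 e0 (ltr0n _ 24)).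
have [n hn] := half_pow_small l0 (divr_gt0 d0 (ltr0n _ 2)).
(* [eta] pays for the three regular quarters met in each of the [n] halvings. *)
suff H : forall eta : R, 0 < eta -> exists M : nat, forall m, (M <= m)%N ->
    N (contour f m (x +i* y) l) (e / 2 + eta).
  have [M hM] := H (e / 2) (divr_gt0 e0 (ltr0n _ 2)).
  by exists M => m /hM; apply: (sb_le SN); lra.
elim: n x y l t l0 ht hw df hn => [|n ih] x y l t l0 ht hw df hn eta eta0.
  rewrite expr0 divr1 in hn; exists 0 => m _.
  suff : N (contour f m (x +i* y) l) (4 * l * (e / 8 / l)).
    apply: (sb_le SN); have -> : 4 * l * (e / 8 / l) = e / 2 by field; rewrite gt_eqF.
    by lra.
  apply: contour_bound => //; first exact: ltW.
  move=> p [ip ep].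
  have iw : in_square x y l w.
    by rewrite hw; split => /=; case: ht => ->; apply/andP; split; lra.
  have h2 := in_square_dist ip iw.
  have h3 : l / 3 <= nr (p - w).
    have := nr_Re (p - w); have := nr_Im (p - w); rewrite !reimE hw /=.
    move=> h4 h5; case: ep => [ep|[ep|[ep|ep]]]; rewrite ep in h4 h5.
    - apply: le_trans h5; rewrite ler_normr; apply/orP; right.
      by case: ht => ->; lra.
    - apply: le_trans h5; rewrite ler_normr; apply/orP; left.
      by case: ht => ->; lra.
    - apply: le_trans h4; rewrite ler_normr; apply/orP; right.
      by case: ht => ->; lra.
    - apply: le_trans h4; rewrite ler_normr; apply/orP; left.
      by case: ht => ->; lra.
  have pw : p != w by apply/eqP => E0; move: h3; rewrite E0 subrr nr0; lra.
  apply: (sb_le SN) (hd p pw _); last by lra.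
  have h4 : 0 < l / 3 by lra.
  have -> : e / 8 / l = e / 24 / (l / 3) by field; rewrite gt_eqF.
  apply: ler_wpM2l; first by lra.
  by rewrite lef_pV2 ?posrE //; apply: lt_le_trans h3.
have l20 : 0 < l / 2 by lra.
have hn' : l / 2 / 2 ^+ n < d / 2.
  by move: hn; rewrite exprS invfM mulrA.
have eta4 : 0 < eta / 4 by lra.
have reg x' y' : x <= x' -> x' + l / 2 <= x + l -> y <= y' -> y' + l / 2 <= y + l ->
    ~ in_square x' y' (l / 2) w ->
    exists M : nat, forall m, (M <= m)%N -> N (contour f m (x' +i* y') (l / 2)) (eta / 4).
  move=> h1 h2 h3 h4 h5.
  have := @goursat _ _ _ SN f x' y' _ l20 _ (eta / 4 / (l / 2) ^+ 2).
  rewrite divfK ?expf_neq0 ?gt_eqF //; apply; last by rewrite divr_gt0 // exprn_gt0.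
  move=> p ip; apply: df; last by apply/eqP => pw; apply: h5; rewrite -pw.
  by case: ip => /andP[? ?] /andP[? ?]; split; lra.
have sing x' y' t' : x <= x' -> x' + l / 2 <= x + l -> y <= y' -> y' + l / 2 <= y + l ->
    t' = 1 / 3 \/ t' = 2 / 3 -> w = (x' + t' * (l / 2)) +i* (y' + t' * (l / 2)) ->
    exists M : nat, forall m, (M <= m)%N ->
      N (contour f m (x' +i* y') (l / 2)) (e / 2 + eta / 4).
  move=> h1 h2 h3 h4 h5 h6; apply: (ih _ _ _ t') => // p ip; apply: df.
  by case: ip => /andP[? ?] /andP[? ?]; split; lra.
have e1 : x +i* y + (l / 2)%:C = (x + l / 2) +i* y.
  by apply/eqP; rewrite eq_complex /= addr0 !eqxx.
have e2 : x +i* y + 'i * (l / 2)%:C = x +i* (y + l / 2).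
  by apply/eqP; rewrite eq_complex /=; apply/andP; split; apply/eqP; lra.
have e3 : x +i* (y + l / 2) + (l / 2)%:C = (x + l / 2) +i* (y + l / 2).
  by apply/eqP; rewrite eq_complex /= addr0 !eqxx.
have half (z : R) : [/\ z <= z, z + l / 2 <= z + l, z <= z + l / 2 & z + l / 2 + l / 2 <= z + l].
  by split; lra.
have [x1 x2 x3 x4] := half x; have [y1 y2 y3 y4] := half y.
suff [[M1 h1] [M2 h2] [M3 h3] [M4 h4]] : [/\
    exists M : nat, forall m, (M <= m)%N ->
      N (contour f m (x +i* y) (l / 2)) (if t == 1 / 3 then e / 2 + eta / 4 else eta / 4),
    exists M : nat, forall m, (M <= m)%N -> N (contour f m ((x + l / 2) +i* y) (l / 2)) (eta / 4),
    exists M : nat, forall m, (M <= m)%N -> N (contour f m (x +i* (y + l / 2)) (l / 2)) (eta / 4) &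
    exists M : nat, forall m, (M <= m)%N ->
      N (contour f m ((x + l / 2) +i* (y + l / 2)) (l / 2))
        (if t == 1 / 3 then eta / 4 else e / 2 + eta / 4)].
  exists (maxn (maxn M1 M2) (maxn M3 M4)).+1 => -[//|m].
  rewrite ltnS !geq_max => /andP[/andP[m1 m2] /andP[m3 m4]].
  rewrite contour_split e1 e2 e3.
  have := sb_D SN (sb_D SN (h1 m m1) (h2 m m2)) (sb_D SN (h3 m m3) (h4 m m4)).
  by apply: (sb_le SN); case: ifP => _; lra.
have t2 : (2 / 3 == 1 / 3 :> R) = false by apply/eqP; lra.
case: ht => ht; rewrite ht ?eqxx ?t2; split.
- by apply: (sing _ _ (2 / 3)) => //; [right|rewrite hw ht; congr (_ +i* _); lra].
- by apply: reg => //; rewrite hw ht => -[/= ? ?]; lra.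
- by apply: reg => //; rewrite hw ht => -[/= ? ?]; lra.
- by apply: reg => //; rewrite hw ht => -[/= ? ?]; lra.
- by apply: reg => //; rewrite hw ht => -[/= ? ?]; lra.
- by apply: reg => //; rewrite hw ht => -[/= ? ?]; lra.
- by apply: reg => //; rewrite hw ht => -[/= ? ?]; lra.
- by apply: (sing _ _ (1 / 3)) => //; [left|rewrite hw ht; congr (_ +i* _); lra].
Qed.

Lemma bder_linear f g k z a b : bder N f z a -> bder N g z b ->
  bder N (fun p => k *: f p + g p) z (k *: a + b).
Proof.
case=> [[c1 f1] [c2 a2] h1] [[c3 g3] [c4 b4] h2]; split.
- by exists (nr k * c1 + c3); apply: (sb_D SN) => //; apply: (sb_Z SN).
- by exists (nr k * c2 + c4); apply: (sb_D SN) => //; apply: (sb_Z SN).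
move=> e e0.
have k0 : 0 < nr k + 1 by rewrite ltr_wpDl // nr_ge0.
have [d1 d10 hd1] := h1 (e / 2 / (nr k + 1)) (divr_gt0 (divr_gt0 e0 (ltr0n _ 2)) k0).
have [d2 d20 hd2] := h2 (e / 2) (divr_gt0 e0 (ltr0n _ 2)).
exists (Num.min d1 d2); first by rewrite lt_min d10.
move=> h; rewrite lt_min => /andP[hh1 hh2].
have -> : k *: f (z + h) + g (z + h) - (k *: f z + g z) - h *: (k *: a + b) =
  k *: (f (z + h) - f z - h *: a) + (g (z + h) - g z - h *: b) by lmod (R[i]) E.
apply: (sb_le SN) (sb_D SN (sb_Z SN k (hd1 h hh1)) (hd2 h hh2)).
have hh := nr_ge0 h.
have : nr k * (e / 2 / (nr k + 1)) <= e / 2.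
  rewrite mulrCA ler_piMr //; first by lra.
  by rewrite ler_pdivrMr // mul1r; lra.
by move=> /(ler_wpM2r hh); lra.
Qed.

Lemma bder_affine a b z : (exists c, N a c) -> (exists c, N b c) ->
  bder N (fun p => p *: a + b) z a.
Proof.
move=> [c hc] [c' hc']; split; [|by exists c|].
  by exists (nr z * c + c'); apply: (sb_D SN) => //; apply: (sb_Z SN).
move=> e e0; exists 1 => // h _.
have -> : (z + h) *: a + b - (z *: a + b) - h *: a = 0 by lmod (R[i]) E.
by apply: (sb_le SN) (sb_0 SN); rewrite mulr_ge0 ?nr_ge0 // ltW.
Qed.

(** Quotient rule away from the pole; two applications produce the double pole in Cauchy's
    estimate. *)
Lemma bder_pole f w p a : p != w -> bder N f p a ->
  exists b, bder N (fun z => (z - w)^-1 *: f z) p b.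
Proof.
move=> pw [[cf hf] [ca ha] hd].
set q := p - w; have q0 : q != 0 by rewrite subr_eq0.
have k0 : 0 < nr q by exact: nr_gt0.
exists (q^-1 *: a - (q^-1 ^+ 2) *: f p); split.
- by exists (nr q^-1 * cf); apply: (sb_Z SN).
- by exists (nr q^-1 * ca + nr (q^-1 ^+ 2) * cf); apply: (sb_B SN); apply: (sb_Z SN).
move=> e e0.
set kp := (nr q)^-1; have kp0 : 0 < kp by rewrite invr_gt0.
have [d d0 hd1] := hd (e / (4 * kp)) (divr_gt0 e0 (mulr_gt0 (ltr0n _ 4) kp0)).
have ca0 := sb_ge0 SN ha; have cf0 := sb_ge0 SN hf.
(* Coefficient of the quadratic remainder once [nr (q + h)^-1] is bounded by [2 * kp]; the summand
   [1] keeps it positive, for a division by [D]. *)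
set D := 2 * kp ^+ 2 * ca + 2 * kp ^+ 3 * cf + 1.
have D0 : 0 < D.
  have kk : 0 <= kp by exact: ltW.
  by rewrite ltr_wpDl // addr_ge0 // !mulr_ge0 // exprn_ge0.
exists (Num.min d (Num.min (nr q / 2) (e / 2 / D))).
  rewrite !lt_min d0 /=; apply/andP; split; first by lra.
  by rewrite divr_gt0 //; lra.
move=> h; rewrite !lt_min => /and3P[h1 h2 h3].
have hq : nr q / 2 <= nr (q + h).
  have := nrB (q + h) h; rewrite addrK; lra.
have qh0 : 0 < nr (q + h) by apply: lt_le_trans hq; lra.
have qh1 : q + h != 0 by apply/eqP => E0; move: qh0; rewrite E0 nr0 ltxx.
have kh : nr (q + h)^-1 <= 2 * kp.
  rewrite nrV /kp -[2]invrK -invfM lef_pV2 ?posrE //; last by rewrite mulr_gt0 ?invr_gt0.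
  by lra.
have -> : p + h - w = q + h by rewrite /q addrAC.
have -> : (q + h)^-1 *: f (p + h) - q^-1 *: f p - h *: (q^-1 *: a - q^-1 ^+ 2 *: f p) =
   (q + h)^-1 *: (f (p + h) - f p - h *: a) +
   ((- (h * h * q^-1 * (q + h)^-1)) *: a + (h * h * q^-1 ^+ 2 * (q + h)^-1) *: f p).
  by lmod (R[i]) E; field; rewrite ?q0 ?qh1.
apply: (sb_le SN) (sb_D SN (sb_Z SN _ (hd1 h h1)) (sb_D SN (sb_Z SN _ ha) (sb_Z SN _ hf))).
rewrite nrN expr2 !nrM (nrV q) -/kp.
set K := nr (q + h)^-1 in kh *; set H := nr h in h1 h2 h3 *.
have H0 : 0 <= H by exact: nr_ge0.
have K0 : 0 <= K by exact: nr_ge0.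
have t1 : K * (e / (4 * kp) * H) <= e / 2 * H.
  have -> : e / 2 * H = 2 * kp * (e / (4 * kp) * H) by field; rewrite gt_eqF.
  by rewrite ler_wpM2r // mulr_ge0 // divr_ge0 ?ltW // mulr_gt0.
have t2 : H * H * kp * K * ca + H * H * (kp * kp) * K * cf <= H * (H * D).
  have -> : H * H * kp * K * ca + H * H * (kp * kp) * K * cf =
    K * (H * H * kp * ca + H * H * kp ^+ 2 * cf) by ring.
  apply: (@le_trans _ _ (2 * kp * (H * H * kp * ca + H * H * kp ^+ 2 * cf))).
    by rewrite ler_wpM2r // addr_ge0 // !mulr_ge0 // ?exprn_ge0 ?ltW.
  have -> : 2 * kp * (H * H * kp * ca + H * H * kp ^+ 2 * cf) = H * (H * (D - 1)).
    by rewrite /D; ring.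
  by rewrite !ler_wpM2l //; lra.
have t3 : H * (H * D) <= H * (e / 2).
  by rewrite ler_wpM2l // -ler_pdivlMr // ltW.
by lra.
Qed.

Lemma contour_scale (k : R[i] -> R[i]^o) (v : E) m z l :
  contour (fun p => k p *: v) m z l = contour k m z l *: v.
Proof.
have hs u z' : seg (fun p => k p *: v) m z' u = seg k m z' u *: v.
  elim: m u z' => [|m' ih] u z' //=; rewrite !ih.
  set a := seg _ _ _ _; set b := seg _ _ _ _.
  change (2^-1 *: (a *: v + b *: v) = (2^-1 * (a + b) : R[i]) *: v).
  lmod (R[i]) E.
rewrite /contour !hs.
set a := seg k _ _ _; set b := seg k _ _ _; set c := seg k _ _ _; set d := seg k _ _ _.
change (l%:C *: (a *: v - b *: v + 'i *: (c *: v - d *: v)) =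
  (l%:C * (a - b + 'i * (c - d)) : R[i]) *: v).
lmod (R[i]) E.
Qed.

End Cauchy.

(** * Cauchy's estimate for the derivative *)

Section CauchyBound.
Variable R : realType.

Lemma seminorm_bound_nr (V : normedModType R[i]) :
  seminorm_bound (fun (x : V) c => nr x <= c).
Proof.
split=> [x c c' h1 h2|x c||x y c c' h1 h2|k x c h].
- exact: le_trans h1.
- by apply: le_trans; exact: nr_ge0.
- by rewrite nr0.
- by apply: le_trans (nrD _ _) _; apply: lerD.
- by rewrite nrZ ler_wpM2l // nr_ge0.
Qed.

Lemma seminorm_bound_scalar : @seminorm_bound R (R[i]^o) (fun x c => nr (x : R[i]) <= c).
Proof.
split=> [x c c' h1 h2|x c||x y c c' h1 h2|k x c h].
- exact: le_trans h1.
- by apply: le_trans; exact: nr_ge0.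
- by rewrite nr0.
- by apply: le_trans (nrD _ _) _; apply: lerD.
- by rewrite -[k *: x]/(k * x : R[i]) nrM ler_wpM2l // nr_ge0.
Qed.

Definition pole (w : R[i]) (p : R[i]) : R[i]^o := (p - w)^-1.

Lemma ReV (z : R[i]) :
  complex.Re z^-1 = complex.Re z / (complex.Re z ^+ 2 + complex.Im z ^+ 2).
Proof. by case: z. Qed.

Lemma ImV (z : R[i]) :
  complex.Im z^-1 = - (complex.Im z / (complex.Re z ^+ 2 + complex.Im z ^+ 2)).
Proof. by case: z. Qed.

(** Stands in for the value [2 * pi * 'i] of the integral: only its distance from zero matters.
    Every edge contributes a nonnegative imaginary part, and the lower edge at least [2^-1];
    midpoint convexity transfers these signs from the integrand to the sums. *)
Lemma pole_contour_ge (w : R[i]) m l : 0 < l ->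
  2^-1 <= nr (contour (pole w) m (w - ((l / 3) +i* (l / 3))) l : R[i]).
Proof.
move=> l0; set z := w - _.
have hm (P : R[i] -> Prop) u : (forall x y, P x -> P y -> P (2^-1 * (x + y))) ->
    forall v, (forall s : R, 0 <= s <= 1 -> P (v + s%:C * u - w)^-1) ->
    P (seg (pole w) m v u).
  by move=> hP v; apply: (@seg_convex R (R[i]^o) (pole w) m v u P).
have half (x y : R[i]) : complex.Re (2^-1 * (x + y)) = (complex.Re x + complex.Re y) / 2 /\
    complex.Im (2^-1 * (x + y)) = (complex.Im x + complex.Im y) / 2.
  have -> : (2^-1 : R[i]) = (2^-1 : R)%:C by rewrite fmorphV rmorph_nat.
  by rewrite !reimE; split; lra.
have h1 : (2 * l)^-1 <= complex.Im (seg (pole w) m z l%:C : R[i]).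
  apply: (hm (fun q => (2 * l)^-1 <= complex.Im q)).
    by move=> x y; rewrite (half x y).2; lra.
  move=> s /andP[s0 s1]; rewrite ImV /z !reimE /=.
  set a := complex.Re w - l / 3 + _ - _; have -> : a = l * (s - 3^-1) by rewrite /a; field.
  set b := complex.Im w - l / 3 + _ - _; have -> : b = - (l / 3) by rewrite /b; field.
  have q0 : 0 < (s - 3^-1) ^+ 2 + 9^-1 by rewrite ltr_wpDl ?sqr_ge0.
  have -> : - (- (l / 3) / ((l * (s - 3^-1)) ^+ 2 + (- (l / 3)) ^+ 2)) =
    (3 * l * ((s - 3^-1) ^+ 2 + 9^-1))^-1.
    by field; rewrite ?(gt_eqF l0) /=; apply/andP; split; apply/eqP; nra.
  rewrite lef_pV2 ?posrE ?mulr_gt0 // -mulrA [2 * l]mulrC mulrCA ler_pM2l //; nra.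
have h2 : complex.Im (seg (pole w) m (z + 'i * l%:C) l%:C : R[i]) <= 0.
  apply: (hm (fun q => complex.Im q <= 0)).
    by move=> x y; rewrite (half x y).2; lra.
  move=> s /andP[s0 s1]; rewrite ImV /z !reimE /=.
  set a := complex.Re w - _ + _ + _ - complex.Re w; set b := complex.Im w - _ + _ + _ - complex.Im w.
  have -> : b = l * 2 / 3 by rewrite /b; field.
  by rewrite oppr_le0 divr_ge0 //; [lra|rewrite addr_ge0 ?sqr_ge0].
have h3 : 0 <= complex.Re (seg (pole w) m (z + l%:C) ('i * l%:C) : R[i]).
  apply: (hm (fun q => 0 <= complex.Re q)).
    by move=> x y; rewrite (half x y).1; lra.
  move=> s /andP[s0 s1]; rewrite ReV /z !reimE /=.
  set a := complex.Re w - _ + _ + _ - complex.Re w; set b := complex.Im w - _ + _ + _ - complex.Im w.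
  have -> : a = l * 2 / 3 by rewrite /a; field.
  by rewrite divr_ge0 //; [lra|rewrite addr_ge0 ?sqr_ge0].
have h4 : complex.Re (seg (pole w) m z ('i * l%:C) : R[i]) <= 0.
  apply: (hm (fun q => complex.Re q <= 0)).
    by move=> x y; rewrite (half x y).1; lra.
  move=> s /andP[s0 s1]; rewrite ReV /z !reimE /=.
  set a := complex.Re w - _ + _ - complex.Re w; set b := complex.Im w - _ + _ - complex.Im w.
  have -> : a = - (l / 3) by rewrite /a; field.
  by rewrite mulNr oppr_le0 divr_ge0 //; [lra|rewrite addr_ge0 ?sqr_ge0].
apply: le_trans (nr_Im _); apply: le_trans (ler_norm _).
rewrite /contour; set a := seg _ _ _ _ in h1 *; set b := seg _ _ _ _ in h2 *.
set c := seg _ _ _ _ in h3 *; set d := seg _ _ _ _ in h4 *.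
change (2^-1 <= complex.Im (l%:C * (a - b + 'i * (c - d)) : R[i])).
rewrite !reimE; apply: (@le_trans _ _ (l * (2 * l)^-1)).
  by rewrite invfM mulrCA divff ?gt_eqF // mulr1.
rewrite ler_pM2l //.
change ((2 * l)^-1 <= complex.Im (a : R[i]) - complex.Im (b : R[i]) +
   (complex.Re (c : R[i]) - complex.Re (d : R[i]))).
lra.
Qed.

Variables (E : lmodType R[i]) (N : E -> R -> Prop).
Hypothesis SN : seminorm_bound N.

(** The first-order remainder of [f] at [w], divided by the square of [p - w], has a small sum.
    Expanding that sum expresses [a] through the sums of [f] against the double pole, of the double
    pole, and of the simple pole. The second of these is bounded rather than evaluated, whence the
    assumption on [f w]. Elsewhere [f] is controlled on an annulus, which is all that Liouville's
    argument can offer. *)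
Lemma cauchy_bound (f : R[i] -> E) (w : R[i]) (a : E) (l C : R) : 0 < l ->
  (forall z, nr (z - w) <= 2 * l -> exists b, bder N f z b) -> bder N f w a ->
  (forall z, l / 3 <= nr (z - w) <= 2 * l -> N (f z) C) -> N (f w) C ->
  forall e, 0 < e -> N a (144 * C / l + e).
Proof.
move=> l0 df dw hC hw e e0.
have [[cf hcf] [ca hca] hda] := dw.
have C0 := sb_ge0 SN hw.
pose x := complex.Re w - l / 3; pose y := complex.Im w - l / 3.
have hwxy : w = (x + 1 / 3 * l) +i* (y + 1 / 3 * l).
  by apply/eqP; rewrite eq_complex /= /x /y; apply/andP; split; apply/eqP; field.
have iw : in_square x y l w.
  by split; rewrite /x /y; apply/andP; split; lra.
(* The first-order remainder of [f] at [w], written in the shape that [bder_linear] and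
   [bder_affine] expect. *)
pose r p := (1 : R[i]) *: f p + ((- p) *: a + (w *: a - f w)).
have rE p : r p = f p - f w - (p - w) *: a by rewrite /r; lmod (R[i]) E.
pose g p := (p - w)^-1 *: ((p - w)^-1 *: r p).
have dg p : in_square x y l p -> p != w -> exists b, bder N g p b.
  move=> ip pw; have [b hb] := df p (in_square_dist ip iw).
  have hr : bder N r p (1 *: b + - a).
    apply: (bder_linear SN) => //.
    have -> : (fun p => (- p) *: a + (w *: a - f w)) = (fun p => p *: (- a) + (w *: a - f w)).
      by apply: funext => q; rewrite scalerN scaleNr.
    apply: (bder_affine SN); first by exists ca; apply: (sb_N SN).
    by exists (nr w * ca + cf); apply: (sb_B SN) => //; apply: (sb_Z SN).
  have [b1 hb1] := bder_pole SN pw hr.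
  exact: (bder_pole SN pw hb1).
have sg d : 0 < d -> exists2 d' : R, 0 < d' & forall p : R[i], p != w ->
    nr (p - w) < d' -> N (g p) (d / nr (p - w)).
  move=> d0; have [d' d'0 hd'] := hda d d0; exists d' => // p pw hp.
  rewrite /g rE; have := hd' _ hp; rewrite [w + _]addrC subrK => hn.
  apply: (sb_le SN) (sb_Z SN _ (sb_Z SN _ hn)).
  have v0 : nr (p - w) != 0 by apply/eqP => /nr0_eq0 /eqP; rewrite subr_eq0; apply/negP.
  by rewrite nrV le_eqVlt; apply/orP; left; apply/eqP; field.
have [M hM] := contour_singular SN l0 (or_introl erefl) hwxy dg sg (divr_gt0 e0 (ltr0n _ 2)).
have {hM} := hM M (leqnn M).
pose k2 (p : R[i]) : R[i]^o := (p - w)^-1 * (p - w)^-1.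
have -> : g = (fun p => 1 *: (fun p => k2 p *: f p) p +
    ((-1) *: (fun p => k2 p *: f w) p + (fun p => pole w p *: (- a)) p)).
  apply: funext => p; rewrite /g rE /k2 /pole.
  (* At [p = w] both sides vanish because the inverse of zero is zero. *)
  have [->|pw] := eqVneq p w; first by rewrite subrr invr0 mul0r !scale0r !scaler0 !addr0.
  by lmod (R[i]) E; field; rewrite ?subr_eq0.
rewrite !contour_linear !contour_scale.
set J1 := contour (fun p => k2 p *: f p) M _ l.
set J2 : R[i] := contour k2 M _ l.
have hS := @pole_contour_ge w M l l0.
have hz : w - ((l / 3) +i* (l / 3)) = x +i* y.
  by rewrite /x /y; case: (w).
rewrite hz in hS; set S : R[i] := contour (pole w) M _ l in hS *.
have hk p : on_edge x y l p -> [/\ nr ((p - w)^-1) <= 3 / l & l / 3 <= nr (p - w) <= 2 * l].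
  move=> [ip ep]; have h2 := in_square_dist ip iw.
  have h3 : l / 3 <= nr (p - w).
    have := nr_Re (p - w); have := nr_Im (p - w); rewrite !reimE.
    move=> h4 h5; case: ep => [ep|[ep|[ep|ep]]]; rewrite ep /x /y in h4 h5.
    - by apply: le_trans h5; rewrite ler_normr; apply/orP; right; lra.
    - by apply: le_trans h5; rewrite ler_normr; apply/orP; left; lra.
    - by apply: le_trans h4; rewrite ler_normr; apply/orP; right; lra.
    - by apply: le_trans h4; rewrite ler_normr; apply/orP; left; lra.
  split; last by rewrite h3.
  have l3 : 0 < l / 3 by lra.
  by rewrite nrV -invf_div lef_pV2 ?posrE //; apply: lt_le_trans h3.
have l3 : 0 <= 3 / l by rewrite divr_ge0 // ltW.
have h1 : N J1 (4 * l * (3 / l * (3 / l * C))).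
  apply: (contour_bound SN) => [|p ep]; first exact: ltW.
  have [h1 h2] := hk p ep; rewrite /k2 -scalerA.
  apply: (sb_le SN) (sb_Z SN _ (sb_Z SN _ (hC p h2))).
  by apply: ler_pM; rewrite ?mulr_ge0 ?nr_ge0 // ler_wpM2r.
have h2 : nr J2 <= 4 * l * (3 / l * (3 / l)).
  refine (@contour_bound _ _ _ seminorm_bound_scalar k2 M x y l _ _ _); first exact: ltW.
  move=> p ep; by have [h2 _] := hk p ep; rewrite /k2 nrM; apply: ler_pM; rewrite ?nr_ge0.
have h3 : N (J2 *: f w) (4 * l * (3 / l * (3 / l)) * C).
  by apply: (sb_le SN) (sb_Z SN _ hw); rewrite ler_wpM2r.
move=> h4.
have S0 : S != 0 by apply/eqP => E0; move: hS; rewrite E0 nr0; lra.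
move: (J1) (J2) (S) S0 hS h1 h2 h3 h4 => {J1 J2 S} J1 J2 S S0 hS h1 h2 h3 h4.
have -> : a = S^-1 *: (J1 - J2 *: f w - (1 *: J1 + (-1 *: (J2 *: f w) + S *: (- a)))).
  by lmod (R[i]) E; field.
apply: (sb_le SN) (sb_Z SN _ (sb_B SN (sb_B SN h1 h3) h4)).
have h5 : nr S^-1 <= 2 by rewrite nrV -[leRHS]invrK lef_pV2 ?posrE //; lra.
(* Each of the first two sums is at most [4 * l * (3 / l) ^+ 2 * C = 36 * C / l], and dividing by
   [S] at most doubles: [2 * (36 + 36) = 144]. *)
have -> : 144 * C / l + e =
  2 * (4 * l * (3 / l * (3 / l * C)) + 4 * l * (3 / l * (3 / l)) * C + e / 2).
  by field; rewrite gt_eqF.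
have l40 : 0 <= 4 * l by lra.
move: (3 / l) l3 => q q0.
have p1 : 0 <= 4 * l * (q * (q * C)) by rewrite !mulr_ge0 // ltW.
have p2 : 0 <= 4 * l * (q * q) * C by rewrite !mulr_ge0 // ltW.
by rewrite ler_wpM2r //; lra.
Qed.

End CauchyBound.

(** * Mean value inequality and Cauchy estimates in normed spaces *)

Section MeanValue.
Variable R : realType.
Implicit Types V W : normedModType R[i].

Lemma scale_absorb (e a n : R) : 0 <= e -> 0 <= a -> 0 <= n -> e / (n + 1) * (a * n) <= e * a.
Proof.
move=> e0 a0 n0; have n1 : 0 < n + 1 by lra.
have -> : e / (n + 1) * (a * n) = e * a * (n / (n + 1)) by field; rewrite gt_eqF.
by rewrite ler_piMr ?mulr_ge0 // ler_pdivrMr // mul1r; lra.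
Qed.

(** A short interval around a given time satisfies the bound with slack [e / L] after being split at
    that time, and Cousin's principle adds up the pieces. Stated by increments rather than
    derivatives so that it applies both along segments and along orbits. *)
Lemma mean_value_bound V (phi : R -> V) (K L : R) : 0 <= L ->
  (forall t, 0 <= t <= L -> forall e, 0 < e -> exists2 d : R, 0 < d &
     forall s, 0 <= s <= L -> `|s - t| < d -> nr (phi s - phi t) <= (K + e) * `|s - t|) ->
  nr (phi L - phi 0) <= K * L.
Proof.
move=> L0 hphi; case: (ltrgtP L 0) L0 => // [L0 _|-> _]; last by rewrite subrr nr0 mulr0.
apply/ler_addgt0Pr => e e0.
suff : nr (phi (0 + L) - phi 0) <= (K + e / L) * L.
  by rewrite add0r mulrDl divfK // gt_eqF.
apply: (@cousin_segment R (fun x l => nr (phi (x + l) - phi x) <= (K + e / L) * l)) => //.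
  move=> x l l0 h1 h2; apply: le_trans (nr_tri _ (phi (x + l / 2)) _) _.
  have -> : x + l = x + l / 2 + l / 2 by field.
  by rewrite addrC; have := lerD h1 h2; rewrite -mulrDr; congr (_ <= _ * _); field.
rewrite add0r => a ha; have [d d0 hd] := hphi a ha (e / L) (divr_gt0 e0 L0).
exists d => // x l /andP[l0 ld] /andP[xa ax] x0 xl.
apply: le_trans (nr_tri _ (phi a) _) _.
have h1 : nr (phi (x + l) - phi a) <= (K + e / L) * (x + l - a).
  have := hd (x + l); rewrite ger0_norm ?subr_ge0 //; apply; last by lra.
  by apply/andP; split; lra.
have h2 : nr (phi a - phi x) <= (K + e / L) * (a - x).
  have := hd x; rewrite nrC distrC ger0_norm ?subr_ge0 //; apply; last by lra.
  by apply/andP; split; lra.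
have -> : l = (x + l - a) + (a - x) by ring.
by rewrite mulrDr; apply: lerD; [have -> : x + (x + l - a + (a - x)) = x + l by ring|].
Qed.

Lemma differentiable_nr_bound V W (g : V -> W) x : differentiable g x ->
  exists2 d : R, 0 < d & forall y, nr (y - x) < d -> nr (g y) <= nr (g x) + 1.
Proof.
move=> /differentiable_continuous /(_ (fun y => nr (y - g x) < 1)).
rewrite /continuous_at => h; have /h/nbhs_nrP[d d0 hd] : nbhs (g x) (fun y => nr (y - g x) < 1).
  by apply/nbhs_nrP; exists 1.
exists d => // y /hd /ltW h1; rewrite -[g y](subrK (g x)) addrC.
by apply: le_trans (nrD _ _) _; rewrite lerD2l.
Qed.

Lemma segment_bound V W (g : V -> W) (x y : V) (K : R) :
  (forall t : R, 0 <= t <= 1 -> differentiable g (x + t%:C *: (y - x)) /\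
     nr (dif g (x + t%:C *: (y - x)) (y - x)) <= K) ->
  nr (g y - g x) <= K.
Proof.
move=> hg; set v := y - x in hg *.
have := @mean_value_bound W (fun t => g (x + t%:C *: v)) K 1 ler01.
have -> : x + (1 : R)%:C *: v = y by rewrite rmorph1 scale1r /v addrC subrK.
rewrite rmorph0 scale0r addr0 mulr1; apply=> t ht e e0.
have [dg hK] := hg t ht.
have v0 : 0 < nr v + 1 by rewrite ltr_wpDl // nr_ge0.
have [_ /(_ (e / (nr v + 1)) (divr_gt0 e0 v0)) [d d0 hd]] := differentiableEP dg.
exists (d / (nr v + 1)) => [|s _ hs]; first by rewrite divr_gt0.
set p := x + t%:C *: v in dg hd hK *.
have -> : x + s%:C *: v = p + (s - t)%:C *: v.
  by rewrite /p rmorphB /=; lmod (R[i]) V.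
set h := _ *: v.
have nh : nr h = `|s - t| * nr v by rewrite nrZ nrR.
have hh : nr h < d.
  rewrite nh; apply: (@le_lt_trans _ _ (`|s - t| * (nr v + 1))).
    by rewrite ler_wpM2l // lerDl.
  by rewrite -ltr_pdivlMr.
have := hd h hh; have -> : dif g p h = (s - t)%:C *: dif g p v by rewrite difZ.
move=> h1; rewrite -(subrK ((s - t)%:C *: dif g p v) (g (p + h) - g p)).
apply: le_trans (nrD _ _) _; rewrite nrZ nrR; rewrite nh in h1.
have h2 : e / (nr v + 1) * (`|s - t| * nr v) <= e * `|s - t|.
  by rewrite scale_absorb ?nr_ge0 // ltW.
have h3 : `|s - t| * nr (dif g p v) <= K * `|s - t| by rewrite mulrC ler_wpM2r.
by rewrite mulrDl addrC; apply: lerD => //; apply: le_trans h1 h2.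
Qed.

Lemma bder_line V W (g : V -> W) (x v : V) (z : R[i]) :
  differentiable g (x + z *: v) ->
  bder (fun (y : W) c => nr y <= c) (fun z => g (x + z *: v)) z (dif g (x + z *: v) v).
Proof.
move=> dg; split; [by exists (nr (g (x + z *: v)))|by exists (nr (dif g (x + z *: v) v))|].
move=> e e0; have v0 : 0 < nr v + 1 by rewrite ltr_wpDl // nr_ge0.
have [_ /(_ (e / (nr v + 1)) (divr_gt0 e0 v0)) [d d0 hd]] := differentiableEP dg.
exists (d / (nr v + 1)) => [|h hh]; first by rewrite divr_gt0.
have hhv : nr (h *: v) < d.
  rewrite nrZ; apply: (@le_lt_trans _ _ (nr h * (nr v + 1))).
    by rewrite ler_wpM2l ?nr_ge0 // lerDl.
  by rewrite -ltr_pdivlMr.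
have -> : x + (z + h) *: v = x + z *: v + h *: v by lmod (R[i]) V.
rewrite -difZ; apply: le_trans (hd _ hhv) _; rewrite nrZ.
by rewrite scale_absorb ?nr_ge0 // ltW.
Qed.

Lemma cauchy_differential V W (g : V -> W) (x v : V) (r C : R) : 0 < r ->
  (forall y, nr (y - x) < r -> differentiable g y) ->
  (forall y, nr (y - x) < r -> nr (g y) <= C) ->
  nr (dif g x v) <= 432 * C / r * nr v.
Proof.
move=> r0 dg hC.
have [->|v0] := eqVneq v 0; first by rewrite dif0 !nr0 mulr0.
have nv : 0 < nr v. by exact: nr_gt0.
apply/ler_addgt0Pr => e e0.
(* Parameters up to [2 * l] then move the point by at most [2 * r / 3], and [144 / l] becomes
   [432 * nr v / r]. *)
pose l := r / (3 * nr v).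
have l0 : 0 < l by rewrite divr_gt0 // mulr_gt0.
have hin (z : R[i]) : nr (z - 0) <= 2 * l -> nr (x + z *: v - x) < r.
  rewrite subr0 [x + _]addrC addrK nrZ => hz.
  apply: (@le_lt_trans _ _ (2 * l * nr v)); first by rewrite ler_wpM2r ?nr_ge0.
  have -> : 2 * l * nr v = r * (2 / 3) by rewrite /l; field; rewrite gt_eqF.
  by rewrite gtr_pMr //; lra.
have := @cauchy_bound R W _ (seminorm_bound_nr W) (fun z => g (x + z *: v)) 0 (dif g x v)
  l C l0 _ _ _ _ e e0.
have -> : 144 * C / l = 432 * C / r * nr v.
  by rewrite /l; field; rewrite ?(gt_eqF r0) ?(gt_eqF nv).
apply.
- by move=> z /hin hz; eexists; apply: bder_line; apply: dg.
- have := @bder_line _ _ g x v 0; rewrite scale0r addr0; apply.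
  by apply: dg; rewrite subrr nr0.
- by move=> z /andP[_ /hin hz]; apply: hC.
- by apply: hC; rewrite scale0r addr0 subrr nr0.
Qed.

(** Around each point of a segment inside the ball of radius [r / 2] there is still a ball of radius
    [r / 2] where [g] is bounded, whence [864 = 2 * 432]. *)
Lemma cauchy_lipschitz V W (g : V -> W) (x y z : V) (r C : R) : 0 < r ->
  (forall y, nr (y - x) < r -> differentiable g y) ->
  (forall y, nr (y - x) < r -> nr (g y) <= C) ->
  nr (y - x) < r / 2 -> nr (z - x) < r / 2 ->
  nr (g y - g z) <= 864 * C / r * nr (y - z).
Proof.
move=> r0 dg hC hy hz; apply: segment_bound => t /andP[t0 t1].
set p := z + _.
have hp : nr (p - x) < r / 2.
  have -> : p - x = t%:C *: (y - x) + (1 - t)%:C *: (z - x).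
    by rewrite /p rmorphB /=; lmod (R[i]) V.
  apply: le_lt_trans (nrD _ _) _; rewrite !nrZ !nrR !ger0_norm ?subr_ge0 //.
  have [->|tn] := eqVneq t 0; first by rewrite mul0r subr0 mul1r add0r.
  have tp : 0 < t by rewrite lt_neqAle eq_sym tn.
  have h1 : t * nr (y - x) < t * (r / 2) by rewrite ltr_pM2l.
  have h2 : (1 - t) * nr (z - x) <= (1 - t) * (r / 2).
    by rewrite ler_wpM2l ?subr_ge0 // ltW.
  by lra.
have hq q : nr (q - p) < r / 2 -> nr (q - x) < r.
  by move=> h; apply: le_lt_trans (nr_tri _ p _) _; lra.
split; first by apply: dg; lra.
have -> : 864 * C / r = 432 * C / (r / 2) by field; rewrite gt_eqF.
apply: cauchy_differential; first by lra.
  by move=> q /hq; apply: dg.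
by move=> q /hq; apply: hC.
Qed.

End MeanValue.

(** * Convergence and second-order remainders *)

Section Weierstrass.
Variable R : realType.
Implicit Types V W : normedModType R[i].

Lemma nr_eq0 V (x : V) : (forall e : R, 0 < e -> nr x <= e) -> x = 0.
Proof.
move=> h; apply: nr0_eq0; apply/eqP; rewrite eq_le nr_ge0 andbT.
by apply/ler_addgt0Pr => e e0; rewrite add0r; apply: h.
Qed.

Lemma nr_complete (V : completeNormedModType R[i]) (u : nat -> V) :
  (forall e : R, 0 < e -> exists M, forall m n, (M <= m)%N -> (M <= n)%N ->
     nr (u m - u n) <= e) ->
  exists l, forall e : R, 0 < e -> exists M, forall n, (M <= n)%N -> nr (u n - l) <= e.
Proof.
move=> hu.
have /cauchy_cvgP /cvg_ex [l hl] : cauchy (u @ \oo).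
  apply/cauchy_ballP => e e0.
  have [eR1 eR2] : e = (complex.Re e)%:C /\ 0 < complex.Re e.
    by move: e0; case: (e) => a b; rewrite /= ltcE /= => /andP[/eqP -> ->].
  have [M hM] := hu (complex.Re e / 2) (divr_gt0 eR2 (ltr0n _ 2)).
  pose S := [set x | exists2 n, (M <= n)%N & x = u n].
  have hS : (u @ \oo) S by exists M => // n /= hn; exists n.
  exists (S, S) => // -[_ _] [/= [m hm ->] [n hn ->]].
  rewrite -ball_normE /= normE eR1 ltcR.
  by apply: le_lt_trans (hM _ _ hm hn) _; lra.
exists l => e e0.
have /hl : nbhs l (fun y => nr (y - l) <= e).
  by apply/nbhs_nrP; exists e => // y /ltW.
by case=> M _ hM; exists M.
Qed.

Lemma nr_lim_le V (u : nat -> V) (l x : V) (c : R) :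
  (forall e : R, 0 < e -> exists M, forall n, (M <= n)%N -> nr (u n - l) <= e) ->
  (exists M, forall n, (M <= n)%N -> nr (u n - x) <= c) -> nr (l - x) <= c.
Proof.
move=> hu [M hM]; apply/ler_addgt0Pr => e e0.
have [M' hM'] := hu e e0; have := hM _ (leq_maxl M M'); have := hM' _ (leq_maxr M M').
by rewrite nrC => h1 h2; apply: le_trans (nr_tri _ (u (maxn M M')) _) _; lra.
Qed.

Lemma diff_affine_comp V W (g : V -> W) (d : R[i]) (w x : V) :
  differentiable g (d *: x + w) ->
  differentiable (fun z => g (d *: z + w)) x /\
  forall v, dif (fun z => g (d *: z + w)) x v = d *: dif g (d *: x + w) v.
Proof.
move=> dg; have [[c c0 hc] hd] := differentiableEP dg.
have [] := @differentiableI R V W (fun z => g (d *: z + w)) x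
  (fun v => d *: dif g (d *: x + w) v) (nr d * c).
- by move=> k u v; rewrite difD difZ; lmod (R[i]) W.
- by move=> v; rewrite nrZ -mulrA ler_wpM2l // nr_ge0.
- move=> e e0; have d0 : 0 < nr d + 1 by rewrite ltr_wpDl // nr_ge0.
  have [a a0 ha] := hd (e / (nr d + 1)) (divr_gt0 e0 d0).
  exists (a / (nr d + 1)) => [|h hh]; first by rewrite divr_gt0.
  have hdh : nr (d *: h) < a.
    rewrite nrZ mulrC; apply: (@le_lt_trans _ _ (nr h * (nr d + 1))).
      by rewrite ler_wpM2l ?nr_ge0 // lerDl.
    by rewrite -ltr_pdivlMr.
  have -> : d *: (x + h) + w = d *: x + w + d *: h by lmod (R[i]) V.
  rewrite -difZ; apply: le_trans (ha _ hdh) _; rewrite nrZ.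
  by rewrite [nr d * _]mulrC scale_absorb ?nr_ge0 // ltW.
by move=> h1 h2; split => // v; rewrite h2.
Qed.

Lemma diff_sub V W (f g : V -> W) x : differentiable f x -> differentiable g x ->
  differentiable (fun z => f z - g z) x /\
  forall v, dif (fun z => f z - g z) x v = dif f x v - dif g x v.
Proof.
move=> df dg; split; first exact: differentiableB.
by move=> v; rewrite !difE; have := diffB df dg => /(congr1 (fun h => h v)).
Qed.

Lemma diff_scale V W (f : V -> W) k x : differentiable f x ->
  differentiable (fun z => k *: f z) x /\
  forall v, dif (fun z => k *: f z) x v = k *: dif f x v.
Proof.
move=> df; split; first exact: differentiableZ.
by move=> v; rewrite !difE; have := diffZ k df => /(congr1 (fun h => h v)).
Qed.

Fact cauchy2_sig : {K : R | K = 432 * 864 * 4 & 0 <= K}.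
Proof. by exists (432 * 864 * 4); [reflexivity|rewrite !mulr_ge0 ?ler0n]. Qed.

(* sealed, so that conversion never sees the unary numerals *)
Definition cauchy2 : R := s2val cauchy2_sig.

Lemma cauchy2_ge0 : 0 <= cauchy2.
Proof. exact: (s2valP' cauchy2_sig). Qed.

(** In place of a second differential, the difference between [g] and its translate by [y - x] is
    considered: it is at most [864 * C / r * nr (y - x)] on a ball of radius [r / 4], and Cauchy's
    estimate there bounds [dif g y - dif g x]. This is the source of the constant
    [432 * 864 * 4]. *)
Lemma cauchy_second_order V W (g : V -> W) (x h : V) (r C : R) : 0 < r -> 0 <= C ->
  (forall y, nr (y - x) < r -> differentiable g y) ->
  (forall y, nr (y - x) < r -> nr (g y) <= C) -> nr h < r / 4 ->
  nr (g (x + h) - g x - dif g x h) <= cauchy2 * C / r ^+ 2 * nr h ^+ 2.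
Proof.
move=> r0 C0 dg hC hh.
have dx : differentiable g x by apply: dg; rewrite subrr nr0.
have dL p : differentiable (dif g x) p /\ dif (dif g x) p = dif g x :> (V -> W).
  have hc := diff_continuous dx; rewrite difE (difE ('d g x)).
  by split; [exact: linear_differentiable hc|exact: diff_lin hc].
have key y v : nr (y - x) < r / 4 ->
    nr (dif g y v - dif g x v) <= cauchy2 * C / r ^+ 2 * nr (y - x) * nr v.
  move=> hy.
  have hin z : nr (z - x) < r / 4 -> nr (1 *: z + (y - x) - x) < r / 2.
    move=> hz; have -> : 1 *: z + (y - x) - x = (z - x) + (y - x) by lmod (R[i]) V.
    by apply: le_lt_trans (nrD _ _) _; lra.
  have dG z : nr (z - x) < r / 4 -> differentiable (fun z => g (1 *: z + (y - x)) - g z) z /\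
      forall v, dif (fun z => g (1 *: z + (y - x)) - g z) z v =
        dif g (1 *: z + (y - x)) v - dif g z v.
    move=> hz; have dg1 : differentiable g (1 *: z + (y - x)).
      by apply: dg; apply: lt_trans (hin z hz) _; lra.
    have dg2 : differentiable g z by apply: dg; lra.
    have [d1 d2] := diff_affine_comp dg1.
    have [d3 d4] := @diff_sub V W (fun z => g (1 *: z + (y - x))) g z d1 dg2.
    by split => // u; rewrite d4 d2 [1 *: dif _ _ _]scale1r.
  have hx0 : nr (x - x) < r / 4 by rewrite subrr nr0; lra.
  have [_ hv] := dG x hx0.
  have -> : dif g y v - dif g x v = dif (fun z => g (1 *: z + (y - x)) - g z) x v.
    by rewrite hv scale1r [x + _]addrC subrK.
  have -> : cauchy2 * C / r ^+ 2 * nr (y - x) * nr v =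
    432 * (864 * C / r * nr (y - x)) / (r / 4) * nr v.
    by rewrite /cauchy2 (s2valP cauchy2_sig); field; rewrite gt_eqF.
  apply: cauchy_differential; first by lra.
    by move=> z /dG[].
  move=> z hz; have := @cauchy_lipschitz _ _ _ g x (1 *: z + (y - x)) z r C r0 dg hC
    (hin z hz) ltac:(lra).
  by have -> : 1 *: z + (y - x) - z = y - x by lmod (R[i]) V.
(* Mean value bound for [g] minus its differential at [x], whose own differential is small along the
   segment by [key]. *)
have /(_ (cauchy2 * C / r ^+ 2 * nr h ^+ 2)) := @segment_bound _ _ _ (fun z => g z - dif g x z) x (x + h).
have -> : g (x + h) - dif g x (x + h) - (g x - dif g x x) = g (x + h) - g x - dif g x h.
  by rewrite difD; lmod (R[i]) W.
apply=> t /andP[t0 t1]; have -> : x + h - x = h by rewrite addrAC subrr add0r.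
have hp : nr (x + t%:C *: h - x) <= nr h.
  rewrite addrAC subrr add0r nrZ nrR ger0_norm //.
  by rewrite ler_piMl ?nr_ge0.
have dp : differentiable g (x + t%:C *: h) by apply: dg; lra.
have [d3 d4] := dL (x + t%:C *: h); have [d1 d2] := diff_sub dp d3.
split => //; rewrite d2 d4.
apply: le_trans (key _ h _) _; first lra.
rewrite expr2 mulrA ler_wpM2r ?nr_ge0 // ler_wpM2l //.
by rewrite divr_ge0 ?exprn_ge0 ?mulr_ge0 ?cauchy2_ge0 // ltW.
Qed.

End Weierstrass.

(** * Limits of holomorphic maps and homogeneous parts *)

Section UniformLimit.
Variable R : realType.

(** Cauchy's estimate turns uniform closeness of the maps into convergence of their differentials at
    [x]. The bound on the second-order remainder is uniform in [n], so it survives the limit. *)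
Lemma uniform_limit_differentiable (V : normedModType R[i]) (W : completeNormedModType R[i])
    (u : nat -> V -> W) (g : V -> W) (x : V) (r : R) : 0 < r ->
  (exists M, forall n y, (M <= n)%N -> nr (y - x) < r -> differentiable (u n) y) ->
  (forall e : R, 0 < e -> exists M, forall n y, (M <= n)%N -> nr (y - x) < r ->
     nr (u n y - g y) <= e) ->
  differentiable g x.
Proof.
move=> r0 [M0 du] hu.
have [M1 hM1] := hu 1 ltr01.
pose M := maxn M0 M1.
have xx : nr (x - x) = 0 by rewrite subrr nr0.
have [d d0 hd] := differentiable_nr_bound (du M x (leq_maxl _ _) ltac:(by rewrite xx)).
pose C := nr (u M x) + 3.
have C0 : 0 <= C by rewrite addr_ge0 ?nr_ge0.
pose q := Num.min r d.
have q0 : 0 < q by rewrite lt_min r0.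
have qr y : nr (y - x) < q -> nr (y - x) < r by rewrite lt_min => /andP[].
have hC n y : (M <= n)%N -> nr (y - x) < q -> nr (u n y) <= C.
  move=> hn hy; have hn1 := leq_trans (leq_maxr M0 M1) hn.
  have h1 := hM1 n y hn1 (qr _ hy); have h2 := hM1 M y (leq_maxr _ _) (qr _ hy).
  have h3 : nr (u M y) <= nr (u M x) + 1 by apply: hd; move: hy; rewrite lt_min => /andP[].
  have -> : u n y = (u n y - g y) - (u M y - g y) + u M y by lmod (R[i]) W.
  apply: le_trans (nrD _ _) _; have := nrB (u n y - g y) (u M y - g y).
  by rewrite /C; lra.
have dun n y : (M <= n)%N -> nr (y - x) < q -> differentiable (u n) y.
  by move=> hn /qr; apply: du; apply: leq_trans hn; apply: leq_maxl.
have dx n : (M <= n)%N -> differentiable (u n) x by move=> hn; apply: dun; rewrite ?xx.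
have lim v : exists l, forall e : R, 0 < e -> exists M', forall n, (M' <= n)%N ->
    nr (dif (u n) x v - l) <= e.
  apply: nr_complete => e e0.
  have v1 : 0 < nr v + 1 by rewrite ltr_wpDl // nr_ge0.
  pose e' := e * q / (864 * (nr v + 1)).
  have e'0 : 0 < e' by rewrite divr_gt0 ?mulr_gt0 ?ltr0n.
  have [M' hM'] := hu e' e'0.
  exists (maxn M M') => m n hm hn.
  have m1 := leq_trans (leq_maxl M M') hm; have m2 := leq_trans (leq_maxr M M') hm.
  have n1 := leq_trans (leq_maxl M M') hn; have n2 := leq_trans (leq_maxr M M') hn.
  have [d1 d2] := diff_sub (dx m m1) (dx n n1).
  rewrite -d2; apply: le_trans (@cauchy_differential _ _ _ _ x v q (2 * e') q0 _ _) _.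
  - by move=> y hy; have [] := diff_sub (dun m y m1 hy) (dun n y n1 hy).
  - move=> y hy; have h1 := hM' m y m2 (qr _ hy); have h2 := hM' n y n2 (qr _ hy).
    by apply: le_trans (nr_tri _ (g y) _) _; rewrite [nr (g y - _)]nrC; lra.
  have -> : 432 * (2 * e') / q * nr v = e / (nr v + 1) * (1 * nr v).
    by rewrite /e'; field; rewrite ?(gt_eqF q0) ?(gt_eqF v1).
  by rewrite -[leRHS]mulr1 scale_absorb ?nr_ge0 // ltW.
pose L v := projT1 (cid (lim v)).
have LP v : forall e : R, 0 < e -> exists M', forall n, (M' <= n)%N ->
    nr (dif (u n) x v - L v) <= e by rewrite /L; case: cid.
have gP y : nr (y - x) < q -> forall e : R, 0 < e -> exists M', forall n, (M' <= n)%N ->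
    nr (u n y - g y) <= e.
  by move=> hy e e0; have [M' hM'] := hu e e0; exists M' => n hn; apply: hM' => //; apply: qr.
have [] // := @differentiableI R V W g x L (432 * C / q).
- move=> k a b; apply/eqP; rewrite -subr_eq0; apply/eqP/nr_eq0 => e e0.
  have k0 : 0 < nr k + 1 by rewrite ltr_wpDl // nr_ge0.
  have [M1' h1] := LP (k *: a + b) (e / 3) (divr_gt0 e0 (ltr0n _ 3)).
  have [M2' h2] := LP a (e / 3 / (nr k + 1)) (divr_gt0 (divr_gt0 e0 (ltr0n _ 3)) k0).
  have [M3' h3] := LP b (e / 3) (divr_gt0 e0 (ltr0n _ 3)).
  pose n := maxn M1' (maxn M2' M3').
  have {}h1 := h1 n (leq_maxl _ _).
  have {}h2 := h2 n (leq_trans (leq_maxl _ _) (leq_maxr _ _)).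
  have {}h3 := h3 n (leq_trans (leq_maxr _ _) (leq_maxr _ _)).
  have -> : L (k *: a + b) - (k *: L a + L b) = - (dif (u n) x (k *: a + b) - L (k *: a + b))
    + (k *: (dif (u n) x a - L a) + (dif (u n) x b - L b)).
    by rewrite difD difZ; lmod (R[i]) W.
  apply: le_trans (nrD _ _) _; rewrite nrN; have := nrD (k *: (dif (u n) x a - L a)) (dif (u n) x b - L b).
  have : nr (k *: (dif (u n) x a - L a)) <= e / 3.
    rewrite nrZ; apply: (@le_trans _ _ (nr k * (e / 3 / (nr k + 1)))).
      by rewrite ler_wpM2l ?nr_ge0.
    have := @scale_absorb R (e / 3) 1 (nr k) ltac:(lra) ler01 (nr_ge0 k).
    by rewrite mul1r mulr1 mulrC.
  by lra.
- move=> v; rewrite -[L v]subr0; apply: (nr_lim_le (LP v)); exists M => n hn; rewrite subr0.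
  by apply: cauchy_differential => // y; [apply: dun|apply: hC].
- move=> e e0; pose K := cauchy2 R * C / q ^+ 2.
  have K0 : 0 < K + 1.
    by rewrite ltr_wpDl // divr_ge0 ?exprn_ge0 ?mulr_ge0 ?cauchy2_ge0 // ltW.
  exists (Num.min (q / 4) (e / (K + 1))).
    by rewrite lt_min !divr_gt0.
  move=> h; rewrite lt_min => /andP[h1 h2].
  have hk : K * nr h ^+ 2 <= e * nr h.
    rewrite expr2 mulrA ler_wpM2r ?nr_ge0 //.
    apply: (@le_trans _ _ ((K + 1) * nr h)); first by rewrite ler_wpM2r ?nr_ge0 // lerDl.
    by rewrite mulrC -ler_pdivlMr // ltW.
  apply: le_trans hk.
  have hx : nr (x + h - x) < q by rewrite addrAC subrr add0r; apply: lt_trans h1 _; lra.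
  have hxx : nr (x - x) < q by rewrite xx.
  apply/ler_addgt0Pr => e' e'0.
  have e'3 : 0 < e' / 3 by lra.
  have [M1' k1] := gP _ hx _ e'3; have [M2' k2] := gP _ hxx _ e'3.
  have [M3' k3] := LP h _ e'3.
  pose n := maxn M (maxn M1' (maxn M2' M3')).
  have n0 : (M <= n)%N := leq_maxl _ _.
  have {}k1 := k1 n (leq_trans (leq_maxl _ _) (leq_maxr _ _)).
  have {}k2 := k2 n (leq_trans (leq_trans (leq_maxl _ _) (leq_maxr _ _)) (leq_maxr _ _)).
  have {}k3 := k3 n (leq_trans (leq_trans (leq_maxr _ _) (leq_maxr _ _)) (leq_maxr _ _)).
  have -> : g (x + h) - g x - L h = (u n (x + h) - u n x - dif (u n) x h)
    - (u n (x + h) - g (x + h)) + ((u n x - g x) + (dif (u n) x h - L h)) by lmod (R[i]) W.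
  have := @cauchy_second_order R V W (u n) x h q C q0 C0 (fun y => @dun n y n0)
    (fun y => @hC n y n0) h1.
  rewrite -/K => k4; apply: le_trans (nrD _ _) _.
  have := nrB (u n (x + h) - u n x - dif (u n) x h) (u n (x + h) - g (x + h)).
  have := nrD (u n x - g x) (dif (u n) x h - L h).
  by lra.
Qed.

(** The directional derivative is a limit of difference quotients with steps [v / n.+1]; the
    second-order remainder bound makes this limit locally uniform. *)
Lemma directional_differentiable (V : normedModType R[i]) (W : completeNormedModType R[i])
    (g : V -> W) (x v : V) (r : R) : 0 < r ->
  (forall y, nr (y - x) < r -> differentiable g y) ->
  differentiable (fun y => dif g y v) x.
Proof.
move=> r0 dg.
have xx : nr (x - x) = 0 by rewrite subrr nr0.
have [d d0 hd] := differentiable_nr_bound (dg x ltac:(by rewrite xx)).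
pose C := nr (g x) + 1.
have C0 : 0 <= C by rewrite addr_ge0 ?nr_ge0.
pose q := Num.min r d.
have q0 : 0 < q by rewrite lt_min r0.
have qr y : nr (y - x) < q -> nr (y - x) < r by rewrite lt_min => /andP[].
have hC y : nr (y - x) < q -> nr (g y) <= C.
  by rewrite lt_min => /andP[_]; apply: hd.
have v1 : 0 < nr v + 1 by rewrite ltr_wpDl // nr_ge0.
pose h n : V := (n.+1%:R^-1 : R)%:C *: v.
have hn n : nr (h n) = n.+1%:R^-1 * nr v by rewrite nrZ nrR ger0_norm // invr_ge0.
have hsmall e : 0 < e -> exists M, forall n, (M <= n)%N -> n.+1%:R^-1 * (nr v + 1) < e.
  move=> e0; have e1 : 0 < (nr v + 1) / e by rewrite divr_gt0.
  exists (Num.truncn ((nr v + 1) / e)) => n hn1.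
  rewrite mulrC ltr_pdivrMr ?ltr0n // mulrC -ltr_pdivrMr //.
  by apply: lt_le_trans (truncnS_gt _) _; rewrite ler_nat.
have hsmall' e : 0 < e -> exists M, forall n, (M <= n)%N -> nr (h n) < e.
  move=> e0; have [M hM] := hsmall e e0; exists M => n /hM; rewrite hn.
  by apply: le_lt_trans; rewrite ler_wpM2l ?invr_ge0 // lerDl.
apply: (@uniform_limit_differentiable _ _
  (fun n y => (n.+1%:R : R)%:C *: (g (1 *: y + h n) - g y)) _ x (q / 2)).
- by lra.
- have [M hM] := hsmall' (q / 2) ltac:(lra); exists M => n y /hM hn2 hy.
  have d1 : differentiable g (1 *: y + h n).
    apply/dg/qr; have -> : 1 *: y + h n - x = (y - x) + h n by lmod (R[i]) V.
    by apply: le_lt_trans (nrD _ _) _; lra.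
  have d2 : differentiable g y by apply/dg/qr; lra.
  have [d3 _] := diff_affine_comp d1.
  by have [d4 _] := diff_sub d3 d2; have [] := diff_scale (n.+1%:R : R)%:C d4.
move=> e e0.
pose K := cauchy2 R * C / (q / 2) ^+ 2 * nr v.
have K0 : 0 <= K.
  by rewrite mulr_ge0 ?nr_ge0 // divr_ge0 ?exprn_ge0 ?mulr_ge0 ?cauchy2_ge0 //; lra.
have [M1 h1] := hsmall' (q / 8) ltac:(lra).
have [M2 h2] := hsmall (e / (K + 1)) ltac:(rewrite divr_gt0 //; lra).
exists (maxn M1 M2) => n y; rewrite geq_max => /andP[/h1 k1 /h2 k2] hy.
have hin z : nr (z - y) < q / 2 -> nr (z - x) < q.
  by move=> hz; apply: le_lt_trans (nr_tri _ y _) _; lra.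
have q2 : 0 < q / 2 by lra.
have hq4 : nr (h n) < q / 2 / 4 by lra.
have := @cauchy_second_order R V W g y (h n) (q / 2) C q2 C0
  (fun z hz => dg z (qr _ (hin z hz))) (fun z hz => hC z (hin z hz)) hq4.
have -> : dif g y (h n) = (n.+1%:R^-1 : R)%:C *: dif g y v by rewrite difZ.
move=> k3.
have nn : (n.+1%:R : R)%:C != 0 :> R[i] by rewrite eq_complex /= eqxx andbT pnatr_eq0.
have -> : (n.+1%:R : R)%:C *: (g (1 *: y + h n) - g y) - dif g y v =
  (n.+1%:R : R)%:C *: (g (y + h n) - g y - (n.+1%:R^-1 : R)%:C *: dif g y v).
  have -> : 1 *: y + h n = y + h n by rewrite scale1r.
  by rewrite fmorphV /=; move: (_%:C) nn => c nn; lmod (R[i]) W; field.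
rewrite nrZ nrR ger0_norm //.
have n0 : 0 < n.+1%:R :> R by rewrite ltr0n.
rewrite -ler_pdivlMl //; apply: le_trans k3 _.
have -> : cauchy2 R * C / (q / 2) ^+ 2 * nr (h n) ^+ 2 =
    n.+1%:R^-1 * (K * (n.+1%:R^-1 * nr v)) by rewrite hn /K; ring.
rewrite ler_wpM2l ?invr_ge0 //.
apply: (@le_trans _ _ ((K + 1) * (n.+1%:R^-1 * (nr v + 1)))).
  apply: ler_pM => //; last by rewrite ler_wpM2l ?invr_ge0 // lerDl.
    by rewrite mulr_ge0 ?invr_ge0 ?nr_ge0.
  by rewrite lerDl.
have K1 : 0 < K + 1 by lra.
by rewrite mulrC -ler_pdivlMr // ltW.
Qed.

End UniformLimit.

(** * Orders of vanishing and scaling *)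

Section Homogeneity.
Variables (R : realType) (V : normedModType R[i]) (W : completeNormedModType R[i]).

(** Cauchy's estimate on the ball of radius [nr y] around [y], where norms stay below [2 * nr y]. At
    [y = 0] that ball is empty, and balls around the origin are used: of radius [r / 2] for [k = 0],
    arbitrarily small otherwise. *)
Lemma differential_order (g : V -> W) (C r : R) (k : nat) (y v : V) : 0 < r -> 0 <= C ->
  (forall y, nr y < r -> differentiable g y) ->
  (forall y, nr y < r -> nr (g y) <= C * nr y ^+ k.+1) -> nr y < r / 2 ->
  nr (dif g y v) <= 432 * C * 2 ^+ k.+1 * nr v * nr y ^+ k.
Proof.
move=> r0 C0 dg hg hy.
have ball0 q : 0 < q -> q < r -> nr (dif g 0 v) <= 432 * (C * q ^+ k.+1) / q * nr v.
  move=> q0 qr; apply: cauchy_differential => // z; rewrite subr0 => hz.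
    by apply: dg; lra.
  apply: le_trans (hg z _) _; first by lra.
  by rewrite ler_wpM2l // lerXn2r ?nnegrE ?nr_ge0 ?ltW.
have [->|y0] := eqVneq y 0.
  case: k hg ball0 => [|k] hg ball0.
    rewrite nr0 expr0 mulr1; apply: le_trans (ball0 (r / 2) ltac:(lra) ltac:(lra)) _.
    have -> : 432 * (C * (r / 2) ^+ 1) / (r / 2) * nr v = 432 * C * nr v.
      by field; rewrite gt_eqF.
    have p0 : 0 <= 432 * C * nr v by rewrite !mulr_ge0 ?ler0n ?nr_ge0.
    have -> : 432 * C * 2 ^+ 1 * nr v = 2 * (432 * C * nr v) by ring.
    by move: (432 * C * nr v) p0 => c c0; lra.
  rewrite nr0 expr0n mulr0; apply/ler_addgt0Pr => e e0; rewrite add0r.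
  pose T := 432 * C * nr v + 1.
  have T0 : 0 < T by rewrite ltr_wpDl // !mulr_ge0 ?ler0n ?nr_ge0.
  pose q := Num.min (r / 2) (Num.min 1 (e / T)).
  have q0 : 0 < q by rewrite !lt_min ltr01 !divr_gt0.
  have [q1 [q2 q3]] : q <= r / 2 /\ q <= 1 /\ q <= e / T.
    by rewrite /q !ge_min !lexx /= !orbT.
  apply: le_trans (ball0 q q0 ltac:(lra)) _.
  have -> : 432 * (C * q ^+ k.+2) / q * nr v = (T - 1) * q * q ^+ k.
    by rewrite /T !exprS; field; rewrite gt_eqF.
  apply: (@le_trans _ _ (T * q)); last by rewrite mulrC -ler_pdivlMr.
  have T1 : 0 <= T - 1 by rewrite /T addrK !mulr_ge0 ?ler0n ?nr_ge0.
  have t0 : 0 <= (T - 1) * q by rewrite mulr_ge0 // ltW.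
  clearbody T.
  apply: le_trans (_ : (T - 1) * q <= _); last by rewrite ler_wpM2r ?ltW //; lra.
  by rewrite ler_piMr // exprn_ile1 // ltW.
have ny : 0 < nr y. by exact: nr_gt0.
have -> : 432 * C * 2 ^+ k.+1 * nr v * nr y ^+ k =
  432 * (C * (2 * nr y) ^+ k.+1) / nr y * nr v.
  by rewrite exprMn !exprS; field; rewrite gt_eqF.
have hz z : nr (z - y) < nr y -> nr z < 2 * nr y.
  by move=> h; rewrite -[z](subrK y); apply: le_lt_trans (nrD _ _) _; lra.
apply: cauchy_differential => // z /hz h; first by apply: dg; lra.
apply: le_trans (hg z _) _; first by lra.
rewrite ler_wpM2l // lerXn2r ?nnegrE ?nr_ge0 //; last exact: ltW.
by rewrite mulr_ge0 ?nr_ge0.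
Qed.

(* A holomorphic map of order [k] at [0] agrees with its homogeneous part up to
   order [k+1], so scaling by [d] multiplies it by [d^k] up to order [k+1];
   differentiating reduces [k+1] to [k]. *)
Lemma homogeneity_defect (k : nat) : exists2 K : R, 0 <= K &
  forall (g : V -> W) (C r : R) (d : R[i]), 0 < r -> 0 <= C ->
  (forall y, nr y < r -> differentiable g y) ->
  (forall y, nr y < r -> nr (g y) <= C * nr y ^+ k) -> nr d <= 1 ->
  forall x, nr x < r / 2 ^+ k.+2 ->
    nr (g (d *: x) - d ^+ k *: g x) <= K * C * nr x ^+ k.+1 / r.
Proof.
elim: k => [|k [K K0 ih]].
  exists 1728; first by rewrite ler0n.
  move=> g C r d r0 C0 dg hg d1 x hx.
  rewrite expr0 scale1r expr1.
  have hx2 : nr x < r / 2 by apply: lt_le_trans hx _; rewrite expr2; lra.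
  have hdx : nr (d *: x) <= nr x by rewrite nrZ ler_piMl ?nr_ge0.
  apply: le_trans (@cauchy_lipschitz _ _ _ g 0 (d *: x) x r C r0 _ _ _ _) _.
  - by move=> y; rewrite subr0; apply: dg.
  - by move=> y; rewrite subr0 => /hg; rewrite expr0 mulr1.
  - by rewrite subr0; lra.
  - by rewrite subr0.
  have -> : 1728 * C * nr x / r = 864 * C / r * (nr x + nr x) by field; rewrite gt_eqF.
  have c0 : 0 <= 864 * C / r by rewrite divr_ge0 ?mulr_ge0 ?ler0n // ltW.
  rewrite ler_wpM2l //.
  by apply: le_trans (nrB _ _) _; rewrite lerD2r.
exists (K * 432 * 2 ^+ k.+1 * 2); first by rewrite !mulr_ge0 ?ler0n ?exprn_ge0.
move=> g C r d r0 C0 dg hg d1 x hx.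
have r2 : 0 < r / 2 by lra.
have dle (z : V) : nr (d *: z) <= nr z by rewrite nrZ ler_piMl ?nr_ge0.
have g00 : g 0 = 0.
  apply: nr0_eq0; apply/eqP; rewrite eq_le nr_ge0 andbT.
  by have := hg 0; rewrite nr0 expr0n mulr0; apply.
(* Order constant of the directional derivative along [v], the map to which the induction hypothesis
   is applied. *)
pose C' (v : V) : R := 432 * C * 2 ^+ k.+1 * nr v.
have C'0 (v : V) : 0 <= C' v by rewrite !mulr_ge0 ?ler0n ?exprn_ge0 ?nr_ge0.
have step (v z : V) : nr z < r / 2 / 2 ^+ k.+2 ->
    nr (dif g (d *: z) v - d ^+ k *: dif g z v) <= K * C' v * nr z ^+ k.+1 / (r / 2).
  move=> hz; apply: (ih (fun y => dif g y v)) => //.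
    move=> y hy; have := @directional_differentiable _ _ _ g y v (r / 2) r2.
    apply=> z' hz'; apply: dg; rewrite -[z'](subrK y).
    by apply: le_lt_trans (nrD _ _) _; lra.
  by move=> y hy; apply: (@differential_order g C r k y v).
have r4 : r / 2 ^+ k.+3 = r / 2 / 2 ^+ k.+2 by rewrite exprS invfM mulrA.
have rle : r / 2 / 2 ^+ k.+2 < r / 2.
  by rewrite ltr_pdivrMr ?exprn_gt0 // ltr_pMr // exprn_egt1 // ltr1n.
(* The differential of [Phi] is [d] times the defect of the directional derivative in degree [k],
   and [Phi] vanishes at [0], so a mean value bound closes the induction. *)
pose Phi (z : V) := g (d *: z + 0) - d ^+ k.+1 *: g z.
have dPhi (z : V) : nr z < r / 2 -> differentiable Phi z /\
    forall v, dif Phi z v = d *: (dif g (d *: z) v - d ^+ k *: dif g z v).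
  move=> hz; have dg1 : differentiable g (d *: z + 0).
    by rewrite addr0; apply: dg; have := dle z; lra.
  have dg2 : differentiable g z by apply: dg; lra.
  have [a1 a2] := diff_affine_comp dg1; have [b1 b2] := diff_scale (d ^+ k.+1) dg2.
  have [c1 c2] := diff_sub a1 b1; split => // v.
  by rewrite c2 a2 b2 addr0 exprS scalerBr scalerA.
have : nr (Phi x - Phi 0) <= K * C' x * nr x ^+ k.+1 / (r / 2).
  apply: segment_bound => t /andP[t0 t1]; rewrite subr0 add0r.
  have hz : nr (t%:C *: x) <= nr x by rewrite nrZ nrR ger0_norm // ler_piMl ?nr_ge0.
  have hz2 : nr (t%:C *: x) < r / 2 by lra.
  have [e1 e2] := dPhi _ hz2; split => //; rewrite e2 nrZ.
  apply: le_trans (_ : nr (dif g (d *: (t%:C *: x)) x - d ^+ k *: dif g (t%:C *: x) x) <= _).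
    by rewrite ler_piMl ?nr_ge0.
  apply: le_trans (step x _ _) _; first by lra.
  have r2i : 0 <= (r / 2)^-1 by rewrite invr_ge0 ltW.
  have p := mulr_ge0 K0 (C'0 x); rewrite ler_wpM2r // ler_wpM2l //.
  by rewrite lerXn2r ?nnegrE ?nr_ge0.
rewrite /Phi scaler0 !addr0 g00 scaler0 subrr subr0 => h; apply: le_trans h _.
rewrite le_eqVlt; apply/orP; left; apply/eqP.
by rewrite /C' [nr x ^+ k.+2]exprS; field; rewrite gt_eqF.
Qed.

End Homogeneity.

(** * Neumann series and the exponential *)

Section Neumann.
Variables (R : realType) (V : completeNormedModType R[i]).

Lemma expr_small (q e : R) : 0 <= q < 1 -> 0 < e -> exists M, forall n, (M <= n)%N -> q ^+ n < e.
Proof.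
move=> /andP[q0 q1] e0.
have /cvg_expr : `|q| < 1 by rewrite ger0_norm.
move=> /cvgrPdist_lt /(_ e e0) [M _ hM]; exists M => n hn.
by have := hM n hn; rewrite sub0r normrN ger0_norm // exprn_ge0.
Qed.

Lemma geometric_limit (u : nat -> V) (c q : R) : 0 <= c -> 0 <= q < 1 ->
  (forall n, nr (u n.+1 - u n) <= c * q ^+ n) ->
  exists l, forall n, nr (u n - l) <= c * q ^+ n / (1 - q).
Proof.
move=> c0 /andP[q0 q1] hu; have q1' : 0 < 1 - q by lra.
have hk n k : nr (u (n + k)%N - u n) <= c * q ^+ n * (1 - q ^+ k) / (1 - q).
  elim: k => [|k ih]; first by rewrite addn0 subrr nr0 expr0 subrr mulr0 mul0r.
  rewrite addnS; apply: le_trans (nr_tri _ (u (n + k)%N) _) _.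
  apply: le_trans (lerD (hu _) ih) _.
  rewrite le_eqVlt; apply/orP; left; apply/eqP.
  by rewrite exprD exprS; field; rewrite gt_eqF.
have hk' n k : nr (u (n + k)%N - u n) <= c * q ^+ n / (1 - q).
  apply: le_trans (hk n k) _; rewrite ler_wpM2r ?invr_ge0 ?(ltW q1') //.
  by rewrite ler_piMr ?mulr_ge0 ?exprn_ge0 // lerBlDr lerDl exprn_ge0.
have [|l hl] := @nr_complete R V u.
  move=> e e0.
  have [M hM] := @expr_small q (e * (1 - q) / (2 * (c + 1))) ltac:(by apply/andP)
    ltac:(by rewrite divr_gt0 ?mulr_gt0 //; lra).
  exists M => m n hm hn.
  have h j : (M <= j)%N -> nr (u j - u M) <= e / 2.
    move=> /subnKC <-; apply: le_trans (hk' _ _) _.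
    have h1 := hM M (leqnn M).
    apply: (@le_trans _ _ ((c + 1) * (e * (1 - q) / (2 * (c + 1))) / (1 - q))).
      rewrite ler_wpM2r ?invr_ge0 ?(ltW q1') //; apply: ler_pM; rewrite ?exprn_ge0 //; lra.
    rewrite le_eqVlt; apply/orP; left; apply/eqP.
    by field; apply/andP; split; apply/eqP; lra.
  apply: le_trans (nr_tri _ (u M) _) _; have := h m hm; have := h n hn.
  by rewrite [nr (u n - _)]nrC; lra.
exists l => n; rewrite nrC; apply: (nr_lim_le hl); exists n => m /subnKC <-.
exact: hk'.
Qed.

(** [z = y + E z] is solved by iteration, and uniqueness of the solution makes it linear in [y]. *)
Lemma neumann (E : V -> V) (q : R) : 0 <= q < 1 ->
  (forall k u v, E (k *: u + v) = k *: E u + E v) -> (forall v, nr (E v) <= q * nr v) ->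
  exists L : V -> V, [/\ forall k u v, L (k *: u + v) = k *: L u + L v,
    forall v, nr (L v) <= (1 - q)^-1 * nr v & forall v, L v - E (L v) = v].
Proof.
move=> /andP[q0 q1] Elin Eb; have q1' : 0 < 1 - q by lra.
have EB u v : E (u - v) = E u - E v.
  by have := Elin (-1) v u; rewrite !scaleN1r addrC => ->; rewrite addrC.
have sol y : exists z, z = y + E z.
  pose u n := iter n (fun z => y + E z) 0.
  have hu n : nr (u n.+1 - u n) <= nr y * q ^+ n.
    elim: n => [|n ih].
      rewrite /u /= subr0 expr0 mulr1.
      by have := EB 0 0; rewrite subrr subrr => ->; rewrite addr0.
    have -> : u n.+2 - u n.+1 = E (u n.+1 - u n).
      by rewrite EB /u /= opprD addrACA subrr add0r.
    apply: le_trans (Eb _) _; rewrite exprS mulrCA ler_wpM2l //.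
  have [l hl] := geometric_limit (nr_ge0 y) (introT andP (conj q0 q1)) hu.
  exists l; apply/eqP; rewrite -subr_eq0; apply/eqP/nr_eq0 => e e0.
  have d0 : 0 < e * (1 - q) / (2 * (nr y + 1)).
    by rewrite divr_gt0 ?mulr_gt0 // ltr_wpDl // nr_ge0.
  have [M hM] := @expr_small q _ (introT andP (conj q0 q1)) d0.
  have y1 : 0 < nr y + 1 by rewrite ltr_wpDl // nr_ge0.
  have h j : (M <= j)%N -> nr (u j - l) <= e / 2.
    move=> hj; apply: le_trans (hl _) _; have h1 := hM j hj.
    apply: (@le_trans _ _ ((nr y + 1) * (e * (1 - q) / (2 * (nr y + 1))) / (1 - q))).
      rewrite ler_wpM2r ?invr_ge0 ?(ltW q1') //.
      by apply: ler_pM; rewrite ?exprn_ge0 ?nr_ge0 ?lerDl //; apply: ltW.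
    rewrite le_eqVlt; apply/orP; left; apply/eqP.
    by field; rewrite !gt_eqF.
  have -> : l - (y + E l) = - (u M.+1 - l) + E (u M - l).
    by rewrite EB /u /=; lmod (R[i]) V.
  apply: le_trans (nrD _ _) _; rewrite nrN; have := h M.+1 (leqnSn M).
  have : nr (E (u M - l)) <= e / 2.
    apply: le_trans (Eb _) _; apply: le_trans (h M (leqnn M)).
    by rewrite ler_piMl ?nr_ge0 // ltW.
  by lra.
have uniq y z z' : z = y + E z -> z' = y + E z' -> z = z'.
  move=> h h'; apply/eqP; rewrite -subr_eq0; apply/eqP/nr0_eq0/eqP.
  have : nr (z - z') <= q * nr (z - z').
    have {1}-> : z - z' = E (z - z') by rewrite EB {1}h {1}h'; lmod (R[i]) V.
    exact: Eb.
  move=> h1; rewrite eq_le nr_ge0 andbT.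
  have : (1 - q) * nr (z - z') <= 0 by lra.
  by rewrite pmulr_rle0.
pose L y := projT1 (cid (sol y)).
have LP y : L y = y + E (L y) by rewrite /L; case: cid.
exists L; split.
- move=> k u v; apply: (uniq (k *: u + v)) => //.
  by rewrite Elin {1}(LP u) {1}(LP v); lmod (R[i]) V.
- move=> v; rewrite mulrC ler_pdivlMr //.
  have := nrD v (E (L v)); rewrite -LP => h; have := Eb (L v); lra.
- by move=> v; rewrite {1}(LP v) addrK.
Qed.

End Neumann.

Lemma sum_triangle (V : zmodType) (f : nat -> nat -> V) n :
  \sum_(0 <= k < n) \sum_(0 <= i < k.+1) f i (k - i)%N =
  \sum_(0 <= i < n) \sum_(0 <= j < n - i) f i j.
Proof.
elim: n => [|n ih]; first by rewrite !big_geq.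
rewrite big_nat_recr //= ih [RHS]big_nat_recr //= subSnn big_nat1.
rewrite [X in _ + X]big_nat_recr //= subnn addrA; congr (_ + _).
rewrite -big_split /=; apply: eq_big_nat => i /andP[_ hi].
by rewrite subSn ?(ltnW hi) // big_nat_recr.
Qed.

Lemma binomial_exp (F : numFieldType) (x y : F) k :
  (x + y) ^+ k / k`!%:R =
  \sum_(0 <= i < k.+1) (x ^+ i / i`!%:R) * (y ^+ (k - i) / (k - i)`!%:R).
Proof.
rewrite addrC exprDn mulr_suml big_mkord; apply: eq_bigr => i _.
have hi : (i <= k)%N by rewrite -ltnS.
have f0 n : (n`!)%:R != 0 :> F by rewrite pnatr_eq0 -lt0n fact_gt0.
rewrite -(bin_fact hi) !natrM -[_ *+ 'C(k, i)]mulr_natr.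
have c0 : 'C(k, i)%:R != 0 :> F by rewrite pnatr_eq0 -lt0n bin_gt0.
by field; rewrite !f0 c0.
Qed.

(** * Inverses and the exponential series in a Banach algebra *)

Section BanachAlgebra.
Variables (R : realType) (A : completeNormedModType R[i]).
Variables (mul : A -> A -> A) (one : A).
Hypothesis ba : banach_algebra mul one.
Implicit Types a b c x y : A.

Lemma bmulBl a b c : mul (a - b) c = mul a c - mul b c.
Proof. by apply: (addIr (mul b c)); rewrite -(ba_mulDl ba) !subrK. Qed.
Lemma bmulBr a b c : mul a (b - c) = mul a b - mul a c.
Proof. by apply: (addIr (mul a c)); rewrite -(ba_mulDr ba) !subrK. Qed.
Lemma bmul0l a : mul 0 a = 0.
Proof. by apply: (addrI (mul 0 a)); rewrite -(ba_mulDl ba) !addr0. Qed.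
Lemma bmul0r a : mul a 0 = 0.
Proof. by apply: (addrI (mul a 0)); rewrite -(ba_mulDr ba) !addr0. Qed.
Lemma bnrM a b : nr (mul a b) <= nr a * nr b.
Proof. by rewrite -lecR rmorphM /= -!normE; exact: (ba_norm_mul ba). Qed.
Lemma bnr1 : nr one = 1.
Proof. by rewrite /nr (ba_norm1 ba). Qed.

Lemma bmul_suml (I : Type) (r : seq I) (F : I -> A) b :
  mul (\sum_(i <- r) F i) b = \sum_(i <- r) mul (F i) b.
Proof.
elim: r => [|i r ih]; first by rewrite !big_nil bmul0l.
by rewrite !big_cons (ba_mulDl ba) ih.
Qed.
Lemma bmul_sumr (I : Type) (r : seq I) (F : I -> A) b :
  mul b (\sum_(i <- r) F i) = \sum_(i <- r) mul b (F i).
Proof.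
elim: r => [|i r ih]; first by rewrite !big_nil bmul0r.
by rewrite !big_cons (ba_mulDr ba) ih.
Qed.

(** Neumann series for left and for right multiplication by [x] give one-sided inverses, which then
    coincide; the bound [2] is [1 / (1 - 1 / 2)]. *)
Lemma inverse_near_one x : nr x <= 2^-1 -> exists z,
  [/\ mul (one - x) z = one, mul z (one - x) = one & nr z <= 2].
Proof.
move=> hx.
have h2 : 0 <= (2^-1 : R) < 1 by apply/andP; split; lra.
have [L [_ Lb LP]] := @neumann R A (mul x) 2^-1 h2
  ltac:(by move=> k u v; rewrite (ba_mulDr ba) (ba_mulZr ba))
  ltac:(by move=> v; apply: le_trans (bnrM _ _) _; rewrite ler_wpM2r ?nr_ge0).
have [L' [_ Lb' LP']] := @neumann R A (fun v => mul v x) 2^-1 h2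
  ltac:(by move=> k u v /=; rewrite (ba_mulDl ba) (ba_mulZl ba))
  ltac:(by move=> v; apply: le_trans (bnrM _ _) _; rewrite mulrC ler_wpM2r ?nr_ge0).
have h1 : mul (one - x) (L one) = one by rewrite bmulBl (ba_mul1l ba) LP.
have h1' : mul (L' one) (one - x) = one by rewrite bmulBr (ba_mul1r ba) LP'.
have E : L' one = L one.
  have := ba_mulA ba (L' one) (one - x) (L one).
  by rewrite h1 h1' (ba_mul1r ba) (ba_mul1l ba).
exists (L one); split => //; first by rewrite -E.
apply: le_trans (Lb one) _; rewrite bnr1 mulr1.
have -> : 1 - 2^-1 = 2^-1 :> R by lra.
by rewrite invrK.
Qed.

Lemma invertibleM a b : invertible mul one a -> invertible mul one b ->
  invertible mul one (mul a b).
Proof.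
move=> [a' [h1 h2]] [b' [h3 h4]]; exists (mul b' a'); split.
  by rewrite -(ba_mulA ba) (ba_mulA ba b) h3 (ba_mul1l ba).
by rewrite -(ba_mulA ba) (ba_mulA ba a') h2 (ba_mul1l ba).
Qed.

Lemma ainvP a : invertible mul one a ->
  mul a (ainv mul one a) = one /\ mul (ainv mul one a) a = one.
Proof.
by move=> [b hb]; rewrite /ainv; case: xgetP => [c _ //|/(_ b)]; case.
Qed.

Definition cterm (b : A) (t : R) (k : nat) : A := (t ^+ k / k`!%:R)%:C *: apow mul one b k.
Definition psum (b : A) (t : R) (n : nat) : A := \sum_(0 <= k < n) cterm b t k.
(** Scalar majorant of [psum]: for [x] the product of the norms of [t] and [b], its increments
    dominate those of [psum], so that convergence and growth are read off from [expR]. *)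
Definition rsum (x : R) (n : nat) : R := \sum_(0 <= k < n) x ^+ k / k`!%:R.

Lemma apowD b i j : mul (apow mul one b i) (apow mul one b j) = apow mul one b (i + j).
Proof.
by elim: i => [|i ih]; rewrite ?(ba_mul1l ba) // addSn /= -/(apow _ _ _ _) -(ba_mulA ba) ih.
Qed.

Lemma apow_scale (k : R[i]) b n : apow mul one (k *: b) n = k ^+ n *: apow mul one b n.
Proof.
elim: n => [|n ih]; first by rewrite expr0 scale1r.
by rewrite /= -!/(apow _ _ _ _) ih (ba_mulZl ba) (ba_mulZr ba) scalerA exprS.
Qed.

Lemma nr_apow b n : nr (apow mul one b n) <= nr b ^+ n.
Proof.
elim: n => [|n ih]; first by rewrite expr0 bnr1.
rewrite /= -/(apow _ _ _ _) exprS; apply: le_trans (bnrM _ _) _.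
by rewrite ler_wpM2l ?nr_ge0.
Qed.

Lemma nr_cterm b t k : nr (cterm b t k) <= (`|t| * nr b) ^+ k / k`!%:R.
Proof.
rewrite /cterm nrZ nrR normrM normrX normfV [`|k`!%:R|]ger0_norm ?ler0n //.
by rewrite exprMn mulrAC ler_wpM2r ?invr_ge0 ?ler0n // ler_wpM2l ?exprn_ge0 ?nr_apow.
Qed.

Lemma aexp_series b (t : R) :
  series (fun k : nat => (k`!%:R)^-1 *: apow mul one (t%:C *: b) k) = psum b t.
Proof.
apply: funext => n; rewrite /series /psum /=; apply: eq_bigr => k _.
rewrite apow_scale scalerA /cterm; congr (_ *: _).
by rewrite rmorphM fmorphV rmorphXn rmorph_nat mulrC.
Qed.

Lemma rsum_cvg (x : R) : forall e : R, 0 < e -> exists M, forall n, (M <= n)%N ->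
  `|rsum x n - expR x| <= e.
Proof.
move=> e e0; have := @is_cvg_series_exp_coeff R x.
move=> /cvgrPdist_le /(_ e e0) [M _ hM]; exists M => n /hM.
by rewrite distrC.
Qed.

Lemma psum_dist b t m n : (m <= n)%N ->
  nr (psum b t n - psum b t m) <= rsum (`|t| * nr b) n - rsum (`|t| * nr b) m.
Proof.
move=> mn; rewrite /psum /rsum (big_cat_nat (leq0n m) mn) /= [X in X - _]addrC addrK.
rewrite [X in _ <= X - _](big_cat_nat (leq0n m) mn) /= [X in _ <= X - _]addrC addrK.
elim: n mn => [|n ih]; first by move=> _; rewrite !big_geq // nr0.
rewrite leq_eqVlt => /predU1P[->|mn]; first by rewrite !big_geq // nr0.
rewrite !big_nat_recr //=; apply: le_trans (nrD _ _) _; apply: lerD; first exact: ih.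
exact: nr_cterm.
Qed.

Lemma psum_cvg b (t : R) : forall e : R, 0 < e -> exists M, forall n, (M <= n)%N ->
  nr (psum b t n - aexp mul one (t%:C *: b)) <= e.
Proof.
have [l hl] : exists l, forall e : R, 0 < e -> exists M, forall n, (M <= n)%N ->
    nr (psum b t n - l) <= e.
  apply: nr_complete => e e0.
  have [M hM] := rsum_cvg (`|t| * nr b) (divr_gt0 e0 (ltr0n _ 2)).
  exists M.
  have key m n : (M <= m)%N -> (m <= n)%N -> nr (psum b t n - psum b t m) <= e.
    move=> hm mn; apply: le_trans (psum_dist _ _ mn) _.
    have := hM n (leq_trans hm mn); have := hM m hm.
    by rewrite !ler_norml => /andP[? ?] /andP[? ?]; lra.
  move=> m n hm hn; case: (leqP m n) => mn; first by rewrite nrC; apply: key.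
  by apply: key => //; apply: ltnW.
suff -> : aexp mul one (t%:C *: b) = l by [].
rewrite /aexp aexp_series; apply: cvg_lim => //.
move=> P /nbhs_nrP [d d0 hd].
have [M hM] := hl (d / 2) ltac:(lra).
exists M => // n /= hn; apply: hd; apply: le_lt_trans (hM n hn) _; lra.
Qed.

End BanachAlgebra.

(** * The one-parameter group generated by an element *)

Section Exponential.
Variables (R : realType) (A : completeNormedModType R[i]).
Variables (mul : A -> A -> A) (one : A).
Hypothesis ba : banach_algebra mul one.
Variable b : A.

Definition bexp (t : R) : A := aexp mul one (t%:C *: b).

Lemma bexp_near (t : R) (e : R) : 0 < e -> exists M, forall n, (M <= n)%N ->
  nr (psum mul one b t n - bexp t) <= e /\
  `|rsum (`|t| * nr b) n - expR (`|t| * nr b)| <= e.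
Proof.
move=> e0; have [M1 h1] := psum_cvg ba b t e0; have [M2 h2] := rsum_cvg (`|t| * nr b) e0.
exists (maxn M1 M2) => n; rewrite geq_max => /andP[n1 n2].
by split; [apply: h1|apply: h2].
Qed.

Lemma nr_bexp (t : R) : nr (bexp t) <= expR (`|t| * nr b).
Proof.
apply/ler_addgt0Pr => e e0.
have [M hM] := bexp_near t (divr_gt0 e0 (ltr0n _ 2)).
have [h1] := hM M (leqnn M); rewrite ler_norml => /andP[_ h2].
have := psum_dist ba b t (leq0n M); rewrite /psum /rsum !(@big_geq _ _ _ 0 0) //.
rewrite !subr0 -/(psum _ _ _ _ _) -/(rsum _ _) => h3.
have := nrB (psum mul one b t M) (psum mul one b t M - bexp t).
by rewrite subKr; lra.
Qed.

Lemma bexp_order2 (t : R) :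
  nr (bexp t - one - t%:C *: b) <= expR (`|t| * nr b) - 1 - `|t| * nr b.
Proof.
apply/ler_addgt0Pr => e e0.
have [M hM] := bexp_near t (divr_gt0 e0 (ltr0n _ 2)).
have [h1] := hM (maxn M 2) (leq_maxl _ _); rewrite ler_norml => /andP[_ h2].
have := psum_dist ba b t (leq_maxr M 2); set n := maxn M 2 in h1 h2 *.
have -> : psum mul one b t 2 = one + t%:C *: b.
  rewrite /psum big_nat_recr //= big_nat1 /cterm /= !expr0 expr1 !fact0 !divr1 (ba_mul1r ba).
  by rewrite scale1r.
have -> : rsum (`|t| * nr b) 2 = 1 + `|t| * nr b.
  by rewrite /rsum big_nat_recr //= big_nat1 expr0 expr1 !divr1.
have -> : bexp t - one - t%:C *: b = (psum mul one b t n - (one + t%:C *: b)) -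
  (psum mul one b t n - bexp t) by lmod (R[i]) A.
move=> h3; apply: le_trans (nrB _ _) _; lra.
Qed.

(** [expR (- x) >= 1 - x] gives [expR x <= 1 / (1 - x)], which is at most [1 + x + 2 * x ^+ 2] up to
    [x = 2^-1]. *)
Lemma expR_order2 (x : R) : 0 <= x <= 2^-1 -> expR x - 1 - x <= 2 * x ^+ 2.
Proof.
move=> /andP[x0 x2]; have := expR_ge1Dx (- x); rewrite expRN => h.
have h1 : 0 < 1 - x by lra.
have : expR x <= (1 - x)^-1.
  by rewrite -[expR x]invrK lef_pV2 ?posrE ?invr_gt0 ?expR_gt0.
have : (1 - x)^-1 <= 1 + x + 2 * x ^+ 2.
  rewrite -[leLHS]mul1r ler_pdivrMr //.
  have -> : (1 + x + 2 * x ^+ 2) * (1 - x) = 1 + x ^+ 2 * (1 - 2 * x) by ring.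
  by rewrite lerDl mulr_ge0 ?sqr_ge0 //; lra.
by lra.
Qed.

Lemma bexp_derivative (e : R) : 0 < e -> exists2 d : R, 0 < d & forall t : R, `|t| < d ->
  nr (bexp t - one - t%:C *: b) <= e * `|t|.
Proof.
move=> e0; have B0 : 0 < nr b + 1 by rewrite ltr_wpDl // nr_ge0.
have bb := nr_ge0 b.
exists (Num.min (2^-1 / (nr b + 1)) (e / (2 * (nr b + 1) ^+ 2))).
  by rewrite lt_min !divr_gt0 ?mulr_gt0 ?exprn_gt0.
move=> t; rewrite lt_min => /andP[t1 t2].
apply: le_trans (bexp_order2 t) _.
have hx : `|t| * nr b <= `|t| * (nr b + 1) by rewrite ler_wpM2l // lerDl.
have hx2 : `|t| * (nr b + 1) < 2^-1 by rewrite -ltr_pdivlMr.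
apply: le_trans (expR_order2 _) _.
  by apply/andP; split; [rewrite mulr_ge0|lra].
have : (`|t| * nr b) ^+ 2 <= (`|t| * (nr b + 1)) ^+ 2.
  by rewrite lerXn2r ?nnegrE ?mulr_ge0 // ltW.
have : `|t| * (2 * (nr b + 1) ^+ 2) <= e by rewrite -ler_pdivlMr ?ltW // mulr_gt0 ?exprn_gt0.
move=> /(ler_wpM2l (normr_ge0 t)); rewrite exprMn; lra.
Qed.

Lemma bexp0 : bexp 0 = one.
Proof.
apply/eqP; rewrite -subr_eq0; apply/eqP/nr_eq0 => e e0.
have := bexp_order2 0; rewrite normr0 mul0r expR0 scale0r !subr0 subrr => h.
by apply: le_trans h _; exact: ltW.
Qed.

(** Both sides collect exactly the products with [i + j >= n], on the right for the majorizing real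
    series. The addition law of [expR] thus implies that of [bexp]. *)
Lemma psum_mul_dist (s t : R) n :
  nr (mul (psum mul one b s n) (psum mul one b t n) - psum mul one b (s + t) n) <=
  rsum (`|s| * nr b) n * rsum (`|t| * nr b) n - rsum (`|s| * nr b + `|t| * nr b) n.
Proof.
have e1 : psum mul one b (s + t) n =
    \sum_(0 <= i < n) \sum_(0 <= j < n - i) mul (cterm mul one b s i) (cterm mul one b t j).
  rewrite -sum_triangle; apply: eq_big_nat => k _.
  rewrite /cterm binomial_exp rmorph_sum /= scaler_suml.
  apply: eq_big_nat => i /andP[_ hi]; rewrite (ba_mulZl ba) (ba_mulZr ba) (apowD ba).
  by rewrite scalerA subnKC // rmorphM.
have e2 : mul (psum mul one b s n) (psum mul one b t n) =
    \sum_(0 <= i < n) \sum_(0 <= j < n) mul (cterm mul one b s i) (cterm mul one b t j).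
  by rewrite (bmul_suml ba); apply: eq_bigr => i _; rewrite (bmul_sumr ba).
have e3 (x y : R) : rsum x n * rsum y n - rsum (x + y) n =
    \sum_(0 <= i < n) \sum_(n - i <= j < n) (x ^+ i / i`!%:R) * (y ^+ j / j`!%:R).
  have -> : rsum (x + y) n =
    \sum_(0 <= i < n) \sum_(0 <= j < n - i) (x ^+ i / i`!%:R) * (y ^+ j / j`!%:R).
    by rewrite -sum_triangle; apply: eq_big_nat => k _; rewrite binomial_exp.
  rewrite {1}/rsum mulr_suml -sumrB; apply: eq_big_nat => i _.
  rewrite mulr_sumr (big_cat_nat (leq0n (n - i)) (leq_subr i n)) /=.
  by rewrite [X in X - _]addrC addrK.
rewrite e1 e2 e3 -sumrB.
have hs (I : Type) (r : seq I) (F : I -> A) (G : I -> R) :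
    (forall i, nr (F i) <= G i) -> nr (\sum_(i <- r) F i) <= \sum_(i <- r) G i.
  move=> h; elim: r => [|i r ih]; first by rewrite !big_nil nr0.
  by rewrite !big_cons; apply: le_trans (nrD _ _) _; apply: lerD.
apply: (hs) => i.
rewrite [X in X - _](big_cat_nat (leq0n (n - i)) (leq_subr i n)) /= [X in X - _]addrC addrK.
apply: (hs) => j; apply: le_trans (bnrM ba _ _) _.
by apply: ler_pM; rewrite ?nr_ge0 ?nr_cterm.
Qed.

Lemma bexpD (s t : R) : mul (bexp s) (bexp t) = bexp (s + t).
Proof.
apply/eqP; rewrite -subr_eq0; apply/eqP/nr_eq0 => e e0.
pose x := `|s| * nr b; pose y := `|t| * nr b.
pose K := expR x + expR y + 4.
have K0 : 0 < K by have := expR_gt0 x; have := expR_gt0 y; rewrite /K; lra.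
pose d := Num.min 1 (e / (4 * K)).
have d0 : 0 < d by rewrite lt_min ltr01 divr_gt0 // mulr_gt0.
have [d1 d2] : d <= 1 /\ d <= e / (4 * K) by rewrite /d !ge_min !lexx orbT.
have [M1 h1] := bexp_near s d0; have [M2 h2] := bexp_near t d0.
have [M3 h3] := psum_cvg ba b (s + t) d0.
have [M4 h4] := rsum_cvg (x + y) d0.
pose n := maxn (maxn M1 M2) (maxn M3 M4).
have [{}h1 h1'] := h1 n (leq_trans (leq_maxl _ _) (leq_maxl _ _)).
have [{}h2 h2'] := h2 n (leq_trans (leq_maxr _ _) (leq_maxl _ _)).
have {}h3 := h3 n (leq_trans (leq_maxl _ _) (leq_maxr _ _)).
have {}h4 := h4 n (leq_trans (leq_maxr _ _) (leq_maxr _ _)).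
have h5 := psum_mul_dist s t n.
rewrite -/x -/y in h1' h2' h5.
set P := psum mul one b s n in h1 h5; set Q := psum mul one b t n in h2 h5.
set S := psum mul one b (s + t) n in h3 h5.
have -> : mul (bexp s) (bexp t) - bexp (s + t) =
   (mul P Q - S) + (S - bexp (s + t)) - (mul (P - bexp s) Q + mul (bexp s) (Q - bexp t)).
  by rewrite (bmulBl ba) (bmulBr ba); lmod (R[i]) A.
have hQ : nr Q <= expR y + 1.
  rewrite -[Q](subrK (bexp t)); apply: le_trans (nrD _ _) _.
  by have := nr_bexp t; rewrite -/y; lra.
have t1 : nr (mul (P - bexp s) Q) <= d * (expR y + 1).
  by apply: le_trans (bnrM ba _ _) _; apply: ler_pM; rewrite ?nr_ge0.
have t2 : nr (mul (bexp s) (Q - bexp t)) <= expR x * d.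
  by apply: le_trans (bnrM ba _ _) _; apply: ler_pM; rewrite ?nr_ge0 ?nr_bexp.
have t3 : rsum x n * rsum y n - rsum (x + y) n <= d * (expR x + expR y + 2).
  move: h1' h2' h4; rewrite !ler_norml => /andP[p1 p2] /andP[q1 q2] /andP[r1 r2].
  have hE : expR (x + y) = expR x * expR y by rewrite expRD.
  have x0 := expR_gt0 x; have y0 := expR_gt0 y.
  have rs0 z : 0 <= z -> 0 <= rsum z n.
    by move=> z0; apply: sumr_ge0 => i _; rewrite divr_ge0 ?exprn_ge0 ?ler0n.
  have : rsum x n * rsum y n <= (expR x + d) * (expR y + d).
    apply: ler_pM; rewrite ?rs0 ?mulr_ge0 ?nr_ge0 //; lra.
  have dd : d * d <= d by rewrite ler_piMl // ltW.
  by lra.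
have t4 : d * (4 * K) <= e by rewrite -ler_pdivlMr // mulr_gt0.
apply: le_trans (nrB _ _) _.
have := nrD (mul P Q - S) (S - bexp (s + t)).
have := nrD (mul (P - bexp s) Q) (mul (bexp s) (Q - bexp t)).
have h3' : nr (S - bexp (s + t)) <= d by exact: h3.
rewrite /K in t4; have x0 := expR_gt0 x; have y0 := expR_gt0 y.
have dx : 0 <= d * expR x by rewrite mulr_ge0 ?ltW.
have dy : 0 <= d * expR y by rewrite mulr_ge0 ?ltW.
by lra.
Qed.

Lemma bexpN (t : R) : mul (bexp t) (bexp (- t)) = one /\ mul (bexp (- t)) (bexp t) = one.
Proof. by rewrite !bexpD subrr addNr bexp0. Qed.

End Exponential.

(** * Rosenblum's theorem *)

Lemma bder_mul_id (R : realType) (E : lmodType R[i]) (N : E -> R -> Prop) f z a :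
  seminorm_bound N -> bder N f z a -> bder N (fun z => z *: f z) z (z *: a + f z).
Proof.
move=> SN [[cf hf] [ca ha] hd]; split.
- by exists (nr z * cf); apply: (sb_Z SN).
- by exists (nr z * ca + cf); apply: (sb_D SN) => //; apply: (sb_Z SN).
move=> e e0; have z0 := nr_ge0 z; have ca0 := sb_ge0 SN ha.
have [d d0 hd1] := hd (e / (2 * (nr z + 1))) ltac:(by rewrite divr_gt0 // mulr_gt0 //; lra).
exists (Num.min d (Num.min 1 (e / (2 * (ca + 1))))).
  by rewrite !lt_min d0 ltr01 divr_gt0 // mulr_gt0 //; lra.
move=> h; rewrite !lt_min => /and3P[h1 h2 h3].
have -> : (z + h) *: f (z + h) - z *: f z - h *: (z *: a + f z) =
  (z + h) *: (f (z + h) - f z - h *: a) + (h * h) *: a by lmod (R[i]) E.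
apply: (sb_le SN) (sb_D SN (sb_Z SN _ (hd1 h h1)) (sb_Z SN _ ha)).
rewrite nrM; have hh := nr_ge0 h; have hz := nrD z h.
have t1 : nr (z + h) * (e / (2 * (nr z + 1)) * nr h) <= e / 2 * nr h.
  apply: (@le_trans _ _ ((nr z + 1) * (e / (2 * (nr z + 1)) * nr h))).
    rewrite ler_wpM2r //; last by lra.
    by rewrite mulr_ge0 // divr_ge0 ?mulr_ge0 //; lra.
  by rewrite le_eqVlt; apply/orP; left; apply/eqP; field; rewrite gt_eqF //; lra.
have t2 : nr h * nr h * ca <= e / 2 * nr h.
  rewrite mulrAC ler_wpM2r //; apply: (@le_trans _ _ (nr h * (ca + 1))).
    by rewrite ler_wpM2l // lerDl.
  rewrite -ler_pdivlMr; last by lra.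
  have -> : e / 2 / (ca + 1) = e / (2 * (ca + 1)) by rewrite invfM mulrA.
  exact: ltW.
by lra.
Qed.

Section Rosenblum.
Variables (R : realType) (A : completeNormedModType R[i]).
Variables (mul : A -> A -> A) (one : A).
Hypothesis ba : banach_algebra mul one.

Definition resolvent (c : A) (z : R[i]) : A := ainv mul one (c - z *: one).

Lemma inverse_unique x y y' : mul y x = one -> mul x y' = one -> y = y'.
Proof.
move=> h h'; have := ba_mulA ba y x y'.
by rewrite h h' (ba_mul1l ba) (ba_mul1r ba).
Qed.

Lemma resolvent_comm c z : invertible mul one (c - z *: one) ->
  mul c (resolvent c z) = mul (resolvent c z) c.
Proof.
move=> /(ainvP) []; rewrite -/(resolvent c z) (bmulBl ba) (bmulBr ba) (ba_mulZl ba) (ba_mulZr ba).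
rewrite (ba_mul1l ba) (ba_mul1r ba) => h h'.
by apply: (addIr (- (z *: resolvent c z))); rewrite h h'.
Qed.

(** [c - (z + h)] factors as [one - h r] times [c - z], and the first factor is inverted by a
    Neumann series. The expansion is the resolvent identity [r' - r = h r' r], applied twice. *)
Lemma resolvent_near c z h : invertible mul one (c - z *: one) ->
  nr h * nr (resolvent c z) <= 2^-1 ->
  [/\ invertible mul one (c - (z + h) *: one),
      nr (resolvent c (z + h)) <= 2 * nr (resolvent c z)
    & resolvent c (z + h) - resolvent c z - h *: mul (resolvent c z) (resolvent c z) =
      (h * h) *: mul (resolvent c (z + h)) (mul (resolvent c z) (resolvent c z))].
Proof.
move=> inv hh; have [i1 i2] := ainvP inv; rewrite -/(resolvent c z) in i1 i2.
set r := resolvent c z in hh i1 i2 *; set u := c - z *: one in i1 i2.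
have hhr : nr (h *: r) <= 2^-1 by rewrite nrZ.
have [s [s1 s2 s3]] := inverse_near_one ba hhr.
have eu' : c - (z + h) *: one = mul (one - h *: r) u.
  by rewrite (bmulBl ba) (ba_mul1l ba) (ba_mulZl ba) i2 /u; lmod (R[i]) A.
have hu1 : mul (c - (z + h) *: one) (mul r s) = one.
  by rewrite eu' -(ba_mulA ba) (ba_mulA ba u) i1 (ba_mul1l ba) s1.
have hu2 : mul (mul r s) (c - (z + h) *: one) = one.
  by rewrite eu' -(ba_mulA ba) (ba_mulA ba s) s2 (ba_mul1l ba) i2.
have inv' : invertible mul one (c - (z + h) *: one) by exists (mul r s).
have [j1 j2] := ainvP inv'; rewrite -/(resolvent c (z + h)) in j1 j2.
have er : resolvent c (z + h) = mul r s by apply: inverse_unique j2 hu1.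
set r' := resolvent c (z + h) in j1 j2 er *.
split => //.
  rewrite er mulrC; apply: le_trans (bnrM ba _ _) _.
  by rewrite ler_wpM2l ?nr_ge0.
have e1 : r' - r = h *: mul r' r.
  have : mul r' (mul (u - (c - (z + h) *: one)) r) = r' - r.
    by rewrite (bmulBl ba) i1 (bmulBr ba) (ba_mul1r ba) (ba_mulA ba) j2 (ba_mul1l ba).
  move=> <-; have -> : u - (c - (z + h) *: one) = h *: one by rewrite /u; lmod (R[i]) A.
  by rewrite (ba_mulZl ba) (ba_mul1l ba) (ba_mulZr ba).
have -> : r' - r - h *: mul r r = h *: mul (r' - r) r.
  by rewrite (bmulBl ba) {1}e1; lmod (R[i]) A.
by rewrite e1 (ba_mulZl ba) scalerA (ba_mulA ba).
Qed.

Lemma resolvent_far c z : 2 * nr c + 1 <= nr z ->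
  invertible mul one (c - z *: one) /\ nr (resolvent c z) <= 2 / nr z.
Proof.
move=> hz; have c0 := nr_ge0 c; have z0 : 0 < nr z by lra.
have zn : z != 0 by apply/eqP => E; move: z0; rewrite E nr0 ltxx.
have hs : nr (z^-1 *: c) <= 2^-1.
  by rewrite nrZ nrV mulrC ler_pdivrMr //; lra.
have [s [s1 s2 s3]] := inverse_near_one ba hs.
have eu : c - z *: one = (- z) *: (one - z^-1 *: c).
  by lmod (R[i]) A; field.
have h1 : mul (c - z *: one) ((- z)^-1 *: s) = one.
  rewrite eu (ba_mulZl ba) (ba_mulZr ba) s1 scalerA mulfV ?scale1r // oppr_eq0 //.
have h2 : mul ((- z)^-1 *: s) (c - z *: one) = one.
  rewrite eu (ba_mulZl ba) (ba_mulZr ba) s2 scalerA mulVf ?scale1r // oppr_eq0 //.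
have inv : invertible mul one (c - z *: one) by exists ((- z)^-1 *: s).
split => //; have [j1 j2] := ainvP inv; rewrite -/(resolvent c z) in j1 j2.
rewrite (inverse_unique j2 h1) nrZ nrV nrN mulrC.
by rewrite ler_wpM2r // invr_ge0 ltW.
Qed.

Variables a b : A.
Hypothesis ab : forall z : R[i],
  invertible mul one (a - z *: one) \/ invertible mul one (b - z *: one).

(** Commuting with left multiplication by [a] and right multiplication by [b], [W] commutes with
    [sylvester]; an approximate right inverse is then an approximate left inverse too. *)
Definition bimodule_map (W : A -> A) : Prop :=
  [/\ forall k u v, W (k *: u + v) = k *: W u + W v,
      exists c, forall v, nr (W v) <= c * nr v,
      forall v, W (mul a v) = mul a (W v)
    & forall v, W (mul v b) = mul (W v) b].

Definition sylvester (y : A) : A := mul a y - mul y b.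

(* [codist S c]: [S] is within [c] of an operator [sylvester \o W], [W] a bimodule map *)
Definition codist (S : A -> A) (c : R) : Prop :=
  0 <= c /\ exists2 W, bimodule_map W & forall y, nr (S y - sylvester (W y)) <= c * nr y.

Lemma sylvester_linear k u v : sylvester (k *: u + v) = k *: sylvester u + sylvester v.
Proof.
rewrite /sylvester (ba_mulDr ba) (ba_mulDl ba) (ba_mulZr ba) (ba_mulZl ba).
by lmod (R[i]) A.
Qed.

Lemma bimodule_linear k W W' : bimodule_map W -> bimodule_map W' ->
  bimodule_map (fun y => k *: W y + W' y).
Proof.
move=> [l [c hc] m1 m2] [l' [c' hc'] m1' m2']; split.
- by move=> k' u v; rewrite l l'; lmod (R[i]) A.
- exists (nr k * c + c') => v; apply: le_trans (nrD _ _) _.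
  by rewrite mulrDl nrZ -mulrA; apply: lerD => //; rewrite ler_wpM2l ?nr_ge0.
- by move=> v; rewrite m1 m1' (ba_mulDr ba) (ba_mulZr ba).
- by move=> v; rewrite m2 m2' (ba_mulDl ba) (ba_mulZl ba).
Qed.

Lemma bimodule_0 : bimodule_map (fun=> 0).
Proof.
split; first by move=> *; rewrite scaler0 addr0.
- by exists 0 => v; rewrite nr0 mul0r.
- by move=> v; rewrite (bmul0r ba).
- by move=> v; rewrite (bmul0l ba).
Qed.

Lemma codist_seminorm : seminorm_bound (E := (A -> A) : lmodType R[i]) codist.
Proof.
split.
- move=> S c c' cc' [c0 [W hW h]]; split; first exact: le_trans cc'.
  by exists W => // y; apply: le_trans (h y) _; rewrite ler_wpM2r ?nr_ge0.
- by move=> S c [].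
- split => //; exists (fun=> 0); first exact: bimodule_0.
  move=> y; rewrite /sylvester (bmul0l ba) (bmul0r ba) !subr0 mul0r.
  by change (nr (0 : A) <= 0); rewrite nr0.
- move=> S S' c c' [c0 [W hW h]] [c'0 [W' hW' h']]; split; first exact: addr_ge0.
  exists (fun y => 1 *: W y + W' y); first exact: bimodule_linear.
  move=> y; rewrite sylvester_linear mulrDl.
  change (nr (S y + S' y - (1 *: sylvester (W y) + sylvester (W' y))) <= c * nr y + c' * nr y).
  have -> : S y + S' y - (1 *: sylvester (W y) + sylvester (W' y)) =
    (S y - sylvester (W y)) + (S' y - sylvester (W' y)) by lmod (R[i]) A.
  by apply: le_trans (nrD _ _) _; apply: lerD.
- move=> k S c [c0 [W hW h]]; split; first by rewrite mulr_ge0 ?nr_ge0.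
  exists (fun y => k *: W y + 0); first exact: bimodule_linear hW bimodule_0.
  move=> y; change (nr (k *: S y - sylvester (k *: W y + 0)) <= nr k * c * nr y).
  have -> : sylvester (k *: W y + 0) = k *: sylvester (W y).
    by rewrite sylvester_linear {2}/sylvester (bmul0l ba) (bmul0r ba) subr0 addr0.
  by rewrite -scalerBr nrZ -mulrA ler_wpM2l ?nr_ge0.
Qed.

Lemma codist_bound (S : A -> A) c : 0 <= c -> (forall y, nr (S y) <= c * nr y) -> codist S c.
Proof.
move=> c0 h; split => //; exists (fun=> 0); first exact: bimodule_0.
by move=> y; rewrite /sylvester (bmul0l ba) (bmul0r ba) !subr0.
Qed.

Lemma codist_left x : codist (mul x) (nr x).
Proof. by apply: codist_bound (nr_ge0 x) _ => y; exact: (bnrM ba). Qed.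

Lemma codist_right x : codist (fun y => mul y x) (nr x).
Proof. by apply: codist_bound (nr_ge0 x) _ => y; rewrite mulrC; exact: (bnrM ba). Qed.

(** Meaningful on the whole plane, because [ab] leaves no point in both spectra. Jumps between the
    two branches are invisible to [codist]. *)
Definition joint_resolvent (z : R[i]) : A -> A :=
  if pselect (invertible mul one (a - z *: one)) is left _
  then mul (resolvent a z) else fun y => mul y (resolvent b z).

Lemma joint_resolvent_left z : invertible mul one (a - z *: one) ->
  joint_resolvent z = mul (resolvent a z).
Proof. by rewrite /joint_resolvent; case: pselect. Qed.

(* where both resolvents exist their difference factors through [sylvester] *)
Lemma joint_resolvent_right z : invertible mul one (b - z *: one) ->
  codist (joint_resolvent z - (fun y => mul y (resolvent b z))) 0.
Proof.
move=> ib; rewrite /joint_resolvent; case: pselect => [ia|_]; last first.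
  by rewrite subrr; exact: (sb_0 codist_seminorm).
have ca := resolvent_comm ia; have cb := resolvent_comm ib.
have [a1 a2] := ainvP ia; have [b1 b2] := ainvP ib.
rewrite -/(resolvent a z) in a1 a2; rewrite -/(resolvent b z) in b1 b2.
set ra := resolvent a z in a1 a2 ca *; set rb := resolvent b z in b1 b2 cb *.
(* [sylvester] of this witness telescopes, by [a ra = one + z ra] and [rb b = one + z rb]; the two
   terms in [z] cancel. *)
split => //; exists (fun y => - mul ra (mul y rb)).
  split.
  - move=> k u v; rewrite (ba_mulDl ba) (ba_mulDr ba) (ba_mulZl ba) (ba_mulZr ba).
    by lmod (R[i]) A.
  - exists (nr ra * nr rb) => v; rewrite nrN; apply: le_trans (bnrM ba _ _) _.
    rewrite -mulrA ler_wpM2l ?nr_ge0 // mulrC; exact: (bnrM ba).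
  - move=> v; rewrite -scaleN1r -[in RHS]scaleN1r (ba_mulZr ba).
    by rewrite -(ba_mulA ba a) (ba_mulA ba a ra) ca -(ba_mulA ba).
  - move=> v; rewrite -scaleN1r -[in RHS]scaleN1r (ba_mulZl ba).
    by rewrite -!(ba_mulA ba) cb.
move=> y; rewrite mul0r.
change (nr (mul ra y - mul y rb - sylvester (- mul ra (mul y rb))) <= 0).
have -> : sylvester (- mul ra (mul y rb)) = mul ra y - mul y rb; last by rewrite subrr nr0.
have e1 : mul ra (mul (mul y rb) b) = mul ra y + z *: mul ra (mul y rb).
  have h : mul rb b = one + z *: rb.
    by rewrite -b2 (bmulBr ba) (ba_mulZr ba) (ba_mul1r ba) subrK.
  by rewrite -(ba_mulA ba y) h (ba_mulDr ba) (ba_mulZr ba) (ba_mul1r ba) (ba_mulDr ba) (ba_mulZr ba).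
have e2 : mul a (mul ra (mul y rb)) = mul y rb + z *: mul ra (mul y rb).
  have h : mul a ra = one + z *: ra.
    by rewrite -a1 (bmulBl ba) (ba_mulZl ba) (ba_mul1l ba) subrK.
  by rewrite (ba_mulA ba) h (ba_mulDl ba) (ba_mulZl ba) (ba_mul1l ba).
rewrite /sylvester -scaleN1r (ba_mulZr ba) (ba_mulZl ba) e2 -(ba_mulA ba ra) e1.
by lmod (R[i]) A.
Qed.

(** Invertibility of [a - z] persists nearby, so a point of the left branch has neighbours on the
    left branch only. Around the other points values may switch branch, at zero cost for
    [codist]. *)
Lemma joint_resolvent_bder z : exists d, bder (E := (A -> A) : lmodType R[i]) codist
  joint_resolvent z d.
Proof.
have SN := codist_seminorm.
have small (r : A) (e : R) : 0 < e -> exists2 d : R, 0 < d & forall h : R[i], nr h < d ->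
    nr h * nr r <= 2^-1 /\ nr h * (2 * nr r * (nr r * nr r)) <= e.
  move=> e0; have r0 := nr_ge0 r.
  have T0 : 0 < 2 * nr r * (nr r * nr r) + 1.
    by rewrite ltr_wpDl // !mulr_ge0.
  exists (Num.min (2^-1 / (nr r + 1)) (e / (2 * nr r * (nr r * nr r) + 1))).
    by rewrite lt_min !divr_gt0 //; lra.
  move=> h; rewrite lt_min => /andP[h1 h2]; have hh := nr_ge0 h; split.
    apply: (@le_trans _ _ (nr h * (nr r + 1))); first by rewrite ler_wpM2l // lerDl.
    by rewrite -ler_pdivlMr ?ltW //; lra.
  apply: (@le_trans _ _ (nr h * (2 * nr r * (nr r * nr r) + 1))).
    by rewrite ler_wpM2l // lerDl.
  by rewrite -ler_pdivlMr ?ltW.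
have second (r r' : A) (h : R[i]) (e : R) : nr r' <= 2 * nr r ->
    nr h * (2 * nr r * (nr r * nr r)) <= e -> nr ((h * h) *: mul r' (mul r r)) <= e * nr h.
  move=> h1 h2; rewrite nrZ nrM -mulrA mulrC ler_wpM2r ?nr_ge0 //; apply: le_trans h2.
  rewrite ler_wpM2l ?nr_ge0 //; apply: le_trans (bnrM ba _ _) _.
  by apply: ler_pM; rewrite ?nr_ge0 ?(bnrM ba).
case: (ab z) => iz.
- set r := resolvent a z; exists (mul (mul r r)); split.
  + by exists (nr r); rewrite (joint_resolvent_left iz); exact: codist_left.
  + by exists (nr (mul r r)); exact: codist_left.
  move=> e e0; have [d d0 hd] := small r e e0; exists d => // h /hd[h1 h2].
  have [i1 i2 i3] := resolvent_near iz h1.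
  rewrite (joint_resolvent_left iz) (joint_resolvent_left i1) -/r.
  have -> : mul (resolvent a (z + h)) - mul r - h *: mul (mul r r) =
     mul ((h * h) *: mul (resolvent a (z + h)) (mul r r)).
    apply: funext => y.
    change (mul (resolvent a (z + h)) y - mul r y - h *: mul (mul r r) y =
      mul ((h * h) *: mul (resolvent a (z + h)) (mul r r)) y).
    by rewrite -i3 (bmulBl ba) (bmulBl ba) (ba_mulZl ba).
  by apply: (sb_le SN) (codist_left _); exact: second.
- set r := resolvent b z; exists (fun y => mul y (mul r r)).
  have jr := joint_resolvent_right iz; rewrite -/r in jr.
  split.
  + exists (0 + nr r); rewrite -[joint_resolvent z](subrK (fun y => mul y r)).
    exact: (sb_D SN) jr (codist_right r).
  + by exists (nr (mul r r)); exact: codist_right.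
  move=> e e0; have [d d0 hd] := small r e e0; exists d => // h /hd[h1 h2].
  have [i1 i2 i3] := resolvent_near iz h1; have jr' := joint_resolvent_right i1.
  rewrite -/r in i2 i3; set r' := resolvent b (z + h) in i2 i3 jr'.
  have -> : joint_resolvent (z + h) - joint_resolvent z - h *: (fun y => mul y (mul r r)) =
     (joint_resolvent (z + h) - (fun y => mul y r')) - (joint_resolvent z - (fun y => mul y r))
     + (fun y => mul y ((h * h) *: mul r' (mul r r))).
    apply: funext => y.
    change (joint_resolvent (z + h) y - joint_resolvent z y - h *: mul y (mul r r) =
     (joint_resolvent (z + h) y - mul y r') - (joint_resolvent z y - mul y r)
     + mul y ((h * h) *: mul r' (mul r r))).
    by rewrite -i3 (bmulBr ba) (bmulBr ba) (ba_mulZr ba); lmod (R[i]) A.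
  have := sb_D SN (sb_B SN jr' jr) (codist_right ((h * h) *: mul r' (mul r r))).
  by apply: (sb_le SN); rewrite !add0r; exact: second.
Qed.

Lemma joint_resolvent_far z : 2 * nr a + 1 <= nr z -> codist (joint_resolvent z) (2 / nr z).
Proof.
move=> hz; have [i1 i2] := resolvent_far hz.
by rewrite (joint_resolvent_left i1); apply: (sb_le codist_seminorm) (codist_left _).
Qed.

(* Liouville: the joint resolvent is entire modulo operators factoring through
   [sylvester] and vanishes at infinity, so it is zero modulo those. *)
Lemma joint_resolvent_0 (e : R) : 0 < e -> codist (joint_resolvent 0) e.
Proof.
move=> e0; have SN := codist_seminorm; have a0 := nr_ge0 a.
(* The first summand puts the annulus beyond [l / 3] where the resolvent of [a] is at most
   [2 / nr z]; the second makes [144 * 2 / l] at most [e / 2]. *)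
pose l := 3 * (2 * nr a + 1) + 576 / e.
have l1 : 576 / e <= l by rewrite /l lerDr; lra.
have l2 : 2 * nr a + 1 <= l / 3.
  by have h : 0 <= 576 / e by [rewrite divr_ge0 ?ler0n // ltW]; rewrite /l; lra.
have l0 : 0 < l by lra.
have [d hd] := joint_resolvent_bder 0.
(* [z *: joint_resolvent z] vanishes at [0], has derivative [joint_resolvent 0] there, and is
   bounded by [2] far away: Cauchy's estimate with a large [l] applies to it. *)
have h0 := bder_mul_id SN hd; rewrite scale0r add0r in h0.
have := @cauchy_bound R _ codist SN (fun z => z *: joint_resolvent z) 0
  (joint_resolvent 0) l 2 l0 _ h0 _ _ (e / 2) (divr_gt0 e0 (ltr0n _ 2)).
have le : 144 * 2 / l + e / 2 <= e.
  have : 144 * 2 / l <= e / 2.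
    rewrite ler_pdivrMr //; have e2 : 0 <= e / 2 by lra.
    have := ler_wpM2l e2 l1; have -> : e / 2 * (576 / e) = 144 * 2 by field; rewrite gt_eqF.
    by [].
  by lra.
move=> h; apply: (sb_le SN) le (h _ _ _).
- by move=> z _; have [d' hd'] := joint_resolvent_bder z; eexists; exact: (bder_mul_id SN hd').
- move=> z; rewrite subr0 => /andP[z1 z2].
  have z3 : 2 * nr a + 1 <= nr z by lra.
  have := sb_Z SN z (joint_resolvent_far z3); rewrite mulrCA divff ?mulr1 //.
  by apply/eqP => E; move: z3; rewrite E; lra.
- by rewrite scale0r; apply: (sb_le SN) (sb_0 SN).
Qed.

(** At [z = 0] the joint resolvent is multiplication by the inverse of [a] or of [b]. Multiplying
    back by [a] or [b] turns its small [codist] into an approximate solution of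
    [sylvester (W y) = y]; the error factor [2^-1] leaves room for the perturbation in
    [homological_inverse]. *)
Theorem rosenblum : exists2 W, bimodule_map W &
  forall y, nr (y - sylvester (W y)) <= 2^-1 * nr y.
Proof.
have a0 := nr_ge0 a; have b0 := nr_ge0 b.
pose e := (2 * (nr a + nr b + 1))^-1.
have e0 : 0 < e by rewrite invr_gt0; lra.
have ea : nr a * e <= 2^-1.
  by rewrite /e invfM mulrCA ler_piMr // ler_pdivrMr ?mul1r; lra.
have eb : nr b * e <= 2^-1.
  by rewrite /e invfM mulrCA ler_piMr // ler_pdivrMr ?mul1r; lra.
have [_ [W [l [c hc] m1 m2] hW]] := joint_resolvent_0 e0.
have scale0 c' : c' - 0 *: one = c' by rewrite scale0r subr0.
case: (pselect (invertible mul one (a - 0 *: one))) => ia.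
- rewrite (joint_resolvent_left ia) in hW; have [a1 _] := ainvP ia.
  rewrite -/(resolvent a 0) {1}scale0 in a1.
  exists (fun y => mul a (W y)).
    split.
    + by move=> k u v; rewrite l (ba_mulDr ba) (ba_mulZr ba).
    + exists (nr a * c) => v; apply: le_trans (bnrM ba _ _) _.
      by rewrite -mulrA ler_wpM2l.
    + by move=> v; rewrite m1.
    + by move=> v; rewrite m2 (ba_mulA ba).
  move=> y; have -> : y - sylvester (mul a (W y)) =
      mul a (mul (resolvent a 0) y - sylvester (W y)).
    by rewrite (bmulBr ba) (ba_mulA ba) a1 (ba_mul1l ba) /sylvester (bmulBr ba) (ba_mulA ba a (W y)).
  apply: le_trans (bnrM ba _ _) _.
  apply: (@le_trans _ _ (nr a * (e * nr y))); first by rewrite ler_wpM2l.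
  by rewrite mulrA ler_wpM2r ?nr_ge0.
- have ib : invertible mul one (b - 0 *: one) by case: (ab 0).
  have [_ b1] := ainvP ib; rewrite -/(resolvent b 0) [X in mul _ X]scale0 in b1.
  have hW' y : nr (mul y (resolvent b 0) - sylvester (W y)) <= e * nr y.
    by have := hW y; rewrite /joint_resolvent; case: pselect.
  exists (fun y => mul (W y) b).
    split.
    + by move=> k u v; rewrite l (ba_mulDl ba) (ba_mulZl ba).
    + exists (c * nr b) => v; apply: le_trans (bnrM ba _ _) _.
      by rewrite mulrAC ler_wpM2r.
    + by move=> v; rewrite m1 (ba_mulA ba).
    + by move=> v; rewrite m2.
  move=> y; have -> : y - sylvester (mul (W y) b) =
      mul (mul y (resolvent b 0) - sylvester (W y)) b.
    by rewrite (bmulBl ba) -(ba_mulA ba) b1 (ba_mul1r ba) /sylvester (bmulBl ba) (ba_mulA ba a (W y)).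
  apply: le_trans (bnrM ba _ _) _.
  apply: (@le_trans _ _ (e * nr y * nr b)); first by rewrite ler_wpM2r.
  by rewrite mulrAC ler_wpM2r ?nr_ge0 // mulrC.
Qed.

End Rosenblum.

(** * The local conjugation equation *)

Section Product.
Variables (R : realType) (X : normedModType R[i]) (A : completeNormedModType R[i]).
Variables (mul : A -> A -> A) (one : A).
Hypothesis ba : banach_algebra mul one.

Lemma mul_increment (g0 g1 h0 h1 dg dh : A) :
  mul g1 h1 - mul g0 h0 - (mul dg h0 + mul g0 dh) =
  mul (g1 - g0 - dg) h0 + mul g0 (h1 - h0 - dh) + mul (g1 - g0) (h1 - h0).
Proof. by rewrite !(bmulBl ba) !(bmulBr ba); lmod (R[i]) A. Qed.

Lemma differentiable_mul (g h : X -> A) x : differentiable g x -> differentiable h x ->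
  differentiable (fun y => mul (g y) (h y)) x.
Proof.
move=> dg dh; have [[cg cg0 hcg] hg] := differentiableEP dg.
have [[ch ch0 hch] hh] := differentiableEP dh.
have g0 := nr_ge0 (g x); have h0 := nr_ge0 (h x).
have [] // := @differentiableI R X A (fun y => mul (g y) (h y)) x
  (fun v => mul (dif g x v) (h x) + mul (g x) (dif h x v)) (cg * nr (h x) + nr (g x) * ch).
- move=> k u v; rewrite !difD !difZ (ba_mulDl ba) (ba_mulDr ba) (ba_mulZl ba) (ba_mulZr ba).
  by lmod (R[i]) A.
- move=> v; apply: le_trans (nrD _ _) _; rewrite mulrDl; apply: lerD.
    by apply: le_trans (bnrM ba _ _) _; rewrite mulrAC ler_wpM2r.
  by apply: le_trans (bnrM ba _ _) _; rewrite -mulrA ler_wpM2l.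
move=> e e0.
pose T := nr (g x) + nr (h x) + cg + ch + 2.
have T0 : 0 < T by rewrite /T; lra.
have [d1 d10 hd1] := hg (Num.min 1 (e / (4 * T))) ltac:(by rewrite lt_min ltr01 divr_gt0 // mulr_gt0).
have [d2 d20 hd2] := hh (Num.min 1 (e / (4 * T))) ltac:(by rewrite lt_min ltr01 divr_gt0 // mulr_gt0).
exists (Num.min (Num.min d1 d2) (e / (4 * T ^+ 2))).
  by rewrite !lt_min d10 d20 divr_gt0 // mulr_gt0 // exprn_gt0.
move=> v; rewrite !lt_min => /andP[/andP[v1 v2] v3].
have hv := nr_ge0 v.
set s := Num.min 1 (e / (4 * T)) in hd1 hd2.
have [s1 s2] : s <= 1 /\ s <= e / (4 * T) by rewrite /s !ge_min !lexx orbT.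
have s0 : 0 <= s by rewrite /s le_min ler01 divr_ge0 ?mulr_ge0 // ltW.
have {}hd1 := hd1 v v1; have {}hd2 := hd2 v v2.
set rg := g (x + v) - g x - dif g x v in hd1.
set rh := h (x + v) - h x - dif h x v in hd2.
have eg : g (x + v) - g x = rg + dif g x v by rewrite subrK.
have eh : h (x + v) - h x = rh + dif h x v by rewrite subrK.
rewrite mul_increment -/rg -/rh eg eh.
move: (rg) (rh) (dif g x v) (dif h x v) hd1 hd2 (hcg v) (hch v) => {rg rh eg eh} rg rh lg lh hd1 hd2 hcg' hch'.
have k1 : nr (mul rg (h x)) <= e / 4 * nr v.
  apply: le_trans (bnrM ba _ _) _.
  apply: (@le_trans _ _ (s * nr v * T)).
    by apply: ler_pM; rewrite ?nr_ge0 // /T; lra.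
  by rewrite mulrAC ler_wpM2r // -ler_pdivlMr // -[e / 4 / T]mulrA -invfM.
have k2 : nr (mul (g x) rh) <= e / 4 * nr v.
  apply: le_trans (bnrM ba _ _) _.
  apply: (@le_trans _ _ (T * (s * nr v))).
    by apply: ler_pM; rewrite ?nr_ge0 // /T; lra.
  by rewrite mulrA ler_wpM2r // mulrC -ler_pdivlMr // -[e / 4 / T]mulrA -invfM.
have k3 : nr (mul (rg + lg) (rh + lh)) <= e / 4 * nr v.
  apply: le_trans (bnrM ba _ _) _.
  have sv : s * nr v <= nr v by rewrite ler_piMl.
  have kg : nr (rg + lg) <= T * nr v.
    apply: le_trans (nrD _ _) _; have := hcg'.
    have : (1 + cg) * nr v <= T * nr v by rewrite ler_wpM2r // /T; lra.
    by lra.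
  have kh : nr (rh + lh) <= T * nr v.
    apply: le_trans (nrD _ _) _; have := hch'.
    have : (1 + ch) * nr v <= T * nr v by rewrite ler_wpM2r // /T; lra.
    by lra.
  apply: le_trans (ler_pM (nr_ge0 _) (nr_ge0 _) kg kh) _.
  rewrite mulrA ler_wpM2r // mulrAC -expr2 mulrC -ler_pdivlMr ?exprn_gt0 //.
  by rewrite -[e / 4 / _]mulrA -invfM ltW.
apply: le_trans (nrD _ _) _; have := nrD (mul rg (h x)) (mul (g x) rh).
have := mulr_ge0 (ltW e0) hv.
by lra.
Qed.

Lemma differentiable_bounded_linear (S : A -> A) (c : R) (g : X -> A) x :
  (forall k u v, S (k *: u + v) = k *: S u + S v) -> (forall v, nr (S v) <= c * nr v) ->
  differentiable g x -> differentiable (fun y => S (g y)) x.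
Proof.
move=> Slin Sb dg.
have SB u v : S (u - v) = S u - S v.
  by have := Slin (-1) v u; rewrite !scaleN1r addrC => ->; rewrite addrC.
have [dS _] : differentiable S (g x) /\ dif S (g x) = S :> (A -> A).
  apply: (@differentiableI R A A S (g x) S c) => // e e0; exists 1 => // h _.
  have -> : S (g x + h) - S (g x) - S h = 0.
    by rewrite -!SB [g x + h]addrC addrK subrr -[0 in LHS](subrr (0 : A)) SB subrr.
  by rewrite nr0 mulr_ge0 ?nr_ge0 // ltW.
exact: (differentiable_comp dg dS).
Qed.

End Product.

(** Two halves with separate uses: the bounded linear right inverse serves existence, the lower
    bound serves uniqueness. *)
Definition boundedly_invertible (R : realType) (A : normedModType R[i]) (H : A -> A) :=
  (exists S c, [/\ forall k u v, S (k *: u + v) = k *: S u + S v,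
     forall v, nr (S v) <= c * nr v & forall v, H (S v) = v]) /\
  exists2 c : R, 0 <= c & forall v, nr v <= c * nr (H v).

Section Local.
Variables (R : realType) (X : normedModType R[i]) (A : completeNormedModType R[i]).
Variables (mul : A -> A -> A) (one : A).
Hypothesis ba : banach_algebra mul one.
(** In the application [Em] and [Ep] are [e^{-tB0}] and [e^{tB0}], and [d] is [e^{-tw}]; [q] and
    [kap] bound the contraction rate of [Phi] and the norm of [G] near [0]. *)
Variables (Phi : X -> X) (G : X -> A) (Em Ep : A) (d : R[i]) (r0 C0 : R).
Hypothesis r00 : 0 < r0.
Hypothesis C00 : 0 <= C0.
Hypothesis dPhi : forall y, nr y < r0 -> differentiable Phi y.
Hypothesis dG : forall y, nr y < r0 -> differentiable G y.
Hypothesis Phi2 : forall y, nr y < r0 -> nr (Phi y - d *: y) <= C0 * nr y ^+ 2.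
Hypothesis G1 : forall y, nr y < r0 -> nr (G y - Ep) <= C0 * nr y.
Hypothesis EmEp : mul Em Ep = one.
Variables (N : nat) (q kap : R).
Hypothesis dq : nr d < q.
Hypothesis q1 : q < 1.
Hypothesis Epkap : nr Ep < kap.
Hypothesis contr : nr Em * kap * q ^+ N < 1.

Definition transfer (P : X -> A) (y : X) : A := mul (mul Em (P (Phi y))) (G y).

Definition homological (k : nat) (y : A) : A := d ^+ k *: mul (mul Em y) Ep - y.

Hypothesis hom_inv : forall k, (0 < k < N)%N -> boundedly_invertible (homological k).

Definition holo0 (g : X -> A) := exists2 r : R, 0 < r & forall y, nr y < r -> differentiable g y.
Definition order0 (k : nat) (g : X -> A) := exists r C : R, [/\ 0 < r, 0 <= C &
  forall y, nr y < r -> nr (g y) <= C * nr y ^+ k].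

Lemma small_ball : exists r1 : R, [/\ 0 < r1, r1 <= r0 &
  forall y, nr y < r1 -> nr (Phi y) <= q * nr y /\ nr (G y) <= kap].
Proof.
have C0_ := C00; have r0_ := r00; have dq_ := dq; have q1_ := q1; have Ep_ := Epkap.
have C1 : 0 < C0 + 1 by lra.
exists (Num.min r0 (Num.min ((q - nr d) / (C0 + 1)) ((kap - nr Ep) / (C0 + 1)))); split.
- rewrite !lt_min; apply/and3P; split => //; rewrite divr_gt0 //; lra.
- by rewrite ge_min lexx.
move=> y; rewrite !lt_min => /and3P[y1 y2 y3].
have y0 := nr_ge0 y.
have k0 : C0 * nr y <= (C0 + 1) * nr y by rewrite ler_wpM2r //; lra.
split.
  rewrite -[Phi y](subrK (d *: y)); apply: le_trans (nrD _ _) _; rewrite nrZ.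
  have := Phi2 y1; have : C0 * nr y ^+ 2 <= (q - nr d) * nr y.
    rewrite expr2 mulrA ler_wpM2r //; apply: le_trans k0 _.
    by rewrite mulrC -ler_pdivlMr // ltW.
  by lra.
rewrite -[G y](subrK Ep); apply: le_trans (nrD _ _) _.
have := G1 y1; have : (C0 + 1) * nr y <= kap - nr Ep by rewrite mulrC -ler_pdivlMr // ltW.
by lra.
Qed.

Lemma Phi0 : Phi 0 = 0.
Proof.
have := @Phi2 0; rewrite nr0 expr0n mulr0 scaler0 subr0 => /(_ r00) h.
by apply: nr0_eq0; apply/eqP; rewrite eq_le h nr_ge0.
Qed.

Lemma G0 : G 0 = Ep.
Proof.
have := @G1 0; rewrite nr0 mulr0 => /(_ r00) h.
by apply/eqP; rewrite -subr_eq0; apply/eqP/nr0_eq0/eqP; rewrite eq_le h nr_ge0.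
Qed.

Lemma transfer_linear k P Q y :
  transfer (fun z => k *: P z + Q z) y = k *: transfer P y + transfer Q y.
Proof. by rewrite /transfer (ba_mulDr ba) (ba_mulZr ba) (ba_mulDl ba) (ba_mulZl ba). Qed.

Lemma transfer_holo P r : 0 < r -> (forall y, nr y < r -> differentiable P y) ->
  forall y, nr y < r0 -> nr (Phi y) < r -> differentiable (transfer P) y.
Proof.
move=> rr dP y y1 y2; apply: (differentiable_mul ba); last exact: dG.
apply: (differentiable_mul ba); first exact: differentiable_cst.
exact: (differentiable_comp (dPhi y1) (dP _ y2)).
Qed.

(** Three replacements, each with an error of order [k.+1]: [Phi y] by its linear part, [D (d *: y)]
    by [d ^+ k *: D y] through [homogeneity_defect], and [G y] by [Ep]. *)
Lemma transfer_order k D : holo0 D -> order0 k D ->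
  order0 k.+1 (fun y => transfer D y - d ^+ k *: mul (mul Em (D y)) Ep).
Proof.
have C0_ := C00; have r0_ := r00; have dq_ := dq; have q1_ := q1; have Ep_ := Epkap.
case=> ra ra0 dD [rb [C [rb0 Cge hC]]].
have [rc [rc0 rcr0 hrc]] := small_ball.
have [K K0 hK] := homogeneity_defect X A k.
pose r := Num.min ra rb.
have rr0 : 0 < r by rewrite lt_min ra0.
have dr y : nr y < r -> differentiable D y by rewrite lt_min => /andP[/dD].
have hr y : nr y < r -> nr (D y) <= C * nr y ^+ k by rewrite lt_min => /andP[_ /hC].
have dd1 : nr d <= 1 by lra.
have Em0 := nr_ge0 Em; have kap0 : 0 <= kap by have := nr_ge0 Ep; lra.
pose K1 := 864 * C * 4 ^+ k / 4 * C0.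
have K10 : 0 <= K1 by rewrite !mulr_ge0 ?ler0n ?exprn_ge0 ?invr_ge0 ?ler0n.
pose K2 := K * C / r.
have K20 : 0 <= K2 by rewrite divr_ge0 ?mulr_ge0 // ltW.
exists (Num.min rc (Num.min (r / 4) (r / 2 ^+ k.+2))).
exists (nr Em * K1 * kap + nr Em * K2 * kap + nr Em * C * C0); split.
- by rewrite !lt_min rc0 !divr_gt0 ?exprn_gt0.
- exact: addr_ge0 (addr_ge0 (mulr_ge0 (mulr_ge0 Em0 K10) kap0)
    (mulr_ge0 (mulr_ge0 Em0 K20) kap0)) (mulr_ge0 (mulr_ge0 Em0 Cge) C0_).
move=> y; rewrite !lt_min => /and3P[y1 y2 y3].
have y0 : nr y < r0 by lra.
have [p1 p2] := hrc y y1.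
have ny := nr_ge0 y.
have Py : nr (Phi y) <= nr y by apply: le_trans p1 _; rewrite ler_piMl // ltW.
have dy : nr (d *: y) <= nr y by rewrite nrZ ler_piMl.
have -> : transfer D y - d ^+ k *: mul (mul Em (D y)) Ep =
    mul (mul Em (D (Phi y) - D (d *: y))) (G y) +
    mul (mul Em (D (d *: y) - d ^+ k *: D y)) (G y) +
    mul (mul Em (d ^+ k *: D y)) (G y - Ep).
  rewrite /transfer !(bmulBr ba) !(bmulBl ba) !(ba_mulZr ba) !(ba_mulZl ba).
  by lmod (R[i]) A.
have t1 : nr (D (Phi y) - D (d *: y)) <= K1 * nr y ^+ k.+1.
  have [E|yn] := eqVneq y 0.
    by rewrite E Phi0 scaler0 subrr !nr0 expr0n mulr0.
  have np : 0 < nr y.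
    by rewrite lt_neqAle ny andbT eq_sym; apply/eqP => /nr0_eq0 /eqP; apply/negP.
  (* Both points lie in half of the ball of radius [4 * nr y], on which [D] is at most
     [C * (4 * nr y) ^+ k]; the quadratic error of [Phi], divided by that radius, leaves one extra
     power of [nr y]. *)
  have := @cauchy_lipschitz _ _ _ D 0 (Phi y) (d *: y) (4 * nr y) (C * (4 * nr y) ^+ k)
    ltac:(lra) _ _ _ _.
  rewrite !subr0 => h; apply: le_trans (h _ _ _ _) _ => {h}.
  - by move=> z; rewrite subr0 => hz; apply: dr; lra.
  - move=> z; rewrite subr0 => hz; apply: le_trans (hr _ _) _; first lra.
    by rewrite ler_wpM2l // lerXn2r ?nnegrE ?nr_ge0 ?mulr_ge0 // ltW.
  - by lra.
  - by lra.
  apply: (@le_trans _ _ (864 * (C * (4 * nr y) ^+ k) / (4 * nr y) * (C0 * nr y ^+ 2))).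
    apply: ler_wpM2l (Phi2 y0); apply: divr_ge0; last by lra.
    apply: mulr_ge0; first exact: ler0n.
    by apply: mulr_ge0 => //; apply: exprn_ge0; lra.
  rewrite le_eqVlt; apply/orP; left; apply/eqP.
  by rewrite /K1 exprMn [nr y ^+ k.+1]exprS; field; rewrite gt_eqF.
have t2 : nr (D (d *: y) - d ^+ k *: D y) <= K2 * nr y ^+ k.+1.
  by have := hK D C r d rr0 Cge dr hr dd1 y y3; rewrite /K2 mulrAC.
have t3 : nr (d ^+ k *: D y) <= C * nr y ^+ k.
  rewrite nrZ; apply: le_trans (hr y _); last by lra.
  rewrite ler_piMl ?nr_ge0 //.
  by elim: (k) => [|j ih]; rewrite ?expr0 ?nr1 // exprS nrM mulr_ile1 ?nr_ge0.
have b3 a1 a2 a3 c1 c3 : 0 <= c1 -> nr a2 <= c1 -> nr a3 <= c3 ->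
    a1 = Em -> nr (mul (mul a1 a2) a3) <= nr Em * c1 * c3.
  move=> c10 h2 h3 ->; apply: le_trans (bnrM ba _ _) _.
  apply: ler_pM; rewrite ?nr_ge0 //.
  by apply: le_trans (bnrM ba _ _) _; rewrite ler_wpM2l.
have yk : 0 <= nr y ^+ k by exact: exprn_ge0.
have yk1 : 0 <= nr y ^+ k.+1 by exact: exprn_ge0.
have u1 := b3 Em _ _ _ _ (mulr_ge0 K10 yk1) t1 p2 erefl.
have u2 := b3 Em _ _ _ _ (mulr_ge0 K20 yk1) t2 p2 erefl.
have u3 := b3 Em _ _ _ _ (mulr_ge0 Cge yk) t3 (G1 y0) erefl.
have f1 : nr Em * (K1 * nr y ^+ k.+1) * kap = nr Em * K1 * kap * nr y ^+ k.+1 by ring.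
have f2 : nr Em * (K2 * nr y ^+ k.+1) * kap = nr Em * K2 * kap * nr y ^+ k.+1 by ring.
have f3 : nr Em * (C * nr y ^+ k) * (C0 * nr y) = nr Em * C * C0 * nr y ^+ k.+1.
  by rewrite [nr y ^+ k.+1]exprS; ring.
rewrite f1 in u1; rewrite f2 in u2; rewrite f3 in u3.
apply: le_trans (nrD _ _) _; rewrite mulrDl; apply: lerD u3.
by apply: le_trans (nrD _ _) _; rewrite mulrDl; apply: lerD.
Qed.

Lemma transfer_holo0 P : holo0 P -> holo0 (transfer P).
Proof.
have q1_ := q1; have r0_ := r00; have dq_ := dq; have dd := nr_ge0 d.
case=> r rr dP; have [r1 [r10 r1r0 hr1]] := small_ball.
exists (Num.min r1 r); first by rewrite lt_min r10.
move=> y; rewrite lt_min => /andP[y1 y2]; have [h1 _] := hr1 y y1.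
apply: (transfer_holo rr dP); first by lra.
apply: le_lt_trans h1 _; apply: le_lt_trans y2; rewrite ler_piMl ?nr_ge0 //; lra.
Qed.

Lemma holo0_linear c g h : holo0 g -> holo0 h -> holo0 (fun y => c *: g y + h y).
Proof.
case=> ra ra0 dg [rb rb0 dh]; exists (Num.min ra rb); first by rewrite lt_min ra0.
move=> y; rewrite lt_min => /andP[/dg d1 /dh d2].
exact: (differentiableD (proj1 (diff_scale c d1)) d2).
Qed.

(** Composition with [Phi] gains the factor [q ^+ N] on maps of order [N], which by [contr]
    outweighs [nr Em] and [kap]. *)
Lemma transfer_contraction rmax : 0 < rmax -> exists r t : R,
  [/\ 0 < r, r <= rmax, 0 <= t < 1, forall y, nr y < r -> nr (Phi y) <= nr y &
   forall D C, 0 <= C -> (forall y, nr y < r -> nr (D y) <= C * nr y ^+ N) ->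
     forall y, nr y < r -> nr (transfer D y) <= C * t * nr y ^+ N].
Proof.
move=> rm0.
have q1_ := q1; have r0_ := r00; have dq_ := dq; have dd := nr_ge0 d.
have Ep_ := Epkap; have nEp := nr_ge0 Ep; have nEm := nr_ge0 Em.
have [r1 [r10 r1r0 hr1]] := small_ball.
have P1 y : nr y < r1 -> nr (Phi y) <= nr y.
  by move=> /hr1[h _]; apply: le_trans h _; rewrite ler_piMl ?nr_ge0 //; lra.
have qN : 0 <= q ^+ N by apply: exprn_ge0; lra.
have kap0 : 0 <= kap by lra.
exists (Num.min r1 rmax), (nr Em * kap * q ^+ N); split.
- by rewrite lt_min r10.
- by rewrite ge_min lexx orbT.
- by rewrite contr andbT; apply: mulr_ge0 => //; apply: mulr_ge0.
- by move=> y; rewrite lt_min => /andP[/P1].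
move=> D C hC hD y hy; have yr1 : nr y < r1 by move: hy; rewrite lt_min => /andP[].
have [h1 h2] := hr1 y yr1.
have h3 : nr (D (Phi y)) <= C * (q * nr y) ^+ N.
  apply: le_trans (hD _ _) _; first by apply: le_lt_trans (P1 y yr1) hy.
  rewrite ler_wpM2l // lerXn2r ?nnegrE ?nr_ge0 //.
  by apply: mulr_ge0 (nr_ge0 _); lra.
have -> : C * (nr Em * kap * q ^+ N) * nr y ^+ N = nr Em * (C * (q * nr y) ^+ N) * kap.
  by rewrite exprMn; ring.
apply: le_trans (bnrM ba _ _) _; apply: ler_pM; rewrite ?nr_ge0 //.
by apply: le_trans (bnrM ba _ _) _; apply: ler_wpM2l.
Qed.

Lemma holo0_order1 D : holo0 D -> D 0 = 0 -> order0 1 D.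
Proof.
case=> r rr dD D0; have d0 : differentiable D 0 by apply: dD; rewrite nr0.
have [[c c0 hc] /(_ 1 ltr01) [e e0 he]] := differentiableEP d0.
exists e, (c + 1); split => //; first by lra.
move=> y /he; rewrite add0r D0 subr0 expr1 mul1r => h.
rewrite -[D y](subrK (dif D 0 y)); apply: le_trans (nrD _ _) _.
by have := hc y; lra.
Qed.

(** For a fixed map of order [k], [homological k (D y)] has order [k.+1], so the lower bound raises
    the order of [D] itself. From order [N] on, iterating the contraction forces [D] to vanish. *)
Lemma local_uniqueness D : (0 < N)%N -> holo0 D -> D 0 = 0 ->
  (exists2 r : R, 0 < r & forall y, nr y < r -> D y = transfer D y) ->
  exists2 r : R, 0 < r & forall y, nr y < r -> D y = 0.
Proof.
move=> N0 hD D0 [r rr hT].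
have ord k : (k < N)%N -> order0 k.+1 D.
  elim: k => [|k ih] kN; first exact: holo0_order1.
  have [ra [C [ra0 Cge hC]]] := transfer_order hD (ih (ltnW kN)).
  have [_ [w w0 hw]] := hom_inv (k := k.+1) ltac:(by rewrite kN).
  exists (Num.min r ra), (w * C); split; first by rewrite lt_min rr.
    exact: mulr_ge0.
  move=> y; rewrite lt_min => /andP[/hT h1 /hC h2].
  apply: le_trans (hw _) _; rewrite -mulrA ler_wpM2l //.
  by rewrite /homological nrC {1}h1.
have [rb [C [rb0 Cge hC]]] := ord N.-1 ltac:(by rewrite prednK).
rewrite prednK // in hC.
have rmin : 0 < Num.min r rb by rewrite lt_min rr.
have [ra [t [ra0 hra ht hP hTr]]] := transfer_contraction rmin.
have rar : ra <= r by move: hra; rewrite le_min => /andP[].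
have rab : ra <= rb by move: hra; rewrite le_min => /andP[].
have it n : forall y, nr y < ra -> nr (D y) <= C * t ^+ n * nr y ^+ N.
  elim: n => [|n ih] y hy; first by rewrite expr0 mulr1; apply: hC; apply: lt_le_trans rab.
  rewrite (hT y (lt_le_trans hy rar)) exprSr mulrA; apply: hTr => //.
  by apply: mulr_ge0 => //; apply: exprn_ge0; case/andP: ht.
exists ra => // y hy; apply: nr_eq0 => e e0.
have T0 : 0 < C * nr y ^+ N + 1 by apply: ltr_wpDl => //; apply: mulr_ge0 => //; apply: exprn_ge0 (nr_ge0 _).
have [M hM] := expr_small ht (divr_gt0 e0 T0).
apply: le_trans (it M y hy) _; have := hM M (leqnn M); rewrite ltr_pdivlMr // => h.
rewrite mulrAC; apply: le_trans (ltW h); rewrite mulrC; apply: ler_wpM2l; last by rewrite lerDl.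
by apply: exprn_ge0; case/andP: ht.
Qed.

(** [P] is corrected by [- S (Q y)], with [Q] the defect and [S] the right inverse in degree [n.+1].
    [S] acts on the values of the whole defect instead of its leading homogeneous part; this only
    affects higher orders. *)
Lemma approximate_solution n : (n < N)%N -> exists P, [/\ holo0 P, P 0 = one &
  order0 n.+1 (fun y => (-1) *: P y + transfer P y)].
Proof.
have defect0 P : P 0 = one -> (-1) *: P 0 + transfer P 0 = 0.
  by move=> P0; rewrite /transfer Phi0 G0 P0 (ba_mul1r ba) EmEp scaleN1r addNr.
elim: n => [|n ih] nN.
  have hone : holo0 (fun=> one) by exists 1 => // y _; exact: differentiable_cst.
  (* The defect of the constant [one] vanishes at [0] because [mul Em Ep = one], hence has order
     one. *)
  exists (fun=> one); split => //; apply: holo0_order1; last exact: defect0.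
  exact: holo0_linear (transfer_holo0 hone).
have [P [hP P0 oP]] := ih (ltnW nN).
pose Q y := (-1) *: P y + transfer P y.
have hQ : holo0 Q := holo0_linear (-1) hP (transfer_holo0 hP).
have [[S [c [Slin Sb HS]]] _] := hom_inv (k := n.+1) ltac:(by rewrite nN).
have hSQ : holo0 (fun y => S (Q y)).
  by case: hQ => r rr dQ; exists r => // y /dQ; apply: differentiable_bounded_linear Slin Sb.
have oSQ : order0 n.+1 (fun y => S (Q y)).
  case: (oP) => r [C [rr C0' hC]]; exists r, (`|c| * C); split => //; first exact: mulr_ge0.
  move=> y /hC h; apply: le_trans (Sb _) _; rewrite -mulrA.
  apply: (@le_trans _ _ (`|c| * nr (Q y))).
    by rewrite ler_wpM2r ?nr_ge0 ?ler_norm.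
  by apply: ler_wpM2l.
exists (fun y => (-1) *: S (Q y) + P y); split.
- exact: holo0_linear hSQ hP.
- have -> : Q 0 = 0 by exact: defect0.
  have := Slin (-1) 0 0; rewrite scaler0 addr0 scaleN1r addNr => ->.
  by rewrite oppr0 add0r.
have [r [C [rr C0' hC]]] := transfer_order hSQ oSQ.
exists r, C; split => // y /hC; rewrite -nrN; congr (nr _ <= _).
rewrite transfer_linear.
have -> : d ^+ n.+1 *: mul (mul Em (S (Q y))) Ep = Q y + S (Q y).
  by have := HS (Q y); rewrite /homological => h; rewrite -[X in _ = X + _]h subrK.
by rewrite [X in - (_ - (X + _))]/Q; lmod (R[i]) A.
Qed.

(** Iterates of [transfer] starting from an approximate solution of order [N] have geometrically
    small differences, uniformly on the ball, so their limit is holomorphic. *)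
Lemma local_existence : (0 < N)%N -> exists2 r : R, 0 < r <= r0 & exists M : X -> A,
  [/\ forall y, nr y < r -> differentiable M y, M 0 = one,
      forall y, nr y < r -> nr (Phi y) <= nr y &
      forall y, nr y < r -> M y = transfer M y].
Proof.
move=> N0; have [P [[rp rp0 dP] P0 [ro [C [ro0 Cge hC]]]]] :=
  @approximate_solution N.-1 ltac:(by rewrite prednK).
rewrite prednK // in hC.
have rmin : 0 < Num.min r0 (Num.min rp ro) by rewrite !lt_min r00 rp0.
have [r [t [rr hr ht hP hTr]]] := transfer_contraction rmin.
have [r_r0 [r_rp r_ro]] : r <= r0 /\ r <= rp /\ r <= ro.
  by move: hr; rewrite !le_min => /and3P[].
have [t0 t1] := andP ht.
pose u n := iter n transfer P.
have du n : forall y, nr y < r -> differentiable (u n) y.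
  elim: n => [|n ih] y hy; first by apply: dP; apply: lt_le_trans r_rp.
  apply: (transfer_holo rr ih); first exact: lt_le_trans r_r0.
  exact: le_lt_trans (hP y hy) hy.
have step n : forall y, nr y < r -> nr (u n.+1 y - u n y) <= C * t ^+ n * nr y ^+ N.
  elim: n => [|n ih] y hy.
    rewrite expr0 mulr1; have := hC y (lt_le_trans hy r_ro).
    by rewrite scaleN1r addrC.
  have -> : u n.+2 y - u n.+1 y = transfer (fun z => u n.+1 z - u n z) y.
    by rewrite /transfer (bmulBr ba) (bmulBl ba).
  rewrite exprSr mulrA; apply: hTr => //.
  by apply: mulr_ge0 => //; apply: exprn_ge0.
have lim y : exists l, nr y < r -> forall n, nr (u n y - l) <= C * nr y ^+ N * t ^+ n / (1 - t).
  have c0 : 0 <= C * nr y ^+ N by apply: mulr_ge0 => //; apply: exprn_ge0 (nr_ge0 _).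
  case: (ltP (nr y) r) => hy; last by exists 0.
  have [l hl] := @geometric_limit _ _ (fun n => u n y) _ t c0 ht
    (fun n => ltac:(by rewrite mulrAC; apply: step)).
  by exists l.
pose M y := projT1 (cid (lim y)).
have MP y : nr y < r -> forall n, nr (u n y - M y) <= C * nr y ^+ N * t ^+ n / (1 - t).
  by rewrite /M; case: cid.
have unif (e : R) : 0 < e -> exists K, forall n y, (K <= n)%N -> nr y < r -> nr (u n y - M y) <= e.
  move=> e0; have t1' : 0 < 1 - t by lra.
  have T0 : 0 < C * r ^+ N + 1.
    by apply: ltr_wpDl => //; apply: mulr_ge0 => //; apply: exprn_ge0; exact: ltW.
  have [K hK] := expr_small ht (divr_gt0 (mulr_gt0 e0 t1') T0).
  exists K => n y /hK h hy; apply: le_trans (MP y hy n) _.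
  rewrite ler_pdivrMr //; move: h; rewrite ltr_pdivlMr // => h; apply: le_trans (ltW h).
  rewrite mulrC; apply: ler_wpM2l; first exact: exprn_ge0.
  apply: (@le_trans _ _ (C * r ^+ N)); last by rewrite lerDl.
  by apply: ler_wpM2l => //; rewrite lerXn2r ?nnegrE ?nr_ge0 // ltW.
have phir y : nr y < r -> nr (Phi y) < r by move=> hy; apply: le_lt_trans (hP y hy) hy.
exists r; first by rewrite rr.
exists M; split => //.
- move=> y hy; have ry : 0 < r - nr y by lra.
  have hin z : nr (z - y) < r - nr y -> nr z < r.
    by move=> h; rewrite -[z](subrK y); apply: le_lt_trans (nrD _ _) _; lra.
  apply: (uniform_limit_differentiable (u := u) ry).
    by exists 0%N => n z _ /hin; apply: du.
  by move=> e /unif[K hK]; exists K => n z hn /hin; apply: hK.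
- have u0 n : u n 0 = one.
    by elim: n => [|n ih] //=; rewrite /transfer Phi0 G0 ih (ba_mul1r ba) EmEp.
  apply/eqP; rewrite -subr_eq0; apply/eqP/nr_eq0 => e /unif[K hK].
  by have := hK K 0 (leqnn K); rewrite u0 nr0 nrC; apply.
- move=> y hy; apply/eqP; rewrite -subr_eq0; apply/eqP/nr_eq0 => e e0.
  pose T := nr Em * nr (G y) + 1.
  have T0 : 0 < T by apply: ltr_wpDl => //; apply: mulr_ge0; exact: nr_ge0.
  have T1 : 1 <= T by rewrite /T lerDr; apply: mulr_ge0; exact: nr_ge0.
  have [K hK] := unif (e / (2 * T)) ltac:(by rewrite divr_gt0 // mulr_gt0).
  have -> : M y - transfer M y = transfer (fun z => u K z - M z) y - (u K.+1 y - M y).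
    rewrite /transfer (bmulBr ba) (bmulBl ba) /u /= -/(u K) /transfer.
    by lmod (R[i]) A.
  have k1 := hK K.+1 y (leqnSn K) hy; have k2 := hK K (Phi y) (leqnn K) (phir y hy).
  have e2 : e / (2 * T) * T = e / 2 by field; rewrite gt_eqF.
  apply: le_trans (nrB _ _) _.
  have k3 : nr (transfer (fun z => u K z - M z) y) <= e / (2 * T) * T.
    rewrite /transfer; apply: le_trans (bnrM ba _ _) _.
    apply: (@le_trans _ _ (nr Em * (e / (2 * T)) * nr (G y))).
      apply: ler_wpM2r (nr_ge0 _) _ _ _; apply: le_trans (bnrM ba _ _) _.
      by apply: ler_wpM2l (nr_ge0 _) _ _ k2.
    rewrite mulrAC mulrC; apply: ler_wpM2l; last by rewrite /T lerDl.
    by rewrite divr_ge0 ?mulr_ge0 // ltW.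
  have k4 : e / (2 * T) <= e / (2 * T) * T.
    by rewrite ler_peMr // divr_ge0 ?mulr_ge0 // ltW.
  lra.
Qed.

End Local.

(** * Generators *)

Section Generator.
Variables (R : realType) (V : normedModType R[i]).

(** First-order expansion at time [0] in operator norm. It makes no mention of a semigroup law, so
    that it can be composed factor by factor, as for [d ^+ k *: e^{-tB0} y e^{tB0}]. *)
Definition is_generator (G : R -> V -> V) (L : V -> V) : Prop :=
  [/\ forall u v, L (u - v) = L u - L v,
      exists2 c : R, 0 <= c & forall v, nr (L v) <= c * nr v &
      forall e : R, 0 < e -> exists2 d : R, 0 < d & forall t, 0 < t < d -> forall v,
        nr (G t v - v - t%:C *: L v) <= e * t * nr v].

Lemma generator_growth G L : is_generator G L -> exists2 K : R, 0 <= K &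
  exists2 d : R, 0 < d & forall t, 0 < t < d -> forall v,
    nr (G t v - v) <= K * t * nr v.
Proof.
case=> _ [c c0 hc] /(_ 1 ltr01) [d d0 hd]; exists (c + 1); first by lra.
exists d => // t ht v; have [t0 _] := andP ht.
rewrite -[G t v - v](subrK (t%:C *: L v)); apply: le_trans (nrD _ _) _.
rewrite nrZ nrR gtr0_norm //; have := hd t ht v; have := ler_wpM2l (ltW t0) (hc v).
by rewrite mul1r; lra.
Qed.

Lemma generator_comp G L G' L' : is_generator G L -> is_generator G' L' ->
  is_generator (fun t v => G t (G' t v)) (fun v => L v + L' v).
Proof.
move=> hG hG'; have [K' K'0 [d3 d30 h3]] := generator_growth hG'.
case: hG hG' => LB [c c0 hc] h1 [LB' [c' c'0 hc'] h2]; split.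
- by move=> u v; rewrite LB LB'; lmod (R[i]) V.
- exists (c + c'); first exact: addr_ge0.
  by move=> v; apply: le_trans (nrD _ _) _; rewrite mulrDl lerD.
move=> e e0; pose T := K' + c * K' + 4.
have T0 : 0 < T by have := mulr_ge0 c0 K'0; rewrite /T; lra.
have [d1 d10 {}h1] := h1 (e / 4) ltac:(by rewrite divr_gt0).
have [d2 d20 {}h2] := h2 (e / 4) ltac:(by rewrite divr_gt0).
exists (Num.min (Num.min d1 d2) (Num.min d3 (Num.min 1 (Num.min (T^-1) (e / (4 * T)))))).
  by rewrite !lt_min d10 d20 d30 ltr01 invr_gt0 T0 divr_gt0 // mulr_gt0.
move=> t /andP[t0]; rewrite !lt_min => /andP[/andP[t1 t2] /and4P[t3 t4 t5 t6]] v.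
have v0 := nr_ge0 v.
have {}h1 := h1 t ltac:(by rewrite t0) (G' t v); have {}h2 := h2 t ltac:(by rewrite t0) v.
have {}h3 := h3 t ltac:(by rewrite t0) v.
have K't : K' * t <= 1.
  apply: (@le_trans _ _ (T * t)); first by rewrite ler_wpM2r ?(ltW t0) // /T; have := mulr_ge0 c0 K'0; lra.
  by rewrite -ler_pdivlMl // mulr1 ltW.
have g2 : nr (G' t v) <= 2 * nr v.
  rewrite -[G' t v](subrK v); apply: le_trans (nrD _ _) _.
  by have := ler_wpM2r v0 K't; lra.
have -> : G t (G' t v) - v - t%:C *: (L v + L' v) =
  (G t (G' t v) - G' t v - t%:C *: L (G' t v)) + (G' t v - v - t%:C *: L' v) +
  t%:C *: L (G' t v - v) by rewrite LB; lmod (R[i]) V.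
have k1 : e / 4 * t * nr (G' t v) <= e / 4 * t * (2 * nr v).
  by apply: ler_wpM2l g2; rewrite mulr_ge0 ?divr_ge0 // ltW.
have k2 : nr (t%:C *: L (G' t v - v)) <= e / 4 * t * nr v.
  rewrite nrZ nrR gtr0_norm //.
  have := le_trans (hc (G' t v - v)) (ler_wpM2l c0 h3).
  move=> /(ler_wpM2l (ltW t0)) h; apply: le_trans h _.
  have -> : t * (c * (K' * t * nr v)) = (c * K' * t) * (t * nr v) by ring.
  rewrite -[leRHS]mulrA; apply: ler_wpM2r; first by rewrite mulr_ge0 // ltW.
  apply: (@le_trans _ _ (T * t)); first by rewrite ler_wpM2r ?(ltW t0) // /T; lra.
  rewrite mulrC -ler_pdivlMr //.
  by have -> : e / 4 / T = e / (4 * T) by [rewrite invfM mulrA]; exact: ltW.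
apply: le_trans (nrD _ _) _; have := nrD (G t (G' t v) - G' t v - t%:C *: L (G' t v)) (G' t v - v - t%:C *: L' v).
by lra.
Qed.

(** Over a short time [h] the two families differ by [o(h)]. Reaching [t] from [t / 2 ^+ n] by
    doublings keeps the error linear in the elapsed time, up to exponential growth. This identifies
    both the differential of the flow and the cocycle at [x0]. *)
Lemma semigroup_unique (G G' : R -> V -> V) (L : V -> V) :
  is_generator G L -> is_generator G' L ->
  (forall t, 0 < t -> forall u v, G t (u - v) = G t u - G t v) ->
  (forall t s, 0 < t -> 0 < s -> forall v, G (t + s) v = G t (G s v)) ->
  (forall t s, 0 < t -> 0 < s -> forall v, G' (t + s) v = G' t (G' s v)) ->
  forall t, 0 < t -> forall v, G t v = G' t v.
Proof.
move=> hG hG' GB GD GD' t t0 v.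
have [K K0 [d1 d10 h1]] := generator_growth hG; have [K' K'0 [d2 d20 h2]] := generator_growth hG'.
have [_ _ h3] := hG; have [_ _ h4] := hG'.
pose k := K + K'.
have k0 : 0 <= k by exact: addr_ge0.
apply/eqP; rewrite -subr_eq0; apply/eqP/nr_eq0 => e e0.
have S0 : 0 < t * expR (k * t) * nr v + 1.
  by rewrite ltr_wpDl // !mulr_ge0 ?nr_ge0 ?expR_ge0 // ltW.
pose e' := e / (t * expR (k * t) * nr v + 1).
have e'0 : 0 < e' by rewrite divr_gt0.
have [d3 d30 {}h3] := h3 (e' / 2) ltac:(by rewrite divr_gt0).
have [d4 d40 {}h4] := h4 (e' / 2) ltac:(by rewrite divr_gt0).
(* A form stable under doubling: the exponentials multiply and the factors linear in [h] add. *)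
pose Q h := forall w, [/\ nr (G h w) <= expR (k * h) * nr w, nr (G' h w) <= expR (k * h) * nr w
  & nr (G h w - G' h w) <= e' * h * expR (k * h) * nr w].
have small : exists2 d : R, 0 < d & forall h, 0 < h < d -> Q h.
  exists (Num.min (Num.min d1 d2) (Num.min d3 d4)).
    by rewrite !lt_min d10 d20 d30 d40.
  move=> h /andP[h0]; rewrite !lt_min => /andP[/andP[a1 a2] /andP[a3 a4]] w.
  have w0 := nr_ge0 w.
  have ek : 1 + k * h <= expR (k * h) := expR_ge1Dx _.
  have Kh : 0 <= K * h by rewrite mulr_ge0 // ltW.
  have Kh' : 0 <= K' * h by rewrite mulr_ge0 // ltW.
  have b1 := h1 h ltac:(by rewrite h0) w; have b2 := h2 h ltac:(by rewrite h0) w.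
  have b3 := h3 h ltac:(by rewrite h0) w; have b4 := h4 h ltac:(by rewrite h0) w.
  have ew := ler_wpM2r w0 ek.
  have Kw := mulr_ge0 Kh w0; have Kw' := mulr_ge0 Kh' w0.
  rewrite /k in ew *; split.
  - by rewrite -[G h w](subrK w); apply: le_trans (nrD _ _) _; lra.
  - by rewrite -[G' h w](subrK w); apply: le_trans (nrD _ _) _; lra.
  have -> : G h w - G' h w = (G h w - w - h%:C *: L w) - (G' h w - w - h%:C *: L w).
    by lmod (R[i]) V.
  apply: le_trans (nrB _ _) _; apply: (@le_trans _ _ (e' * h * nr w)); first by lra.
  apply: ler_wpM2r => //; rewrite ler_peMr //; first by rewrite mulr_ge0 // ltW.
  by apply: le_trans ek; rewrite lerDl mulr_ge0 ?addr_ge0 // ltW.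
have double h : 0 < h -> Q h -> Q (h + h).
  move=> h0 hQ w; have [a1 a2 a3] := hQ w; have E0 := expR_ge0 (k * h).
  have [_ b2 b3] := hQ (G' h w); have [c1 _ _] := hQ (G h w).
  have [c2 _ _] := hQ (G h w - G' h w).
  rewrite mulrDr expRD GD // GD' //.
  split.
  - by apply: le_trans c1 _; rewrite -mulrA ler_wpM2l.
  - by apply: le_trans b2 _; rewrite -mulrA ler_wpM2l.
  have -> : G h (G h w) - G' h (G' h w) =
     G h (G h w - G' h w) + (G h (G' h w) - G' h (G' h w)) by rewrite GB //; lmod (R[i]) V.
  apply: le_trans (nrD _ _) _.
  have x1 := le_trans c2 (ler_wpM2l E0 a3).
  have eh := mulr_ge0 (mulr_ge0 (ltW e'0) (ltW h0)) E0.
  have x2 := le_trans b3 (ler_wpM2l eh a2).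
  have -> : e' * (h + h) * (expR (k * h) * expR (k * h)) * nr w =
    expR (k * h) * (e' * h * expR (k * h) * nr w) +
    e' * h * expR (k * h) * (expR (k * h) * nr w) by ring.
  exact: lerD.
have [d d0 hd] := small.
have [n hn] := half_pow_small t0 d0.
have hQ j : (j <= n)%N -> Q (t / 2 ^+ (n - j)).
  elim: j => [|j ih] jn.
    by rewrite subn0; apply: hd; rewrite hn andbT divr_gt0 // exprn_gt0.
  have -> : t / 2 ^+ (n - j.+1) = t / 2 ^+ (n - j) + t / 2 ^+ (n - j).
    by rewrite -[(n - j)%N]subnSK // exprS; field; rewrite expf_neq0.
  by apply: double; [rewrite divr_gt0 // exprn_gt0|apply: ih; apply: ltnW].
have [_ _ ] := hQ n (leqnn n) v; rewrite subnn expr0 divr1 => h; apply: le_trans h _.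
have -> : e' * t * expR (k * t) * nr v = e' * (t * expR (k * t) * nr v) by ring.
apply: (@le_trans _ _ (e' * (t * expR (k * t) * nr v + 1))).
  by rewrite ler_wpM2l ?(ltW e'0) // lerDl.
by rewrite /e' divfK ?gt_eqF.
Qed.

End Generator.

(** * The decay factor and its powers as generated families *)

Section Decay.
Variable R : realType.

Lemma derivative_bound (u : R -> R) (x l : R) : is_derive x 1 u l ->
  forall e : R, 0 < e -> exists2 d : R, 0 < d & forall s, `|s| < d ->
    `|u (x + s) - u x - s * l| <= e * `|s|.
Proof.
move=> du e e0; have hd : derivable u x 1 := @ex_derive _ _ _ _ _ _ _ du.
have := derivable_nbhs hd; move/eqaddoP => /(_ e e0).
rewrite (@derive_val _ _ _ _ _ _ _ du).
case/nbhs_ballP => d /= d0 hb; exists d => // s hs.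
have := hb s; rewrite /ball /= sub0r normrN => /(_ hs).
have s1 : s *: (1 : R^o) = s by exact: mulr1.
move=> h; apply: le_trans h; rewrite le_eqVlt; apply/orP; left; apply/eqP; congr (`|_|).
change (u (x + s) - u x - s * l = u (s *: (1 : R^o) + x) - (u x + s * l)).
by rewrite s1 [s + x]addrC opprD addrA.
Qed.

(** [e^{-wt}] by Euler's formula. *)
Definition cdec (w : R[i]) (t : R) : R[i] :=
  (expR (- (complex.Re w * t)))%:C *
  (cos (complex.Im w * t) +i* (- sin (complex.Im w * t))).

Lemma cdecD w t s : cdec w (t + s) = cdec w t * cdec w s.
Proof.
rewrite /cdec !mulrDr opprD expRD cosD sinD rmorphM /=.
apply/eqP; rewrite eq_complex /=; apply/andP; split; apply/eqP; ring.
Qed.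

Lemma nr_cdec w t : nr (cdec w t) = expR (- (complex.Re w * t)).
Proof.
rewrite /cdec nrM nrR ger0_norm ?expR_ge0 // /nr normc_def /= sqrrN cos2Dsin2 sqrtr1.
by rewrite mulr1.
Qed.

Lemma derivative_bound_at0 (u : R -> R) (u0 l k : R) : is_derive (0 : R) 1 u l -> u 0 = u0 ->
  forall e : R, 0 < e -> exists2 d : R, 0 < d & forall t, 0 < t < d ->
    `|u (k * t) - u0 - k * t * l| <= e * t.
Proof.
move=> du hu0 e e0; have k0 : 0 < `|k| + 1 by rewrite ltr_wpDl.
have [d d0 hd] := derivative_bound du (divr_gt0 e0 k0).
exists (d / (`|k| + 1)) => [|t /andP[t0 td]]; first by rewrite divr_gt0.
have hkt : `|k * t| <= (`|k| + 1) * t.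
  by rewrite normrM (gtr0_norm t0) ler_wpM2r ?(ltW t0) // lerDl.
have := hd (k * t); rewrite add0r hu0 => h; apply: le_trans (h _) _.
  by apply: le_lt_trans hkt _; rewrite mulrC -ltr_pdivlMr.
have := ler_wpM2l (ltW (divr_gt0 e0 k0)) hkt.
by have -> : e / (`|k| + 1) * ((`|k| + 1) * t) = e * t by field; rewrite gt_eqF.
Qed.

Lemma scalar_generator (V : normedModType R[i]) (s : R -> R[i]) (w : R[i]) :
  (forall e : R, 0 < e -> exists2 d : R, 0 < d & forall t, 0 < t < d ->
     nr (s t - 1 - t%:C * w) <= e * t) ->
  is_generator (fun t (v : V) => s t *: v) (fun v => w *: v).
Proof.
move=> hs; split; first by move=> u v; rewrite scalerBr.
  by exists (nr w) => [|v]; [exact: nr_ge0|rewrite nrZ].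
move=> e /hs[d d0 hd]; exists d => // t /hd h v.
have -> : s t *: v - v - t%:C *: (w *: v) = (s t - 1 - t%:C * w) *: v by lmod (R[i]) V.
by rewrite nrZ ler_wpM2r ?nr_ge0.
Qed.

Lemma cdec_generator (V : normedModType R[i]) (w : R[i]) :
  is_generator (fun t (v : V) => cdec w t *: v) (fun v => - w *: v).
Proof.
set a := complex.Re w; set b := complex.Im w.
have g1 : is_generator (fun t (v : V) => (expR (- a * t))%:C *: v) (fun v => (- a)%:C *: v).
  apply: scalar_generator => e e0.
  have [d d0 hd] := derivative_bound_at0 (- a) (is_derive_expR (0 : R)) (expR0 R) e0.
  exists d => // t /hd; rewrite expR0 mulr1 => h.
  have -> : (expR (- a * t))%:C - 1 - t%:C * (- a)%:C = (expR (- a * t) - 1 - - a * t)%:C.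
    by rewrite [_ * t]mulrC !rmorphB rmorph1 rmorphM.
  by rewrite nrR.
have g2 : is_generator (fun t (v : V) => (cos (b * t) +i* (- sin (b * t))) *: v)
    (fun v => (0 +i* (- b)) *: v).
  apply: scalar_generator => e e0; have e2 : 0 < e / 2 by lra.
  have [d1 d10 h1] := derivative_bound_at0 b (is_derive_cos (0 : R)) (cos0 R) e2.
  have [d2 d20 h2] := derivative_bound_at0 b (is_derive_sin (0 : R)) (sin0 R) e2.
  exists (Num.min d1 d2); first by rewrite lt_min d10.
  move=> t /andP[t0]; rewrite lt_min => /andP[t1 t2].
  have {}h1 := h1 t ltac:(by rewrite t0); have {}h2 := h2 t ltac:(by rewrite t0).
  move: h1 h2; rewrite sin0 cos0 oppr0 mulr0 mulr1 !subr0 ?addr0 => h1 h2.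
  apply: le_trans (nr_ReIm _) _; rewrite !reimE /=.
  set x := cos (b * t) - _ - _; have -> : x = cos (b * t) - 1 by rewrite /x; ring.
  set y := - sin (b * t) - _ - _; have -> : y = - (sin (b * t) - b * t) by rewrite /y; ring.
  by rewrite normrN; lra.
have := generator_comp g1 g2; rewrite /cdec -/a -/b.
have -> : (fun v : V => (- a)%:C *: v + (0 +i* (- b)) *: v) = (fun v => - w *: v).
  apply: funext => v; rewrite -scalerDl; congr (_ *: _).
  by rewrite /a /b; case: (w) => x y; apply/eqP; rewrite eq_complex /= addr0 add0r !eqxx.
congr is_generator; apply: funext => t; apply: funext => v.
by rewrite scalerA mulNr.
Qed.

Lemma cdecX_generator (V : normedModType R[i]) (w : R[i]) k :
  is_generator (fun t (v : V) => cdec w t ^+ k *: v) (fun v => - (k%:R * w) *: v).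
Proof.
elim: k => [|k ih].
  split.
  - by move=> u v; rewrite scalerBr.
  - by exists 0 => // v; rewrite !mul0r oppr0 scale0r nr0.
  move=> e e0; exists 1 => // t /andP[t0 _] v.
  rewrite expr0 scale1r subrr sub0r mul0r oppr0 scale0r scaler0 oppr0 nr0.
  by apply: mulr_ge0 (nr_ge0 _); apply: mulr_ge0; exact: ltW.
have := generator_comp (cdec_generator V w) ih.
have -> : (fun v : V => - w *: v + - (k%:R * w) *: v) = (fun v => - (k.+1%:R * w) *: v).
  by apply: funext => v; rewrite -scalerDl -opprD -natr1 mulrDl mul1r [w + _]addrC.
congr is_generator; apply: funext => t; apply: funext => v.
by rewrite scalerA exprS.
Qed.

End Decay.

(** * Invertibility of the homological operators for small times *)

Section Conjugation.
Variables (R : realType) (A : completeNormedModType R[i]).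
Variables (mul : A -> A -> A) (one : A).
Hypothesis ba : banach_algebra mul one.

Lemma left_generator (g : R -> A) (c : A) :
  (forall e : R, 0 < e -> exists2 d : R, 0 < d & forall t, 0 < t < d ->
     nr (g t - one - t%:C *: c) <= e * t) ->
  is_generator (fun t => mul (g t)) (mul c).
Proof.
move=> hg; split; first by move=> u v; exact: (bmulBr ba).
  by exists (nr c); [exact: nr_ge0|exact: (bnrM ba)].
move=> e /hg[d d0 hd]; exists d => // t /hd h v.
have -> : mul (g t) v - v - t%:C *: mul c v = mul (g t - one - t%:C *: c) v.
  by rewrite !(bmulBl ba) (ba_mul1l ba) (ba_mulZl ba).
by apply: le_trans (bnrM ba _ _) _; rewrite ler_wpM2r ?nr_ge0.
Qed.

Lemma right_generator (g : R -> A) (c : A) :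
  (forall e : R, 0 < e -> exists2 d : R, 0 < d & forall t, 0 < t < d ->
     nr (g t - one - t%:C *: c) <= e * t) ->
  is_generator (fun t y => mul y (g t)) (fun y => mul y c).
Proof.
move=> hg; split; first by move=> u v; rewrite (bmulBl ba).
  by exists (nr c); [exact: nr_ge0|move=> v; rewrite mulrC; exact: (bnrM ba)].
move=> e /hg[d d0 hd]; exists d => // t /hd h v.
have -> : mul v (g t) - v - t%:C *: mul v c = mul v (g t - one - t%:C *: c).
  by rewrite !(bmulBr ba) (ba_mul1r ba) (ba_mulZr ba).
by apply: le_trans (bnrM ba _ _) _; rewrite mulrC ler_wpM2r ?nr_ge0.
Qed.

Variable b : A.
Local Notation E := (bexp mul one b).

Lemma bexp_generator (e : R) : 0 < e -> exists2 d : R, 0 < d & forall t, 0 < t < d ->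
  nr (E t - one - t%:C *: b) <= e * t.
Proof.
move=> e0; have [d d0 hd] := bexp_derivative ba b e0.
by exists d => // t /andP[t0 td]; have := hd t; rewrite (gtr0_norm t0); apply.
Qed.

Lemma bexpN_generator (e : R) : 0 < e -> exists2 d : R, 0 < d & forall t, 0 < t < d ->
  nr (E (- t) - one - t%:C *: (- b)) <= e * t.
Proof.
move=> e0; have [d d0 hd] := bexp_derivative ba b e0.
exists d => // t /andP[t0 td]; have := hd (- t); rewrite normrN (gtr0_norm t0) => /(_ td).
by rewrite rmorphN scalerN scaleNr.
Qed.

Variable w : R[i].
Hypothesis nonresonant : forall k : nat, (0 < k)%N -> forall l l' : R[i],
  spectrum mul one b l -> spectrum mul one b l' -> k%:R * w != l - l'.

(* [homological (E (-t)) (E t) (cdec w t) k] is [-t] times a Sylvester operator up to [o(t)] *)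
Lemma homological_inverse (k : nat) : (0 < k)%N -> exists2 dl : R, 0 < dl &
  forall t, 0 < t < dl -> boundedly_invertible (homological mul (E (- t)) (E t) (cdec w t) k).
Proof.
move=> k0; pose a := b + (k%:R * w) *: one.
have ab z : invertible mul one (a - z *: one) \/ invertible mul one (b - z *: one).
  case: (pselect (invertible mul one (b - z *: one))) => [|nb]; [by right|left].
  apply: contrapT => na.
  (* A [z] in both spectra would put [z] and [z - k%:R * w] in the spectrum of [b]: a resonance. *)
  have ea : a - z *: one = b - (z - k%:R * w) *: one by rewrite /a; lmod (R[i]) A.
  rewrite ea in na.
  by have := nonresonant k0 nb na; rewrite opprB addrC subrK eqxx.
have [W [Wlin [c0 hc0] Wa Wb] hW] := rosenblum ba ab.
pose c := `|c0|; have c0' : 0 <= c by exact: normr_ge0.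
have hc v : nr (W v) <= c * nr v.
  by apply: le_trans (hc0 v) _; rewrite ler_wpM2r ?nr_ge0 ?ler_norm.
have WB u v : W (u - v) = W u - W v.
  by have := Wlin (-1) v u; rewrite !scaleN1r addrC => ->; rewrite addrC.
have gen := generator_comp (cdecX_generator A w k)
  (generator_comp (right_generator bexp_generator) (left_generator bexpN_generator)).
have [_ _ gen3] := gen.
(* Against the bound [c] of [W] this error costs at most [1 / 4]; with the [1 / 2] from [rosenblum],
   the total stays at [3 / 4]. *)
have e0 : 0 < (4 * (c + 1))^-1 by rewrite invr_gt0 mulr_gt0 //; lra.
have [dl dl0 hdl] := gen3 _ e0.
exists dl => // t ht; set H := homological _ _ _ _ _; have [t0 _] := andP ht.
pose C := sylvester mul a b.
have tC : t%:C != 0 :> R[i] by rewrite eq_complex /= eqxx andbT gt_eqF.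
have hnear v : nr ((t%:C)^-1 *: H v + C v) <= (4 * (c + 1))^-1 * nr v.
  have := hdl t ht v.
  have -> : cdec w t ^+ k *: mul (mul (E (- t)) v) (E t) - v -
     t%:C *: (- (k%:R * w) *: v + (mul v b + mul (- b) v)) = t%:C *: ((t%:C)^-1 *: H v + C v).
    have -> : mul (- b) v = - mul b v by rewrite -sub0r (bmulBl ba) (bmul0l ba) sub0r.
    rewrite /H /homological /C /sylvester /a (ba_mulDl ba) (ba_mulZl ba) (ba_mul1l ba).
    move: (_%:C) tC => tc tC; lmod (R[i]) A; field => //.
  rewrite nrZ nrR (gtr0_norm t0) => h.
  rewrite -(ler_pM2l t0); apply: le_trans h _.
  by rewrite le_eqVlt; apply/orP; left; apply/eqP; ring.
have ec : (4 * (c + 1))^-1 * c <= 4^-1.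
  rewrite mulrC ler_pdivrMr; last by rewrite mulr_gt0 //; lra.
  lra.
pose W' v := - (t%:C)^-1 *: W v.
have HW v : nr (v - H (W' v)) <= 3 / 4 * nr v.
  have HZ x u : H (x *: u) = x *: H u.
    by rewrite /H /homological (ba_mulZr ba) (ba_mulZl ba); lmod (R[i]) A.
  have -> : v - H (W' v) = (v - C (W v)) + ((t%:C)^-1 *: H (W v) + C (W v)).
    by rewrite /W' HZ; lmod (R[i]) A.
  apply: le_trans (nrD _ _) _; have h1 := hW v; have h2 := hnear (W v).
  have h3 : (4 * (c + 1))^-1 * nr (W v) <= 4^-1 * nr v.
    apply: le_trans (ler_wpM2l (ltW e0) (hc v)) _.
    by rewrite mulrA ler_wpM2r ?nr_ge0.
  have : nr (v - C (W v)) <= 2^-1 * nr v by exact: h1.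
  by lra.
have Hlin x u v : H (x *: u + v) = x *: H u + H v.
  by rewrite /H /homological (ba_mulDr ba) (ba_mulZr ba) (ba_mulDl ba) (ba_mulZl ba); lmod (R[i]) A.
have W'lin x u v : W' (x *: u + v) = x *: W' u + W' v.
  by rewrite /W' Wlin; lmod (R[i]) A.
split.
  have q34 : 0 <= (3 / 4 : R) < 1 by apply/andP; split; lra.
  have [L [Llin Lb LP]] := @neumann R A (fun v => v - H (W' v)) _ q34
    ltac:(by move=> x u v /=; rewrite W'lin Hlin; lmod (R[i]) A) HW.
  exists (fun v => W' (L v)), (t^-1 * c * (1 - 3 / 4)^-1); split.
  - by move=> x u v; rewrite Llin W'lin.
  - move=> v; rewrite /W' nrZ nrN nrV nrR (gtr0_norm t0) -!mulrA.
    rewrite ler_wpM2l ?invr_ge0 ?(ltW t0) //; apply: le_trans (hc _) _.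
    by rewrite ler_wpM2l.
  - by move=> v; have := LP v; rewrite subKr.
exists (4 * (t^-1 * c)); first by rewrite !mulr_ge0 ?invr_ge0 // ltW.
move=> v.
(* The bimodule property enters here: the same [W] inverts from the left as well, which yields the
   lower bound. *)
have comm : W (C v) = C (W v).
  have Wa' u : W (mul a u) = mul a (W u) by exact: Wa.
  by rewrite /C /sylvester WB Wa' Wb.
have e1 : v = (v - C (W v)) + W ((t%:C)^-1 *: H v + C v) - (t%:C)^-1 *: W (H v).
  by rewrite Wlin comm; lmod (R[i]) A.
have h1 : nr (v - C (W v)) <= 2^-1 * nr v by exact: hW.
have h2 : nr (W ((t%:C)^-1 *: H v + C v)) <= 4^-1 * nr v.
  apply: le_trans (hc _) _; apply: le_trans (ler_wpM2l c0' (hnear v)) _.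
  by rewrite mulrA ler_wpM2r ?nr_ge0 // mulrC.
have h3 : nr ((t%:C)^-1 *: W (H v)) <= t^-1 * c * nr (H v).
  rewrite nrZ nrV nrR (gtr0_norm t0) -mulrA ler_wpM2l ?invr_ge0 ?(ltW t0) //.
have h4 := nrB ((v - C (W v)) + W ((t%:C)^-1 *: H v + C v)) ((t%:C)^-1 *: W (H v)).
rewrite -e1 in h4; have h5 := nrD (v - C (W v)) (W ((t%:C)^-1 *: H v + C v)).
by lra.
Qed.

End Conjugation.

(** * The semigroup near its fixed point *)

Lemma diff_identity (R : realType) (V : normedModType R[i]) (x : V) :
  differentiable (fun z : V => z) x /\ dif (fun z : V => z) x = (fun v => v).
Proof.
apply: (@differentiableI R V V (fun z => z) x (fun v => v) 1) => //.
  by move=> v; rewrite mul1r.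
move=> e e0; exists 1 => // h _.
by rewrite [x + h]addrC addrK subrr nr0 mulr_ge0 ?nr_ge0 // ltW.
Qed.

Lemma diff_chain (R : realType) (U V W : normedModType R[i]) (g : V -> W) (h : U -> V) x :
  differentiable h x -> differentiable g (h x) ->
  differentiable (g \o h) x /\ forall v, dif (g \o h) x v = dif g (h x) (dif h x v).
Proof.
move=> dh dg; split; first exact: differentiable_comp.
move=> v; have E := diff_comp dh dg.
have E1 := etrans (difE (g \o h) x) E.
refine (etrans (congr1 (fun k => k v) E1) _).
by rewrite (difE g) (difE h).
Qed.

Section Flow.
Variables (R : realType) (X : completeNormedModType R[i]).
Variables (D : set X) (F : R -> X -> X) (x0 : X) (f : X -> X) (w : R[i]).
Hypothesis Dopen : open D.
Hypothesis sg : hol_semigroup D F.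
Hypothesis star : condition_star D F x0 f.
Hypothesis dfx0 : forall v : X, 'd f x0 v = - w *: v.

Lemma flow_in t x : 0 <= t -> D x -> D (F t x).
Proof. by case: sg => h _ _ _ _ t0; apply: h. Qed.
Lemma flow_diff t x : 0 <= t -> D x -> differentiable (F t) x.
Proof. by case: sg => _ h _ _ _ t0; apply: h. Qed.
Lemma flow0 x : D x -> F 0 x = x.
Proof. by case: sg => _ _ h _ _; apply: h. Qed.
Lemma flowD t s x : 0 <= t -> 0 <= s -> D x -> F (t + s) x = F t (F s x).
Proof. by case: sg => _ _ _ h _ t0 s0; apply: h. Qed.
Lemma Dx0 : D x0.
Proof. by case: star. Qed.

Lemma ball_in x : D x -> exists2 r : R, 0 < r & forall y, nr (y - x) < r -> D y.
Proof. by move=> Dx; apply/nbhs_nrP; exact: open_nbhs_nbhs. Qed.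

Lemma ball_strictly_inside x (r : R) : 0 < r -> (forall y, nr (y - x) < r + r -> D y) ->
  strictly_inside D [set y | nr (y - x) < r].
Proof.
move=> r0 hD; split.
- by move=> y /= h; apply: hD; lra.
- exists (nr x + r) => y /= h; rewrite normE lecR.
  by rewrite -[y](subrK x); apply: le_trans (nrD _ _) _; lra.
exists r; split => // y z /= hy; rewrite normE ltcR => hz; apply: hD.
by apply: le_lt_trans (nr_tri _ y _) _; lra.
Qed.

(** A small ball around any point of [D] lies strictly inside [D], so both uniform limits of the
    hypotheses hold on it. *)
Lemma uniform_generator x : D x -> exists2 r : R, 0 < r &
  [/\ forall y, nr (y - x) < r -> D y,
      forall e : R, 0 < e -> exists2 d : R, 0 < d & forall t, 0 < t < d -> forall y,
        nr (y - x) < r -> nr ((t%:C)^-1 *: (F t y - y) - f y) <= e &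
      forall e : R, 0 < e -> exists T : R, forall t, T <= t -> forall y,
        nr (y - x) < r -> nr (F t y - x0) < e].
Proof.
move=> Dx; have [r r0 hD] := ball_in Dx.
have r2 : 0 < r / 2 by lra.
have hS := @ball_strictly_inside x (r / 2) r2 ltac:(by rewrite -splitr).
case: star => _ h1 _ h2 _.
exists (r / 2) => //; split.
- by move=> y h; apply: hD; lra.
- move=> e e0; have [d [d0 hd]] := h2 _ hS e e0; exists d => // t /andP[t0 td] y hy.
  by have := hd t t0 td y hy; rewrite normE ltcR => /ltW.
- move=> e e0; have [T hT] := h1 _ hS e e0; exists T => t ht y hy.
  by have := hT t ht y hy; rewrite normE ltcR.
Qed.

Lemma flow_speed x : D x -> exists r C d : R, [/\ 0 < r, 0 < C, 0 < d,
   forall y, nr (y - x) < r -> D y &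
   forall t y, 0 <= t < d -> nr (y - x) < r -> nr (F t y - y) <= C * t].
Proof.
move=> Dx; have [r r0 [hD hg _]] := uniform_generator Dx.
have [_ _ hf _ _] := star.
have [r' r'0 hr'] := differentiable_nr_bound (hf x Dx).
have [d d0 hd] := hg 1 ltr01.
have fx := nr_ge0 (f x).
exists (Num.min r r'), (nr (f x) + 2), d; split => //.
- by rewrite lt_min r0.
- by lra.
- by move=> y; rewrite lt_min => /andP[/hD].
move=> t y /andP[t0 td]; rewrite lt_min => /andP[y1 y2].
have [->|tn] := eqVneq t 0; first by rewrite flow0 ?subrr ?nr0 ?mulr0 //; exact: hD.
have tp : 0 < t by rewrite lt_neqAle eq_sym tn.
have tC : t%:C != 0 :> R[i] by rewrite eq_complex /= eqxx andbT.
have h := hd t ltac:(by rewrite tp) y y1.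
have -> : F t y - y = t%:C *: (((t%:C)^-1 *: (F t y - y) - f y) + f y).
  by move: (_%:C) tC => c tC; lmod (R[i]) X; field.
rewrite nrZ nrR (gtr0_norm tp) mulrC ler_wpM2r //.
by apply: le_trans (nrD _ _) _; have := hr' y y2; lra.
Qed.

(* [F h] is a small perturbation of the identity, hence locally onto *)
Lemma flow_preimage x (eta : R) : D x -> 0 < eta -> exists2 d : R, 0 < d &
  forall h, 0 < h < d -> exists y, [/\ D y, nr (y - x) < eta & F h y = x].
Proof.
move=> Dx eta0; have [r [C [d1 [r0 C0 d10 hD hF]]]] := flow_speed Dx.
pose rho := Num.min (r / 2) eta.
have rho0 : 0 < rho by rewrite lt_min eta0 andbT; lra.
have [rho1 rho2] : rho <= r / 2 /\ rho <= eta by rewrite /rho !ge_min !lexx orbT.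
exists (Num.min d1 (Num.min (rho / (4 * C)) (r / (2 * 864 * C)))).
  rewrite !lt_min d10 /=; apply/andP; split; first by rewrite divr_gt0 // mulr_gt0.
  by apply: divr_gt0 r0 _; apply: mulr_gt0 C0; apply: mulr_gt0; exact: ltr0n.
move=> h /andP[h0]; rewrite !lt_min => /and3P[h1 h2 h3].
have hCr : h * (4 * C) < rho by rewrite -ltr_pdivlMr // mulr_gt0.
have hL : 864 * (C * h) / r <= 2^-1.
  have c2 : 0 < 2 * 864 * C by apply: mulr_gt0 C0; apply: mulr_gt0; exact: ltr0n.
  have k : h * (2 * 864 * C) <= r by rewrite -(ler_pdivlMr _ _ c2); exact: ltW.
  by rewrite (ler_pdivrMr _ _ r0); lra.
(* [g] is small near [x], hence [1 / 2]-Lipschitz by Cauchy's estimate, and the fixed point of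
   [y |-> x - g y] is the preimage. *)
pose g (y : X) := F h y - y.
have hg y : nr (y - x) < r -> nr (g y) <= C * h by move=> hy; apply: hF; rewrite ?(ltW h0).
have dg y : nr (y - x) < r -> differentiable g y.
  move=> hy; apply: differentiableB; last exact: (diff_identity y).1.
  by apply: flow_diff (hD y hy); exact: ltW.
have lip y z : nr (y - x) < rho -> nr (z - x) < rho -> nr (g y - g z) <= 2^-1 * nr (y - z).
  move=> hy hz; have := @cauchy_lipschitz _ _ _ g x y z r (C * h) r0 dg hg
    (lt_le_trans hy rho1) (lt_le_trans hz rho1).
  by move=> k; apply: le_trans k _; rewrite ler_wpM2r ?nr_ge0.
pose u n := iter n (fun y => x - g y) x.
have hu n : nr (u n - x) < rho.
  case: n => [|n]; first by rewrite subrr nr0.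
  elim: n => [|n ih]; rewrite /u iterS addrAC subrr add0r nrN.
    apply: le_lt_trans (hg x _) _; first by rewrite subrr nr0.
    by have := mulr_gt0 C0 h0; lra.
  by apply: le_lt_trans (hg _ (lt_trans ih _)) _; have := mulr_gt0 C0 h0; lra.
have step n : nr (u n.+1 - u n) <= C * h * 2^-1 ^+ n.
  elim: n => [|n ih].
    rewrite expr0 mulr1 /u /= addrAC subrr add0r nrN.
    by apply: hg; rewrite subrr nr0.
  have -> : u n.+2 - u n.+1 = - (g (u n.+1) - g (u n)).
    change ((x - g (u n.+1)) - (x - g (u n)) = - (g (u n.+1) - g (u n))).
    by lmod (R[i]) X.
  rewrite nrN; apply: le_trans (lip _ _ (hu _) (hu _)) _.
  by rewrite exprS mulrCA ler_wpM2l.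
have Ch0 : 0 <= C * h by rewrite mulr_ge0 // ltW.
have [|l hl] := geometric_limit Ch0 _ step; first by apply/andP; split; lra.
have hlx : nr (l - x) < rho.
  have := hl 0; rewrite /u /= expr0 mulr1 nrC => k; apply: le_lt_trans k _.
  have -> : (1 - 2^-1 : R) = 2^-1 by lra.
  by rewrite invrK; lra.
exists l; split.
- by apply: hD; lra.
- exact: lt_le_trans rho2.
apply/eqP; rewrite -subr_eq0; apply/eqP/nr_eq0 => e e0.
have [M hM] := @expr_small R 2^-1 (e / (4 * (C * h) + 1)) ltac:(by apply/andP; split; lra)
  ltac:(by rewrite divr_gt0 //; lra).
have k1 : C * h * 2^-1 ^+ M / (1 - 2^-1) <= e / 2.
  have -> : (1 - 2^-1 : R) = 2^-1 by lra.
  have := hM M (leqnn M); rewrite ltr_pdivlMr; last by lra.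
  have p0 : 0 <= (2^-1 : R) ^+ M by apply: exprn_ge0; lra.
  by rewrite invrK; lra.
have k2 : C * h * 2^-1 ^+ M.+1 / (1 - 2^-1) <= e / 2.
  have p0 : 0 <= (2^-1 : R) ^+ M by apply: exprn_ge0; lra.
  have p1 : (2^-1 : R) ^+ M.+1 <= 2^-1 ^+ M by rewrite exprS; lra.
  have p2 : 0 <= (1 - 2^-1 : R)^-1 by rewrite invr_ge0; lra.
  by apply: le_trans k1; apply: (ler_wpM2r p2); exact: (ler_wpM2l Ch0).
have -> : F h l - x = (g l - g (u M)) - (u M.+1 - l).
  change (F h l - x = (F h l - l - g (u M)) - ((x - g (u M)) - l)).
  by lmod (R[i]) X.
apply: le_trans (nrB _ _) _.
have := lip l (u M) hlx (hu M); have := hl M; have := hl M.+1; rewrite [nr (u M - l)]nrC.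
have := nr_ge0 (l - u M); lra.
Qed.

(** The limit at [0] gives continuity from the right only. If [F h y = x] with [y] near [x], then
    [F (t - h) x = F t y], and continuity of [F t] in space yields continuity from the left in
    time. *)
Lemma flow_left_continuous t x (e : R) : 0 < t -> D x -> 0 < e -> exists2 d : R, 0 < d &
  forall h, 0 <= h < d -> h <= t -> nr (F (t - h) x - F t x) < e.
Proof.
move=> t0 Dx e0.
have /differentiable_continuous := flow_diff (ltW t0) Dx.
move=> /(_ (fun y => nr (y - F t x) < e)).
have hn : nbhs (F t x) (fun y => nr (y - F t x) < e) by apply/nbhs_nrP; exists e.
move=> /(_ hn) /nbhs_nrP[eta eta0 heta].
have [d d0 hd] := flow_preimage Dx eta0.
exists d => // h /andP[h0 hd1] ht.
have [->|hn0] := eqVneq h 0; first by rewrite subr0 subrr nr0.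
have hp : 0 < h by rewrite lt_neqAle eq_sym hn0.
have [y [Dy yx Fy]] := hd h ltac:(by rewrite hp).
have : nr (F t y - F t x) < e by apply: heta.
have := @flowD (t - h) h y ltac:(by rewrite subr_ge0) h0 Dy.
by rewrite subrK Fy => ->.
Qed.

Lemma flow_continuous t x (e : R) : 0 <= t -> D x -> 0 < e -> exists2 d : R, 0 < d &
  forall s, 0 <= s -> `|s - t| < d -> nr (F s x - F t x) < e.
Proof.
move=> t0 Dx e0.
have [r [C [d1 [r0 C0 d10 hD hF]]]] := flow_speed (flow_in t0 Dx).
have [d2 d20 hd2] : exists2 d : R, 0 < d & forall h, 0 <= h < d -> h <= t ->
    nr (F (t - h) x - F t x) < e.
  have [->|tn] := eqVneq t 0.
    exists 1 => // h /andP[h0 _] h1; have -> : h = 0 by lra.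
    by rewrite subr0 subrr nr0.
  by apply: flow_left_continuous => //; rewrite lt_neqAle eq_sym tn.
exists (Num.min d2 (Num.min d1 (e / C))); first by rewrite !lt_min d20 d10 divr_gt0.
move=> s s0; rewrite !lt_min => /and3P[k1 k2 k3].
case: (leP t s) => st.
  have h0 : 0 <= s - t by rewrite subr_ge0.
  rewrite ger0_norm // in k1 k2 k3.
  have := @flowD (s - t) t x h0 t0 Dx; rewrite subrK => ->.
  apply: le_lt_trans (hF (s - t) (F t x) _ _) _; first by rewrite h0.
    by rewrite subrr nr0.
  by rewrite mulrC -ltr_pdivlMr.
have h0 : 0 < t - s by rewrite subr_gt0.
rewrite distrC gtr0_norm // in k1.
have := hd2 (t - s) ltac:(by rewrite (ltW h0)) ltac:(lra).
by rewrite subKr.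
Qed.

(** For large [s], [F t (F s x0)] is close to [F t x0] by continuity and, being [F (t + s) x0],
    close to [x0]. *)
Lemma flow_fix t : 0 <= t -> F t x0 = x0.
Proof.
move=> t0; apply/eqP; rewrite -subr_eq0; apply/eqP/nr_eq0 => e e0.
have Dx := Dx0; have [r r0 [_ _ hT]] := uniform_generator Dx.
have /differentiable_continuous := flow_diff t0 Dx.
move=> /(_ (fun y => nr (y - F t x0) < e / 2)).
have e2 : 0 < e / 2 by lra.
have hn : nbhs (F t x0) (fun y => nr (y - F t x0) < e / 2) by apply/nbhs_nrP; exists (e / 2).
move=> /(_ hn) /nbhs_nrP[eta eta0 heta].
have [T1 h1] := hT eta eta0; have [T2 h2] := hT (e / 2) e2.
pose s := Num.max 0 (Num.max T1 T2).
have [s0 [s1 s2]] : 0 <= s /\ T1 <= s /\ T2 <= s by rewrite /s !le_max !lexx !orbT.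
have xr : nr (x0 - x0) < r by rewrite subrr nr0.
have k1 : nr (F t (F s x0) - F t x0) < e / 2 by apply: heta; apply: h1.
have k2 := h2 (t + s) ltac:(lra) x0 xr.
rewrite flowD // in k2.
by rewrite nrC in k1; have := nr_tri (F t x0) (F t (F s x0)) x0; lra.
Qed.

Lemma dif_local (V W : normedModType R[i]) (g h : V -> W) x (r : R) : 0 < r ->
  (forall y, nr (y - x) < r -> g y = h y) -> differentiable g x ->
  differentiable h x /\ dif h x = dif g x :> (V -> W).
Proof.
move=> r0 gh dg; have [[c c0 hc] hd] := differentiableEP dg.
apply: (@differentiableI R V W h x (dif g x) c) => //.
  by move=> k u v; rewrite difD difZ.
move=> e /hd[d d0 hd']; exists (Num.min d r); first by rewrite lt_min d0.
move=> v; rewrite lt_min => /andP[v1 v2].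
have hx v' : nr v' < r -> g (x + v') = h (x + v').
  by move=> k; apply: gh; rewrite [x + v']addrC addrK.
rewrite -hx // -[h x](_ : g x = _); first exact: hd'.
by apply: gh; rewrite subrr nr0.
Qed.

Local Notation Dt := (fun t : R => dif (F t) x0).

Lemma flow_dif_comp t s : 0 < t -> 0 < s -> forall v, Dt (t + s) v = Dt t (Dt s v).
Proof.
move=> t0 s0 v; have Dx := Dx0; have [r r0 hD] := ball_in Dx.
have d1 := flow_diff (ltW s0) Dx.
have d2 : differentiable (F t) (F s x0) by apply: flow_diff (ltW t0) (flow_in (ltW s0) Dx).
have [_ ->] := dif_local (g := F t \o F s) (h := F (t + s)) r0
  ltac:(by move=> y /hD Dy; rewrite flowD // ltW) (diff_chain d1 d2).1.
by rewrite (diff_chain d1 d2).2 (flow_fix (ltW s0)).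
Qed.

(** The difference quotient of the flow minus [f] is uniformly small near [x0]; Cauchy's estimate
    passes this on to differentials at [x0], in operator norm. *)
Lemma flow_dif_generator : is_generator Dt (fun v => - w *: v).
Proof.
have Dx := Dx0; have [r r0 [hD hg _]] := uniform_generator Dx.
have [_ _ hf _ _] := star.
split; first by move=> u v; rewrite scalerBr.
  by exists (nr w) => [|v]; [exact: nr_ge0|rewrite nrZ nrN].
move=> e e0; have e1 : 0 < e * r / 432 by rewrite divr_gt0 ?mulr_gt0 ?ltr0n.
have [d d0 hd] := hg _ e1; exists d => // t ht v; have [t0 _] := andP ht.
have tC : t%:C != 0 :> R[i] by rewrite eq_complex /= eqxx andbT gt_eqF.
have {}hd := hd t ht.
have [k hk] : exists k : R[i], k = (t%:C)^-1 by exists ((t%:C)^-1).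
rewrite -hk in hd.
pose g y := k *: (F t y - y) - f y.
have dg y : nr (y - x0) < r -> differentiable g y /\
    forall v, dif g y v = k *: (dif (F t) y v - v) - dif f y v.
  move=> /hD Dy; have d1 := flow_diff (ltW t0) Dy.
  have [d2 d3] := diff_identity y.
  have [/= a1 a2] := diff_sub d1 d2.
  have [b1 b2] := @diff_scale R X X (fun z => F t z - z) k y a1.
  have [c1 c2] := diff_sub b1 (hf y Dy); split; first exact: c1.
  by move=> u; rewrite c2 b2 a2 d3.
have xr : nr (x0 - x0) < r by rewrite subrr nr0.
have := @cauchy_differential _ _ _ g x0 v r (e * r / 432) r0 (fun y hy => (dg y hy).1) hd.
have [_ ->] := dg x0 xr.
have -> : dif f x0 v = - w *: v by rewrite difE dfx0.
have -> : 432 * (e * r / 432) / r * nr v = e * nr v by field; rewrite gt_eqF.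
have -> : Dt t v - v - t%:C *: (- w *: v) =
    t%:C *: (k *: (Dt t v - v) - (- w *: v)).
  by rewrite hk; move: (_%:C) tC => c tC; lmod (R[i]) X; field.
move=> h; rewrite nrZ nrR (gtr0_norm t0) [e * t]mulrC -mulrA.
by rewrite ler_wpM2l // ltW.
Qed.

Lemma flow_dif t v : 0 < t -> Dt t v = cdec w t *: v.
Proof.
move=> t0; apply: (semigroup_unique flow_dif_generator (cdec_generator X w)) => //.
- by move=> s _ a b; rewrite -[- b]scaleN1r difD difZ scaleN1r.
- exact: flow_dif_comp.
- by move=> s s' _ _ u; rewrite cdecD scalerA.
Qed.

(** At some time [t >= 1] the flow maps a fixed ball into a ball of radius [r / 864], so by Cauchy's
    estimate its differential [e^{-tw}] has modulus at most [432 / 864]. The nonzero vector turns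
    the operator bound into one on this modulus. *)
Lemma decay_positive : (exists v : X, v != 0) -> 0 < complex.Re w.
Proof.
case=> v v0; have Dx := Dx0; have [r r0 [hD _ hT]] := uniform_generator Dx.
have nv : 0 < nr v. by exact: nr_gt0.
have e0 : 0 < r / 864 by rewrite divr_gt0 ?ltr0n.
have [T hT'] := hT _ e0.
pose t := Num.max 1 T.
have [t1 tT] : 1 <= t /\ T <= t by rewrite /t !le_max !lexx orbT.
have t0 : 0 < t by lra.
have dg y : nr (y - x0) < r -> differentiable (fun z => F t z - x0) y.
  move=> /hD Dy; apply: differentiableB; first by apply: flow_diff => //; exact: ltW.
  exact: differentiable_cst.
have := @cauchy_differential _ _ _ (fun z => F t z - x0) x0 v r (r / 864) r0 dg
  (fun y hy => ltW (hT' t tT y hy)).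
have [_ ->] := diff_sub (flow_diff (ltW t0) Dx) (differentiable_cst x0 x0).
have -> : dif (cst x0) x0 v = 0 by rewrite difE diff_cst.
rewrite subr0 flow_dif // nrZ nr_cdec.
have -> : 432 * (r / 864) / r * nr v = 2^-1 * nr v by field; rewrite gt_eqF.
rewrite ler_pM2r // => h.
have := expR_ge1Dx (- (complex.Re w * t)) => h'.
rewrite -(pmulr_lgt0 _ t0); lra.
Qed.

End Flow.

(** * The cocycle *)

Section Cocycle.
Variables (R : realType) (X A : completeNormedModType R[i]).
Variables (mul : A -> A -> A) (one : A).
Variables (D : set X) (F : R -> X -> X) (x0 : X) (f : X -> X).
Variables (Gamma : R -> X -> A) (B : X -> A).
Hypothesis ba : banach_algebra mul one.
Hypothesis Dopen : open D.
Hypothesis sg : hol_semigroup D F.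
Hypothesis star : condition_star D F x0 f.
Hypothesis sc : semicocycle mul one D F Gamma B.

Lemma cocycle_diff t x : 0 <= t -> D x -> differentiable (Gamma t) x.
Proof. by case: sc => h _ _ _ _ t0; apply: h. Qed.
Lemma cocycleD t s x : 0 <= t -> 0 <= s -> D x ->
  mul (Gamma t (F s x)) (Gamma s x) = Gamma (t + s) x.
Proof. by case: sc => _ h _ _ _ t0 s0; apply: h. Qed.
Lemma cocycle0 x : D x -> Gamma 0 x = one.
Proof. by case: sc => _ _ _ h _; apply: h. Qed.

Lemma cocycle_derivative x t (e : R) : D x -> 0 <= t -> 0 < e ->
  exists2 d : R, 0 < d & forall s, 0 <= s -> `|s - t| < d ->
    nr (Gamma s x - Gamma t x - (s - t)%:C *: mul (B (F t x)) (Gamma t x)) <= e * `|s - t|.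
Proof.
move=> Dx t0 e0; have [_ _ _ _ [_ h]] := sc.
have {}h := h x Dx t t0; set l := mul _ _ in h *.
have hn : nbhs l (fun y => nr (y - l) < e) by apply/nbhs_nrP; exists e.
have := h _ hn; rewrite /within /= => /nbhs_ballP [d /= d0 hd].
exists d => // s s0 hs.
have [->|st] := eqVneq s t.
  by rewrite !subrr scale0r subrr nr0 normr0 mulr0.
have st0 : s - t != 0 by rewrite subr_eq0.
have := hd (s - t); rewrite /ball /= sub0r normrN => /(_ hs).
rewrite [t + _]addrC subrK => /(_ (conj st0 s0)) h2.
have sC : (s - t)%:C != 0 :> R[i] by rewrite eq_complex /= eqxx andbT.
have -> : Gamma s x - Gamma t x - (s - t)%:C *: l =
  (s - t)%:C *: ((s - t)%:C^-1 *: (Gamma s x - Gamma t x) - l).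
  by move: ((s - t)%:C) sC => c sC; lmod (R[i]) A; field.
by rewrite nrZ nrR mulrC ler_wpM2r // ltW.
Qed.

Lemma cocycle_locally_bounded x h : D x -> 0 < h -> exists C : R, forall s, 0 <= s <= h ->
  nr (Gamma s x) <= C.
Proof.
move=> Dx h0.
have := @cousin_segment R (fun a l => exists C : R, forall s, a <= s <= a + l ->
   nr (Gamma s x) <= C) 0 h h0; rewrite add0r; apply.
- move=> a l l0 [C1 h1] [C2 h2]; exists (Num.max C1 C2) => s /andP[s1 s2].
  rewrite le_max; apply/orP; case: (leP s (a + l / 2)) => sl; [left|right].
    by apply: h1; rewrite s1.
  by apply: h2; apply/andP; split; lra.
move=> t /andP[t0 th]; have [d d0 hd] := cocycle_derivative Dx t0 ltr01.
set L := mul _ _ in hd.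
exists d => // a l /andP[l0 ld] /andP[at1 at2] a0 _.
exists (nr (Gamma t x) + d * (nr L + 1)) => s /andP[s1 s2].
have st : `|s - t| < d by rewrite ltr_norml; apply/andP; split; lra.
have := hd s ltac:(lra) st.
rewrite -{2}[Gamma s x](subrK (Gamma t x)).
rewrite -{2}[Gamma s x - Gamma t x](subrK ((s - t)%:C *: L)).
set u := _ - _ *: L => hu.
apply: le_trans (nrD _ _) _; have := nrD u ((s - t)%:C *: L); rewrite nrZ nrR.
have k1 : `|s - t| * nr L <= d * nr L by rewrite ler_wpM2r ?nr_ge0 // ltW.
by lra.
Qed.

(** Uniformity in [y] is the point, since the limit at time [0] is given for each [y] separately. It
    comes from the differential equation and a bound on [B] along short orbits. *)
Lemma cocycle_near_one p : D p -> exists r d : R, [/\ 0 < r, 0 < d &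
  forall y h, nr (y - p) < r -> 0 <= h < d -> D y -> nr (one - Gamma h y) <= 2^-1].
Proof.
move=> Dp; have [r [C [d [r0 C0 d0 hD hF]]]] := flow_speed Dopen sg star Dp.
have [_ _ _ _ [hB _]] := sc.
have [r' r'0 hr'] := differentiable_nr_bound (hB p Dp).
set K := nr (B p) + 1 in hr'; have K0 : 0 < K by rewrite ltr_wpDl // nr_ge0.
pose rho := Num.min r r'.
have rho0 : 0 < rho by rewrite lt_min r0.
have [rho1 rho2] : rho <= r /\ rho <= r' by rewrite /rho !ge_min !lexx orbT.
exists (rho / 2), (Num.min d (Num.min (rho / (2 * C)) (4 * K)^-1)); split.
- by lra.
- by rewrite !lt_min d0 divr_gt0 ?mulr_gt0 // invr_gt0 mulr_gt0.
move=> y h hy /andP[h0]; rewrite !lt_min => /and3P[h1 h2 h3] Dy.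
have [->|hn] := eqVneq h 0; first by rewrite cocycle0 // subrr nr0; lra.
have hp : 0 < h by rewrite lt_neqAle eq_sym hn.
have hC : h * (2 * C) < rho by rewrite -ltr_pdivlMr // mulr_gt0.
have hK : h * (4 * K) < 1 by rewrite -ltr_pdivlMr ?mulr_gt0 // mul1r.
have Bb s : 0 <= s <= h -> nr (B (F s y)) <= K.
  move=> /andP[s0 sh]; apply: hr'; apply: le_lt_trans (nr_tri _ y _) _.
  have := hF s y ltac:(by rewrite s0; lra) ltac:(lra).
  have : C * s <= C * h by rewrite ler_wpM2l // ltW.
  by lra.
(* Bootstrap: a bound [M] for the solution bounds its derivative by [K * M]. Iterated, it replaces
   the bound [C1], which depends on [y], by [2 + C1 * 2^-1 ^+ n], hence by [2]. *)
have improve M : 0 <= M -> (forall s, 0 <= s <= h -> nr (Gamma s y) <= M) ->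
    forall s, 0 <= s <= h -> nr (Gamma s y - one) <= K * M * s.
  move=> M0 hM s /andP[s0 sh].
  have := @mean_value_bound R A (fun t => Gamma t y) (K * M) s s0 _.
  rewrite cocycle0 //; apply => t /andP[t0 ts] e e0.
  have [dl dl0 hdl] := cocycle_derivative Dy t0 e0.
  exists dl => // u /andP[u0 _] /(hdl u u0) k.
  rewrite -[Gamma u y - Gamma t y](subrK ((u - t)%:C *: mul (B (F t y)) (Gamma t y))).
  apply: le_trans (nrD _ _) _; rewrite nrZ nrR.
  have t1 : 0 <= t <= h by rewrite t0; lra.
  have k2 : nr (mul (B (F t y)) (Gamma t y)) <= K * M.
    by apply: le_trans (bnrM ba _ _) _; apply: ler_pM; rewrite ?nr_ge0 ?Bb ?hM.
  have := ler_wpM2l (normr_ge0 (u - t)) k2; lra.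
have [C1 hC1] := cocycle_locally_bounded Dy hp.
have C10 : 0 <= C1 by apply: le_trans (hC1 0 _); rewrite ?nr_ge0 // lexx ltW.
have it n : forall s, 0 <= s <= h -> nr (Gamma s y) <= 2 + C1 * 2^-1 ^+ n.
  elim: n => [|n ih] s hs; first by rewrite expr0 mulr1; have := hC1 s hs; lra.
  have p0 : 0 <= C1 * 2^-1 ^+ n by rewrite mulr_ge0 // exprn_ge0 // invr_ge0.
  rewrite exprS; move: (2^-1 ^+ n) ih p0 => z ih p0.
  have k := improve (2 + C1 * z) ltac:(lra) ih s hs; have [s0 sh] := andP hs.
  have k1 : K * s <= 4^-1.
    have : K * s <= K * h by rewrite ler_wpM2l // ltW.
    by lra.
  have k2 : K * s * (2 + C1 * z) <= 4^-1 * (2 + C1 * z) by rewrite ler_wpM2r //; lra.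
  have := nrD (Gamma s y - one) one; rewrite subrK (bnr1 ba).
  have e2 : K * (2 + C1 * z) * s = K * s * (2 + C1 * z) by ring.
  move: k; rewrite e2; lra.
have h3' s : 0 <= s <= h -> nr (Gamma s y) <= 2 + 1 * 0.
  move=> hs; apply/ler_addgt0Pr => e e0.
  have [n hn'] := @expr_small R 2^-1 (e / (C1 + 1)) ltac:(by apply/andP; split; lra)
    ltac:(by rewrite divr_gt0 //; lra).
  have := hn' n (leqnn n); rewrite ltr_pdivlMr; last by lra.
  have p0 : 0 <= (2^-1 : R) ^+ n by rewrite exprn_ge0 // invr_ge0.
  by have := it n s hs; lra.
have := improve 2 ltac:(lra) ltac:(by move=> s /h3'; lra) h ltac:(by rewrite (ltW hp) lexx).
by rewrite nrC; lra.
Qed.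

(** Over short times the cocycle is close to [one], hence invertible; Cousin's principle and the
    cocycle law assemble [Gamma t x] from finitely many such factors. *)
Lemma cocycle_invertible t x : 0 <= t -> D x -> invertible mul one (Gamma t x).
Proof.
move=> t0 Dx.
have inv1 : invertible mul one one by exists one; rewrite (ba_mul1l ba).
have [->|tn] := eqVneq t 0; first by rewrite cocycle0.
have tp : 0 < t by rewrite lt_neqAle eq_sym tn.
suff : 0 <= (0 : R) -> invertible mul one (Gamma t (F 0 x)).
  by rewrite (flow0 sg) //; apply.
apply: (@cousin_segment R (fun a l => 0 <= a -> invertible mul one (Gamma l (F a x))) 0 t tp).
  move=> a l l0 h1 h2 a0; have l2 : 0 <= l / 2 by lra.
  have -> : l = l / 2 + l / 2 by lra.
  rewrite -cocycleD //; last exact: (flow_in sg).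
  apply: (invertibleM ba); last exact: h1.
  by rewrite -(flowD sg) // addrC; apply: h2; lra.
rewrite add0r => s /andP[s0 st].
have Ds := flow_in sg s0 Dx.
have [r [d [r0 d0 hr]]] := cocycle_near_one Ds.
have [d' d'0 hd'] := flow_continuous Dopen sg star s0 Dx r0.
exists (Num.min d d') => [|a l /andP[l0]]; first by rewrite lt_min d0.
rewrite lt_min => /andP[l1 l2] /andP[as1 as2] _ _ a0.
have Fa : nr (F a x - F s x) < r.
  by apply: hd' => //; rewrite ltr_norml; apply/andP; split; lra.
have := hr (F a x) l Fa ltac:(by rewrite (ltW l0)) (flow_in sg a0 Dx).
move=> /(inverse_near_one ba)[z [z1 z2 _]]; exists z.
by move: z1 z2; rewrite subKr.
Qed.

(** At the fixed point the cocycle law becomes a semigroup law, whose generator is multiplication by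
    [B x0]. *)
Lemma cocycle_fix t : 0 <= t -> Gamma t x0 = bexp mul one (B x0) t.
Proof.
move=> t0; have Dx := Dx0 star.
have [->|tn] := eqVneq t 0; first by rewrite cocycle0 // (bexp0 ba).
have tp : 0 < t by rewrite lt_neqAle eq_sym tn.
have gen e : 0 < e -> exists2 d : R, 0 < d & forall t, 0 < t < d ->
    nr (Gamma t x0 - one - t%:C *: B x0) <= e * t.
  move=> e0; have [d d0 hd] := cocycle_derivative Dx (lexx 0) e0.
  exists d => // s /andP[s0 sd]; have := hd s (ltW s0).
  by rewrite subr0 (gtr0_norm s0) cocycle0 // (flow0 sg) // (ba_mul1r ba); apply.
have := semigroup_unique (left_generator ba gen) (left_generator ba (bexp_generator ba (B x0))).
move=> h; have := h _ _ _ t tp one; rewrite !(ba_mul1r ba); apply.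
- by move=> s _ u v; rewrite (bmulBr ba).
- move=> s s' sp sp' v; rewrite -cocycleD ?(ltW sp) ?(ltW sp') //.
  by rewrite (flow_fix Dopen sg star (ltW sp')) (ba_mulA ba).
- by move=> s s' _ _ v; rewrite -(bexpD ba) (ba_mulA ba).
Qed.

End Cocycle.

(** * Linearization *)

Lemma diff_shift (R : realType) (V W : normedModType R[i]) (g : V -> W) (w x : V) :
  differentiable g (x + w) -> differentiable (fun z => g (z + w)) x.
Proof.
move=> dg; have -> : (fun z => g (z + w)) = (fun z => g (1 *: z + w)).
  by apply: funext => z; rewrite scale1r.
by apply: (diff_affine_comp (d := 1) _).1; rewrite scale1r.
Qed.

Section Linearization.
Variables (R : realType) (X A : completeNormedModType R[i]).
Variables (mul : A -> A -> A) (one : A).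
Variables (D : set X) (F : R -> X -> X) (x0 : X) (f : X -> X) (w : R[i]).
Variables (Gamma : R -> X -> A) (B : X -> A).
Hypothesis ba : banach_algebra mul one.
Hypothesis Dopen : open D.
Hypothesis sg : hol_semigroup D F.
Hypothesis star : condition_star D F x0 f.
Hypothesis dfx0 : forall v : X, 'd f x0 v = - w *: v.
Hypothesis sc : semicocycle mul one D F Gamma B.
Local Notation E := (bexp mul one (B x0)).

(** For invertible [M] the conjugation equation at time [t] says that [pull t] fixes [M]. On [D]
    these operators form a semigroup in [t], so they commute. *)
Definition pull (t : R) (M : X -> A) (x : X) : A := mul (mul (E (- t)) (M (F t x))) (Gamma t x).

Lemma pullB t M1 M2 x : pull t (fun y => M1 y - M2 y) x = pull t M1 x - pull t M2 x.
Proof. by rewrite /pull (bmulBr ba) (bmulBl ba). Qed.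

Lemma pullD s t M x : 0 <= s -> 0 <= t -> D x -> pull s (pull t M) x = pull (t + s) M x.
Proof.
move=> s0 t0 Dx; rewrite /pull (flowD sg) // -(cocycleD sc) // opprD addrC -(bexpD ba).
by rewrite !(ba_mulA ba).
Qed.

Lemma pull0 M x : D x -> pull 0 M x = M x.
Proof.
by move=> Dx; rewrite /pull oppr0 (bexp0 ba) (flow0 sg) // (cocycle0 sc) // (ba_mul1r ba) (ba_mul1l ba).
Qed.

Lemma pull_fix t M : 0 <= t -> M x0 = one -> pull t M x0 = one.
Proof.
move=> t0 M1; rewrite /pull (flow_fix Dopen sg star t0) M1 (cocycle_fix ba Dopen sg star sc t0).
by rewrite (ba_mul1r ba) (bexpN ba _ t).2.
Qed.

Lemma pull_diff t M x : 0 <= t -> D x -> differentiable M (F t x) -> differentiable (pull t M) x.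
Proof.
move=> t0 Dx dM.
have d1 := differentiable_cst (E (- t)) x.
have [d2 _] := diff_chain (flow_diff sg t0 Dx) dM.
exact: (differentiable_mul ba (differentiable_mul ba d1 d2) (cocycle_diff sc t0 Dx)).
Qed.

Lemma pull_iter t M : 0 <= t -> (forall x, D x -> M x = pull t M x) ->
  forall n x, D x -> M x = pull (n%:R * t) M x.
Proof.
move=> t0 hM; elim=> [|n ih] x Dx; first by rewrite mul0r pull0.
have nt : 0 <= n%:R * t by rewrite mulr_ge0.
rewrite -natr1 mulrDl mul1r addrC -pullD // ih //.
congr (mul (mul _ _) _); apply: (hM); exact: (flow_in sg).
Qed.

Lemma eventually_near x (t e : R) : D x -> 0 < t -> 0 < e -> exists n : nat,
  forall s, n%:R * t <= s -> nr (F s x - x0) < e.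
Proof.
move=> Dx t0 e0; have [r r0 [_ _ h]] := uniform_generator Dopen star Dx.
have [T hT] := h e e0.
exists (Num.truncn (`|T| / t)).+1 => s hs; apply: hT; last by rewrite subrr nr0.
apply: le_trans hs; apply: le_trans (ler_norm T) _.
rewrite -ler_pdivrMr //; apply: ltW; exact: truncnS_gt.
Qed.

Hypothesis nonresonant : forall k : nat, (0 < k)%N -> forall l l' : R[i],
  spectrum mul one (B x0) l -> spectrum mul one (B x0) l' -> k%:R * w != l - l'.
Hypothesis nontrivial : exists v : X, v != 0.

(** Only finitely many degrees lie below [N], so one small time serves them all. *)
Lemma time_step N : exists2 t : R, 0 < t & forall k, (0 < k < N)%N ->
  boundedly_invertible (homological mul (E (- t)) (E t) (cdec w t) k).
Proof.
suff [dl dl0 h] : exists2 dl : R, 0 < dl & forall t k, 0 < t < dl -> (0 < k < N)%N ->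
    boundedly_invertible (homological mul (E (- t)) (E t) (cdec w t) k).
  by exists (dl / 2) => [|k kN]; [lra|apply: h kN; apply/andP; split; lra].
elim: N => [|N [dl dl0 ih]]; first by exists 1 => // t k _ /andP[].
have [->|N0] := posnP N; first by exists 1 => // t [|k] _ /andP[].
have [dl' dl'0 h'] := homological_inverse ba nonresonant N0.
exists (Num.min dl dl'); first by rewrite lt_min dl0.
move=> t k /andP[t0]; rewrite lt_min => /andP[t1 t2] /andP[k0].
rewrite ltnS leq_eqVlt => /orP[/eqP ->|kN]; first by apply: h'; rewrite t0.
by apply: ih; rewrite ?t0 ?k0.
Qed.

Lemma local_theory : exists2 t : R, 0 < t &
  (exists r M, [/\ 0 < r, forall x, nr (x - x0) < r -> D x /\ differentiable M x, M x0 = one,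
     forall x, nr (x - x0) < r -> nr (F t x - x0) <= nr (x - x0) &
     forall x, nr (x - x0) < r -> M x = pull t M x]) /\
  forall M, (forall x, D x -> differentiable M x) -> M x0 = 0 ->
    (forall x, D x -> M x = pull t M x) ->
    exists2 r : R, 0 < r & forall x, nr (x - x0) < r -> M x = 0.
Proof.
have a0 := decay_positive Dopen sg star dfx0 nontrivial.
set a := complex.Re w in a0; set b := nr (B x0); have b0 : 0 <= b by exact: nr_ge0.
have Dx := Dx0 star.
(* The product in [contr] is at most the exponential of [t * b + t * (b + 1) - N * a * t / 2],
   negative once [4 * b + 2 < N * a]: a condition free of [t]. *)
pose N := (Num.truncn ((4 * b + 2) / a)).+1.
have hN : 4 * b + 2 < N%:R * a by rewrite -ltr_pdivrMr //; exact: truncnS_gt.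
have [t t0 hom] := time_step N.
have [rD rD0 hD] := ball_in Dopen Dx.
have dF := flow_diff sg (ltW t0); have dG := cocycle_diff sc (ltW t0).
have [r1 r10 h1] := differentiable_nr_bound (dF _ Dx).
have [r2 r20 h2] := differentiable_nr_bound (dG _ Dx).
pose r := Num.min rD (Num.min r1 r2).
have r_gt0 : 0 < r by rewrite !lt_min rD0 r10.
have hr y : nr (y - x0) < r -> [/\ D y, nr (F t y) <= nr (F t x0) + 1 &
    nr (Gamma t y) <= nr (Gamma t x0) + 1].
  rewrite !lt_min => /and3P[k1 k2 k3].
  by split; [apply: hD|apply: h1|apply: h2].
have c1 : 0 <= nr (F t x0) + 1 by rewrite addr_ge0 ?nr_ge0.
have c2 : 0 <= nr (Gamma t x0) + 1 by rewrite addr_ge0 ?nr_ge0.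
pose C1 := cauchy2 R * (nr (F t x0) + 1) / r ^+ 2.
pose C2 := 864 * (nr (Gamma t x0) + 1) / r.
have C10 : 0 <= C1 by apply: divr_ge0 (exprn_ge0 _ (ltW r_gt0)); apply: mulr_ge0 (cauchy2_ge0 _) c1.
have C20 : 0 <= C2 by apply: divr_ge0 (ltW r_gt0); apply: mulr_ge0 (ler0n _ _) c2.
pose C := C1 + C2; have CC : 0 <= C by rewrite addr_ge0.
have [C1C C2C] : C1 <= C /\ C2 <= C by rewrite /C lerDl lerDr.
have r4 : 0 < r / 4 by rewrite divr_gt0.
have r4r : r / 4 <= r by lra.
pose Phi y := F t (y + x0) - x0; pose G y := Gamma t (y + x0).
have in_r y : nr y < r / 4 -> nr ((y + x0) - x0) < r by rewrite addrK => k; lra.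
have dPhi y : nr y < r / 4 -> differentiable Phi y.
  move=> /in_r/hr[Dy _ _]; apply: differentiableB (differentiable_cst _ _).
  by apply: diff_shift; exact: dF.
have dG' y : nr y < r / 4 -> differentiable G y.
  by move=> /in_r/hr[Dy _ _]; apply: diff_shift; exact: dG.
have Phi2 y : nr y < r / 4 -> nr (Phi y - cdec w t *: y) <= C * nr y ^+ 2.
  move=> hy; have := @cauchy_second_order R X X (F t) x0 y r (nr (F t x0) + 1) r_gt0 c1
    (fun z hz => ltac:(by have [/dF] := hr z hz)) (fun z hz => ltac:(by have [] := hr z hz)) hy.
  rewrite {1}(flow_fix Dopen sg star (ltW t0)) (flow_dif Dopen sg star dfx0) // [x0 + y]addrC => k.
  apply: (@le_trans _ _ (C1 * nr y ^+ 2)); first exact: k.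
  by apply: ler_wpM2r C1C; apply: exprn_ge0 (nr_ge0 _).
have G1 y : nr y < r / 4 -> nr (G y - E t) <= C * nr y.
  move=> hy; rewrite -(cocycle_fix ba Dopen sg star sc (ltW t0)).
  have := @cauchy_lipschitz R X A (Gamma t) x0 (y + x0) x0 r (nr (Gamma t x0) + 1) r_gt0
    (fun z hz => ltac:(by have [/dG] := hr z hz)) (fun z hz => ltac:(by have [] := hr z hz))
    ltac:(by rewrite addrK; lra) ltac:(by rewrite subrr nr0; lra).
  rewrite addrK => k; apply: (@le_trans _ _ (C2 * nr y)); first exact: k.
  exact: ler_wpM2r (nr_ge0 _) _ _ C2C.
(* [q] gives up half of the decay rate to absorb the quadratic part of [Phi]; [kap] leaves room
   above [nr (E t)] for nearby values of [G]. *)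
pose q := expR (- (a * t / 2)); pose kap := expR (t * (b + 1)).
have at0 : 0 < a * t by rewrite mulr_gt0.
have dq : nr (cdec w t) < q by rewrite nr_cdec ltr_expR -/a; lra.
have q1 : q < 1 by rewrite /q expR_lt1; lra.
have Epk : nr (E t) < kap.
  by apply: le_lt_trans (nr_bexp ba _ _) _; rewrite ltr_expR (gtr0_norm t0) -/b; lra.
have contr : nr (E (- t)) * kap * q ^+ N < 1.
  apply: (@le_lt_trans _ _ (expR (t * b) * kap * q ^+ N)).
    rewrite -!mulrA ler_wpM2r ?mulr_ge0 ?exprn_ge0 ?expR_ge0 //.
    by have := nr_bexp ba (B x0) (- t); rewrite normrN (gtr0_norm t0).
  rewrite /kap /q -expRM_natl -!expRD expR_lt1.
  have := mulr_gt0 t0 (_ : 0 < N%:R * a - (4 * b + 2)); rewrite subr_gt0 => /(_ hN).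
  by move: (N%:R); move=> n; nra.
have Em := (bexpN ba (B x0) t).2.
split with t => //; split.
  have [r' /andP[r'0 r'r] [M [dM M0 inv hM]]] := local_existence ba r4 CC dPhi dG' Phi2 G1 Em
    dq q1 Epk contr hom (ltn0Sn _).
  exists r', (fun x => M (x - x0)); split => //.
  - move=> x hx; split; last by apply: diff_shift; exact: dM.
    by have [] := hr x (lt_le_trans hx (le_trans r'r r4r)).
  - by rewrite subrr; exact: M0.
  - by move=> x /inv; rewrite /Phi subrK.
  - by move=> x /hM; rewrite /transfer /Phi /G subrK.
move=> M dM M0 hM.
have [] := @local_uniqueness R X A mul one ba Phi G _ _ _ _ C r4 CC Phi2 G1 N q kap
    dq q1 Epk contr hom (fun y => M (y + x0)).
- by [].
- by exists (r / 4) => // y /in_r/hr[Dy _ _]; apply: diff_shift; exact: dM.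
- by rewrite add0r.
- exists (r / 4) => // y /in_r/hr[Dy _ _].
  by rewrite hM // /transfer /Phi /G /pull subrK.
by move=> r' r'0 h; exists r' => // x /h; rewrite subrK.
Qed.

(** Every orbit enters the ball at some time [n%:R * t], and pulling [M] back from there does not
    depend on [n], since [F t] maps the ball into itself. By continuity one [n] serves a whole
    neighbourhood, which gives holomorphy. *)
Lemma pull_extend t r M : 0 < t -> 0 < r ->
  (forall x, nr (x - x0) < r -> D x /\ differentiable M x) -> M x0 = one ->
  (forall x, nr (x - x0) < r -> nr (F t x - x0) <= nr (x - x0)) ->
  (forall x, nr (x - x0) < r -> M x = pull t M x) ->
  exists M' : X -> A, [/\ holo D M', M' x0 = one & forall x, D x -> M' x = pull t M' x].
Proof.
move=> t0 r0 dM M1 inv hM.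
have nt n : 0 <= n%:R * t by rewrite mulr_ge0 // ltW.
have St n : n.+1%:R * t = t + n%:R * t by rewrite -natr1 mulrDl mul1r addrC.
pose U n x := nr (F (n%:R * t) x - x0) < r.
have stepU n x : D x -> U n x -> U n.+1 x /\ pull (n.+1%:R * t) M x = pull (n%:R * t) M x.
  move=> Dx hU; rewrite /U St; split.
    by rewrite (flowD sg) ?(ltW t0) //; apply: le_lt_trans (inv _ hU) hU.
  rewrite -(pullD M (nt n) (ltW t0) Dx); congr (mul (mul _ _) _).
  by rewrite -hM.
have step n k x : D x -> U n x -> U (n + k)%N x /\ pull ((n + k)%:R * t) M x = pull (n%:R * t) M x.
  move=> Dx hU; elim: k => [|k [ih1 ih2]]; first by rewrite addn0.
  by have [h1 h2] := stepU _ _ Dx ih1; rewrite addnS; split => //; rewrite h2.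
have same n m x : D x -> U n x -> U m x -> pull (n%:R * t) M x = pull (m%:R * t) M x.
  by move=> Dx /(step n m x Dx)[_ <-] /(step m n x Dx)[_ <-]; rewrite addnC.
have ex x : exists n, D x -> U n x.
  case: (pselect (D x)) => [Dx|]; last by exists 0%N.
  by have [n hn] := eventually_near Dx t0 r0; exists n => _; apply: hn.
pose n_ x := projT1 (cid (ex x)).
have nU x : D x -> U (n_ x) x by rewrite /n_; case: cid.
pose M' x := pull ((n_ x)%:R * t) M x.
have M'E n x : D x -> U n x -> M' x = pull (n%:R * t) M x.
  by move=> Dx hU; apply: same => //; exact: nU.
exists M'; split.
- move=> x Dx; set n := n_ x.
  have dF := flow_diff sg (nt n) Dx.
  have [rD rD0 hD] := ball_in Dopen Dx.
  have [rU rU0 hU] : exists2 d : R, 0 < d & forall y, nr (y - x) < d -> U n y.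
    have e0 : 0 < r - nr (F (n%:R * t) x - x0) by rewrite subr_gt0; exact: nU.
    have hn : nbhs (F (n%:R * t) x) (fun y => nr (y - F (n%:R * t) x) < r - nr (F (n%:R * t) x - x0)).
      by apply/nbhs_nrP; exists (r - nr (F (n%:R * t) x - x0)).
    have /nbhs_nrP[d d0 hd] := differentiable_continuous dF hn.
    exists d => // y /hd /= k; rewrite /U.
    by apply: le_lt_trans (nr_tri _ (F (n%:R * t) x) _) _; lra.
  have rr : 0 < Num.min rD rU by rewrite lt_min rD0.
  have eqV y : nr (y - x) < Num.min rD rU -> pull (n%:R * t) M y = M' y.
    by rewrite lt_min => /andP[y1 y2]; apply/esym; apply: M'E; [exact: hD|exact: hU].
  have dV := pull_diff (nt n) Dx (dM _ (nU x Dx)).2.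
  exact: (dif_local rr eqV dV).1.
- by apply: (pull_fix _ M1).
move=> x Dx; have DF := flow_in sg (ltW t0) Dx.
set n := n_ (F t x).
have hU : U n.+1 x by rewrite /U St [t + _]addrC (flowD sg) ?(ltW t0) //; exact: (nU _ DF).
by rewrite (M'E _ _ Dx hU) St [t + _]addrC -(pullD M (ltW t0) (nt n) Dx).
Qed.

(** An iterate of [F t] carries any point to where [M] vanishes, and [pull] carries the zero
    back. *)
Lemma conjugation_unique t M : 0 < t ->
  (forall M, (forall x, D x -> differentiable M x) -> M x0 = 0 ->
    (forall x, D x -> M x = pull t M x) ->
    exists2 r : R, 0 < r & forall x, nr (x - x0) < r -> M x = 0) ->
  holo D M -> M x0 = 0 -> (forall x, D x -> M x = pull t M x) -> forall x, D x -> M x = 0.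
Proof.
move=> t0 loc dM M0 hM x Dx; have [r r0 hr] := loc M dM M0 hM.
have [n hn] := eventually_near Dx t0 r0.
rewrite (pull_iter (ltW t0) hM n Dx) /pull.
by rewrite hr ?(bmul0r ba) ?(bmul0l ba) //; apply: hn.
Qed.

(** Near [x0] the values of [M] are close to [one], hence invertible; elsewhere [M x] is the product
    of an exponential, such a value, and an invertible value of [Gamma]. *)
Lemma conjugation_of_pull M : holo D M -> M x0 = one ->
  (forall t, 0 <= t -> forall x, D x -> M x = pull t M x) ->
  (forall x, D x -> invertible mul one (M x)) /\
  forall t, 0 <= t -> forall x, D x ->
    Gamma t x = mul (mul (ainv mul one (M (F t x))) (E t)) (M x).
Proof.
move=> dM M1 hM; have Dx := Dx0 star.
have hn : nbhs (M x0) (fun y => nr (y - M x0) < 2^-1).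
  by apply/nbhs_nrP; exists 2^-1 => //; rewrite invr_gt0.
have /nbhs_nrP[d d0 hd] := differentiable_continuous (dM _ Dx) hn.
have inv x : D x -> invertible mul one (M x).
  move=> Dx'; have [n hn'] := eventually_near Dx' ltr01 d0.
  have n0 : 0 <= (n%:R : R) by rewrite ler0n.
  have := hn' n%:R; rewrite mulr1 => /(_ (lexx _))/hd /=; rewrite M1 => k.
  rewrite (hM n%:R n0 x Dx'); apply: (invertibleM ba); last exact: (cocycle_invertible ba Dopen sg star sc).
  apply: (invertibleM ba).
    by exists (E n%:R); have [] := bexpN ba (B x0) n%:R.
  have := @inverse_near_one R A mul one ba (one - M (F n%:R x)).
  rewrite nrC => /(_ (ltW k))[z [z1 z2 _]].
  by exists z; move: z1 z2; rewrite subKr.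
split=> // t t0 x Dx'.
rewrite (hM t t0 x Dx') /pull -!(ba_mulA ba) (ba_mulA ba (E t)) (bexpN ba _ t).1.
have [_ h] := ainvP (inv _ (flow_in sg t0 Dx')).
by rewrite (ba_mul1l ba) (ba_mulA ba) h (ba_mul1l ba).
Qed.

Lemma pull_of_conjugation M : (forall x, D x -> invertible mul one (M x)) ->
  (forall t, 0 <= t -> forall x, D x ->
    Gamma t x = mul (mul (ainv mul one (M (F t x))) (E t)) (M x)) ->
  forall t, 0 <= t -> forall x, D x -> M x = pull t M x.
Proof.
move=> inv hG t t0 x Dx; rewrite /pull hG //.
have [h _] := ainvP (inv _ (flow_in sg t0 Dx)).
rewrite -!(ba_mulA ba) (ba_mulA ba (M (F t x))) h (ba_mul1l ba) (ba_mulA ba).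
by rewrite (bexpN ba _ t).2 (ba_mul1l ba).
Qed.

End Linearization.

Theorem theorem4p10 (R : realType) (X A : completeNormedModType R[i])
  (mul : A -> A -> A) (one : A) (D : set X) (F : R -> X -> X) (x0 : X)
  (f : X -> X) (omega : R[i]) (Gamma : R -> X -> A) (B : X -> A) :
  banach_algebra mul one ->
  is_domain D ->
  hol_semigroup D F ->
  condition_star D F x0 f ->
  (forall v : X, 'd f x0 v = - omega *: v) ->
  semicocycle mul one D F Gamma B ->
  (forall k : nat, (0 < k)%N -> forall l l' : R[i],
      spectrum mul one (B x0) l -> spectrum mul one (B x0) l' ->
      k%:R * omega != l - l') ->
  (exists M : X -> A,
      [/\ holo D M,
          forall x, D x -> invertible mul one (M x)
        & forall t, 0 <= t -> forall x, D x ->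
            Gamma t x = mul (mul (ainv mul one (M (F t x)))
                                 (aexp mul one (t%:C *: B x0))) (M x)])
  /\
  (forall M1 M2 : X -> A,
      holo D M1 -> (forall x, D x -> invertible mul one (M1 x)) ->
      M1 x0 = one ->
      (forall t, 0 <= t -> forall x, D x ->
          Gamma t x = mul (mul (ainv mul one (M1 (F t x)))
                               (aexp mul one (t%:C *: B x0))) (M1 x)) ->
      holo D M2 -> (forall x, D x -> invertible mul one (M2 x)) ->
      M2 x0 = one ->
      (forall t, 0 <= t -> forall x, D x ->
          Gamma t x = mul (mul (ainv mul one (M2 (F t x)))
                               (aexp mul one (t%:C *: B x0))) (M2 x)) ->
      forall x, D x -> M1 x = M2 x).
Proof.
move=> ba [Dopen _ _] sg star dfx0 sc nonres.
case: (pselect (exists v : X, v != 0)) => [nontriv|triv]; last first.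
  have eqx x : x = x0.
    apply/eqP; rewrite -subr_eq0; apply/negPn/negP => h.
    by apply: triv; exists (x - x0).
  split; last first.
    move=> M1 M2 _ _ M1x0 _ _ _ M2x0 _ x _.
    by rewrite (eqx x) M1x0 M2x0.
  exists (fun => one).
  have inv1 : invertible mul one one by exists one; rewrite (ba_mul1l ba).
  split; [by move=> x _; exact: differentiable_cst|by []|].
  move=> t t0 x _; have [_ h] := ainvP inv1.
  rewrite (ba_mul1r ba) in h.
  rewrite h (ba_mul1l ba) (ba_mul1r ba) (eqx x).
  exact: (cocycle_fix ba Dopen sg star sc t0).
have [t t0 [[r [M0 [r0 dM0 M01 inv hM0]]] loc]] :=
  local_theory ba Dopen sg star dfx0 sc nonres nontriv.
have uniq M1 M2 : holo D M1 -> holo D M2 -> M1 x0 = M2 x0 ->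
    (forall x, D x -> M1 x = pull mul one F x0 Gamma B t M1 x) ->
    (forall x, D x -> M2 x = pull mul one F x0 Gamma B t M2 x) ->
    forall x, D x -> M1 x = M2 x.
  move=> d1 d2 e h1 h2 x Dx'; apply/eqP; rewrite -subr_eq0; apply/eqP.
  apply: (conjugation_unique ba Dopen sg star sc (M := fun y => M1 y - M2 y) t0 loc) Dx'.
  - by move=> y Dy; apply: differentiableB; [exact: d1|exact: d2].
  - by rewrite e subrr.
  - by move=> y Dy; rewrite (pullB _ _ _ _ ba) -h1 // -h2.
split.
  have [M [dM M1 hM]] := pull_extend ba Dopen sg star sc t0 r0 dM0 M01 inv hM0.
  have hMt s : 0 <= s -> forall x, D x -> M x = pull mul one F x0 Gamma B s M x.
    move=> s0; apply: (uniq _ _ dM) => //.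
    - move=> x Dx'; apply: (pull_diff _ ba sg sc s0 Dx'); apply: dM.
      exact: (flow_in sg s0 Dx').
    - by rewrite (pull_fix ba Dopen sg star sc s0 M1).
    (* [pull t] fixes [pull s M] because the two operators commute. *)
    move=> x Dx'; rewrite (pullD _ ba sg sc M (ltW t0) s0 Dx') addrC.
    rewrite -(pullD _ ba sg sc M s0 (ltW t0) Dx'); congr (mul (mul _ _) _).
    exact: (hM _ (flow_in sg s0 Dx')).
  have [inv' h] := conjugation_of_pull ba Dopen sg star sc dM M1 hMt.
  by exists M.
move=> M1 M2 d1 i1 e1 h1 d2 i2 e2 h2; apply: uniq => //.
- by rewrite e1 e2.
- exact: (pull_of_conjugation ba sg i1 h1 (ltW t0)).
- exact: (pull_of_conjugation ba sg i2 h2 (ltW t0)).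
Qed.
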